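(* Let $d$ be an odd integer with $3\le d\le 1999$, and let $m\ge 1$ be an integer. There exists an $m$-stiff configuration in $S^{d-1}$ if and only if $m\in\{1,2,3\}$ or $(d,m)\in\{(23,4),(241,4),(241,5),(1079,5)\}$.
   Context: $S^{d-1}$ is the unit sphere in $\mathbb{R}^d$ with standard inner product $\langle\cdot,\cdot\rangle$. A spherical $t$-design is a finite (nonempty) subset $X\subset S^{d-1}$ such that $\frac{1}{|X|}\sum_{x\in X} f(x)=\frac{1}{|S^{d-1}|}\int_{S^{d-1}} f(x)\,dx$ for every polynomial $f$ in $d$ variables of degree at most $t$, where $|S^{d-1}|$ is the surface volume of $S^{d-1}$. For positive integers $m,d$, a finite subset $X\subset S^{d-1}$ is called an $m$-stiff configuration if it is a spherical $(2m-1)$-design and there exists $z\in S^{d-1}$ such that the set $D(z,X)=\{\langle z,x\rangle : x\in X\}$ has at most $m$ elements. *)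

(* Defs.v *)
From mathcomp Require Import all_boot all_order all_algebra finmap.
From mathcomp Require Import all_classical all_reals all_analysis.
From mathcomp Require Import -(notations) mpoly.

Set Implicit Arguments.
Unset Strict Implicit.
Unset Printing Implicit Defensive.

Import Order.TTheory GRing.Theory Num.Theory.

Local Open Scope classical_set_scope.
Local Open Scope ring_scope.

Definition dotp {R : realType} {d : nat} (x y : 'rV[R]_d) : R :=
  \sum_(i < d) x 0 i * y 0 i.

(* The norm that the library puts on ['rV[R]_d] is the sup norm, hence the
   Euclidean condition <x, x> = 1 instead of [`|x| = 1]. *)
Definition unit_sphere (R : realType) (d : nat) : set 'rV[R]_d :=
  [set x | dotp x x = 1].

Arguments unit_sphere : clear implicits.

(* Surface integral over the unit sphere of R^d, in spherical coordinates:
   S^0 = {1, -1} carries the counting measure, and writing a point of S^(k+1)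
   as (cos t, sin t * y) with 0 <= t <= pi and y in S^k, the area element of
   S^(k+1) is sin(t)^k dt dy. *)
Fixpoint sphere_integral {R : realType} (d : nat) : ('rV[R]_d -> R) -> R :=
  match d return ('rV[R]_d -> R) -> R with
  | 0 => fun=> 0
  | d'.+1 =>
    match d' return (('rV[R]_d' -> R) -> R) -> ('rV[R]_d'.+1 -> R) -> R with
    | 0 => fun _ f => f (const_mx 1) + f (const_mx (-1))
    | k.+1 => fun integral_Sk f =>
        \int[lebesgue_measure]_(t in `[0, pi])
          (sin t ^+ k *
           integral_Sk (fun y =>
             f (row_mx (const_mx (cos t) : 'rV_1) (sin t *: y))))
    end (@sphere_integral R d')
  end.

Definition sphere_area (R : realType) (d : nat) : R :=
  sphere_integral (fun _ : 'rV[R]_d => 1).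

Definition poly_fun {R : realType} {d : nat} (p : mpoly.mpoly d R)
    (x : 'rV[R]_d) : R :=
  mpoly.meval (fun i => x 0 i) p.

(* [msize p] is the total degree of [p] plus one (and [0] if [p = 0]). *)
Definition spherical_design {R : realType} {d : nat} (t : nat)
    (X : {fset 'rV[R]_d}) : Prop :=
  [/\ X != fset0,
      [set` X] `<=` unit_sphere R d
    & forall p : mpoly.mpoly d R, (mpoly.msize p <= t.+1)%N ->
        (#|` X|%:R)^-1 * \sum_(x <- X) poly_fun p x
        = (sphere_area R d)^-1 * sphere_integral (poly_fun p)].

Definition inner_products {R : realType} {d : nat} (z : 'rV[R]_d)
    (X : {fset 'rV[R]_d}) : {fset R} :=
  [fset dotp z x | x in X]%fset.

Definition stiff_configuration {R : realType} {d : nat} (m : nat)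
    (X : {fset 'rV[R]_d}) : Prop :=
  spherical_design (2 * m - 1)%N X /\
  exists2 z : 'rV[R]_d, unit_sphere R d z & (#|` inner_products z X| <= m)%N.

(* Main.v *)
Require Import Defs.
From Stdlib Require Import BinNat.
From mathcomp Require Import all_boot all_order all_algebra finmap.
From mathcomp Require Import all_classical all_reals all_analysis.
From mathcomp Require Import -(notations) mpoly.
From mathcomp Require polyrcf.
From mathcomp Require Import ring lra zify.

Set Implicit Arguments.
Unset Strict Implicit.
Unset Printing Implicit Defensive.

Import Order.TTheory GRing.Theory Num.Theory.
Import numFieldNormedType.Exports.

Local Open Scope classical_set_scope.
Local Open Scope ring_scope.

(** An average over the sphere of a power of [<z, x>] is an explicit rational
    multiple of a power of [|z|], and designs are detected by these averages.
    Sorting the points of an m-stiff configuration X by [t = <z, x>] therefore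
    gives a quadrature formula of degree 2m - 1 for the weight
    (1 - t^2)^((d-3)/2), with at most m nodes and integer weights: the nodes are
    the zeros of the Gegenbauer polynomial P of degree m.

    Existence: whenever the Gauss weights at these zeros are rational, X is a
    union of slices [t = const] filled with designs of the next smaller sphere;
    those are built in the same way, starting from rotated dodecagons in the
    plane, with all weights scaled to integers.

    Nonexistence: two nodes with the same weight have the same square, and the
    nodes of a given weight v are the common zeros of P and a rational
    combination of P' and the numerator polynomial of the quadrature, so every
    t^2 is rational. If a prime p > m divides exactly one of the factors
    2m + d - 2 - 2 rho (2 <= rho <= m/2) entering the coefficients of P, and does
    so v times, the p-adic Newton polygon of P in t^2 has a segment of width rho
    and height v, so rho divides v. For m >= 6 some such prime contradicts this:
    by Erdos' proof of Bertrand's postulate for large m, by a chain of primes for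
    medium m and by inspection for m < 40, up to four pairs (d, m) whose p-adic
    Newton polygon, for p = 3 or 5, is excluded separately. For m = 4 and m = 5
    the polynomial is quadratic in t^2, and its discriminant must be a square:
    24 (d+1)(d+2), respectively 40 (d+1)(d+4), up to squares. *)

(** * Integration over the sphere *)

Section TrigMoments.
Variable R : realType.
Implicit Types (f F : R -> R) (a b : nat).

Lemma continuous_integrable_0pi f : continuous f ->
  (@lebesgue_measure R).-integrable `[0, pi] (EFin \o f).
Proof.
move=> cf; apply: continuous_compact_integrable; first exact: segment_compact.
exact: continuous_subspaceT.
Qed.

Lemma Rintegral_0pi_derive f F :
    (forall x : R, is_derive x 1 F (f x)) -> continuous f ->
  \int[lebesgue_measure]_(t in `[0, pi]) f t = F pi - F 0.
Proof.
move=> dF cf; rewrite /Rintegral (@continuous_FTC2 _ f F) //.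
- exact: pi_gt0.
- exact: continuous_subspaceT.
- have cF (x : R) : {for x, continuous F}.
    by apply: differentiable_continuous; apply/derivable1_diffP; case: (dF x).
  split.
  + by move=> x _; case: (dF x).
  + exact: cvg_at_right_filter (cF 0).
  + exact: cvg_at_left_filter (cF pi).
- by move=> x _; rewrite derive1E; case: (dF x).
Qed.

Let mulRE (u v : R) : u *: (v : R^o) = u * v. Proof. by []. Qed.

Definition trigmom a b : R :=
  \int[lebesgue_measure]_(t in `[0, pi]) (cos t ^+ a * sin t ^+ b).

Lemma continuous_cosXsinX a b : continuous (fun t : R => cos t ^+ a * sin t ^+ b).
Proof.
move=> t; apply: (@continuousM _ R (fun t => cos t ^+ a) (fun t => sin t ^+ b)).
  by apply: (@continuous_comp _ _ _ cos (fun x => x ^+ a)); [exact: continuous_cos|exact: exprn_continuous].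
by apply: (@continuous_comp _ _ _ sin (fun x => x ^+ b)); [exact: continuous_sin|exact: exprn_continuous].
Qed.

Lemma trigmom_integrable a b :
  (@lebesgue_measure R).-integrable `[0, pi]
    (EFin \o (fun t => cos t ^+ a * sin t ^+ b)).
Proof. exact/continuous_integrable_0pi/continuous_cosXsinX. Qed.

Lemma trigmom_sin2 a b : trigmom a b.+2 = trigmom a b - trigmom a.+2 b.
Proof.
rewrite /trigmom -RintegralB//; try exact: trigmom_integrable.
apply: eq_Rintegral => t _; have := cos2Dsin2 t => e.
rewrite -[sin t ^+ b.+2]/(sin t ^+ (2 + b)) -[cos t ^+ a.+2]/(cos t ^+ (2 + a)) !exprD.
have -> : sin t ^+ 2 = 1 - cos t ^+ 2 by rewrite -e; ring.
ring.
Qed.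

(** Integration by parts: the derivative of cos^(a+1) sin^(b+1) has integral zero, since sin
    vanishes at 0 and pi. *)
Lemma trigmom_recl a b :
  (a + b + 2)%:R * trigmom a.+2 b = (a.+1)%:R * trigmom a b.
Proof.
pose f t : R := (b.+1)%:R * (cos t ^+ a.+2 * sin t ^+ b) -
  (a.+1)%:R * (cos t ^+ a * sin t ^+ b.+2).
have dF (x : R) : is_derive x 1 ((cos : R -> R) ^+ a.+1 * (sin : R -> R) ^+ b.+1) (f x).
  apply: is_derive_eq.
  rewrite !fctE.
  rewrite /f !mulRE !succnK !exprS; ring.
have cM c i j : continuous (fun t : R => c * (cos t ^+ i * sin t ^+ j)).
  by move=> t; apply: cvgM; [exact: cvg_cst|exact: continuous_cosXsinX].
have cf : continuous f by move=> t; apply: cvgB; exact: cM.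
have := Rintegral_0pi_derive dF cf.
rewrite !fctE sinpi sin0 !expr0n !mulr0 subr0.
rewrite RintegralB//; try exact/continuous_integrable_0pi/cM.
rewrite !RintegralZl//; try exact: trigmom_integrable.
rewrite -/(trigmom _ _) -/(trigmom _ _) trigmom_sin2 -!natr1 !natrD => e.
apply/eqP; rewrite -subr_eq0 -e; apply/eqP; ring.
Qed.

Lemma trigmom1 b : trigmom 1 b = 0.
Proof.
have dF (x : R) : is_derive x 1 ((b.+1)%:R^-1 *: (sin : R -> R) ^+ b.+1)
    (cos x ^+ 1 * sin x ^+ b).
  apply: is_derive_eq; rewrite !mulRE !succnK expr1.
  by rewrite !mulrA mulVf ?pnatr_eq0 // mul1r mulrC.
rewrite /trigmom (Rintegral_0pi_derive dF); last exact: continuous_cosXsinX.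
by rewrite !fctE sinpi sin0 !expr0n !scaler0 subr0.
Qed.

(** Induction in steps of two, from the integrals of 1 and of sin, by the two recursions above. *)
Lemma trigmom0_gt0 b : 0 < trigmom 0 b.
Proof.
elim/ltn_ind: b => -[|[|b]] IH.
- rewrite /trigmom.
  under eq_Rintegral do rewrite !expr0 mulr1.
  rewrite (@Rintegral_0pi_derive (fun=> 1) id) ?subr0 ?pi_gt0 //.
  exact: cst_continuous.
- rewrite /trigmom.
  under eq_Rintegral do rewrite expr0 mul1r expr1.
  have dF (x : R) : is_derive x 1 (- (cos : R -> R)) (sin x).
    by apply: is_derive_eq; rewrite opprK.
  rewrite (Rintegral_0pi_derive dF); last exact: continuous_sin.
  by rewrite !fctE cospi cos0; lra.
- have := trigmom_recl 0 b; rewrite mulr1n mul1r add0n addn2 => e.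
  rewrite trigmom_sin2; have h := IH b (ltnW (ltnSn _)).
  have -> : trigmom 0 b - trigmom 2 b = (b.+1)%:R * trigmom 2 b.
    by rewrite -e -natr1 mulrDl mul1r addrK.
  by rewrite mulr_gt0 ?ltr0n // -(pmulr_rgt0 _ (ltr0Sn _ b.+1)) e.
Qed.

End TrigMoments.

(** * Moments of a linear form on the sphere, and their behaviour under slicing *)

Section SphereMoments.
Variable R : realType.

(** The average of <z, x>^k over the unit sphere of R^d, for a unit vector z; see
    [sphere_integral_dotpX]. *)
Definition sphmom (d k : nat) : R :=
  if odd k then 0 else \prod_(i < k./2) ((2 * i + 1)%:R / (d + 2 * i)%:R).

Lemma sphmom_odd d k : odd k -> sphmom d k = 0.
Proof. by rewrite /sphmom => ->. Qed.

Lemma sphmom0 d : sphmom d 0 = 1.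
Proof. by rewrite /sphmom big_ord0. Qed.

Lemma sphmom_recl d k : (0 < d)%N ->
  (d + k)%:R * sphmom d k.+2 = (k.+1)%:R * sphmom d k.
Proof.
move=> d0; rewrite /sphmom /= negbK; case: ifPn => [_|ek]; first by rewrite !mulr0.
rewrite big_ord_recr /= mulrCA [RHS]mulrC; congr (_ * _).
have -> : (2 * k./2 = k)%N by rewrite mul2n even_halfK.
by rewrite mulrC divfK ?addn1 // pnatr_eq0 -lt0n ltn_addr.
Qed.

Lemma sphmomSS d k : (0 < d)%N ->
  sphmom d k.+2 = (k.+1)%:R / (d + k)%:R * sphmom d k.
Proof.
move=> d0; have dk : (d + k)%:R != 0 :> R by rewrite pnatr_eq0 -lt0n ltn_addr.
by apply: (mulfI dk); rewrite sphmom_recl // mulrA [_ / _]mulrC mulVKf.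
Qed.

(** The double factorial (2l - 1)!!, numerator of [sphmom d (2 * l)]; the denominator is the product
    d (d + 2) ... (d + 2l - 2) that follows. *)
Let oddfact l : R := \prod_(i < l) (2 * i + 1)%:R.
Let pochhammer2 d l : R := \prod_(i < l) (d + 2 * i)%:R.

Let pochhammer2_neq0 d l : (0 < d)%N -> pochhammer2 d l != 0.
Proof.
by move=> d0; rewrite prodf_seq_neq0; apply/allP => i _; rewrite /= pnatr_eq0 -lt0n ltn_addr.
Qed.

Let sphmom_even d l : sphmom d (2 * l) = oddfact l / pochhammer2 d l.
Proof.
rewrite /sphmom oddM /= mul2n doubleK /oddfact /pochhammer2 -prodfV -big_split.
by [].
Qed.

Let oddfactE l : oddfact l * (l`! * 2 ^ l)%:R = (2 * l)`!%:R.
Proof.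
elim: l => [|l IH]; first by rewrite /oddfact big_ord0 mul1r.
rewrite /oddfact big_ord_recr /= -/(oddfact l).
have -> : (2 * l.+1 = (2 * l).+2)%N by lia.
have -> : ((2 * l).+2)`!%:R = (2 * l + 2)%:R * ((2 * l + 1)%:R * (2 * l)`!%:R) :> R.
  by rewrite !factS -!natrM addn1 addn2.
have -> : (l.+1`! * 2 ^ l.+1)%:R = (2 * l + 2)%:R * (l`! * 2 ^ l)%:R :> R.
  by rewrite -natrM factS expnS; congr (_%:R); ring.
rewrite -IH; ring.
Qed.

(** Since (2l - 1)!! = (2l)! / (l! 2^l), both sides are quotients of factorials and powers of 2. *)
Let oddfact_bin l j : (j <= l)%N ->
  'C(2 * l, 2 * j)%:R * oddfact (l - j) * oddfact j = 'C(l, j)%:R * oddfact l.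
Proof.
move=> jl; have h1 := bin_fact jl.
have h2 : (2 * j <= 2 * l)%N by rewrite leq_mul2l jl orbT.
have := bin_fact h2; rewrite -mulnBr => {}h2.
have f0 n : (n`!)%:R != 0 :> R by rewrite pnatr_eq0 -lt0n fact_gt0.
have p0 n : (2 ^ n)%:R != 0 :> R by rewrite pnatr_eq0 expn_eq0.
have e1 : oddfact j = (2 * j)`!%:R / (j`!%:R * (2 ^ j)%:R).
  by rewrite -oddfactE natrM mulfK // mulf_neq0.
have e2 : oddfact (l - j) = (2 * (l - j))`!%:R / ((l - j)`!%:R * (2 ^ (l - j))%:R).
  by rewrite -oddfactE natrM mulfK // mulf_neq0.
have e3 : oddfact l = (2 * l)`!%:R / (l`!%:R * (2 ^ l)%:R).
  by rewrite -oddfactE natrM mulfK // mulf_neq0.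
rewrite e1 e2 e3 -h2 -h1 -[in (2 ^ l)%N](subnK jl) expnD !natrM.
have c0 : 'C(l, j)%:R != 0 :> R by rewrite pnatr_eq0 -lt0n bin_gt0.
by field; rewrite !f0 !p0 c0.
Qed.

Lemma sum_even_index l (F : nat -> R) : (forall j, odd j -> F j = 0) ->
  \sum_(j < (2 * l).+1) F j = \sum_(j < l.+1) F (2 * j)%N.
Proof.
move=> F0; elim: l => [|l IH]; first by rewrite !big_ord_recr !big_ord0.
rewrite [RHS]big_ord_recr /= -IH.
have -> : (2 * l.+1 = (2 * l).+2)%N by lia.
rewrite big_ord_recr big_ord_recr /= F0 ?addr0 //.
by rewrite /= oddM.
Qed.

(* [E a j] stands for the average of t^a (1 - t^2)^(j/2) over the first
   coordinate t of a uniform point of S^n. *)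
Lemma slice_moments n (tau : nat) (E : nat -> nat -> R) (x q : R) k :
    (0 < n)%N -> (k <= tau)%N ->
    (forall a j, (a + j.+2 <= tau)%N -> E a j.+2 = E a j - E a.+2 j) ->
    (forall a, (a <= tau)%N -> E a 0 = sphmom n.+1 a) ->
  \sum_(j < k.+1) 'C(k, j)%:R * x ^+ (k - j) * E (k - j)%N j
      * (sphmom n j * q ^+ j./2)
    = sphmom n.+1 k * (x ^+ 2 + q) ^+ k./2.
Proof.
move=> n0 ktau Erec E0.
have Eodd j a : odd a -> ~~ odd j -> (a + j <= tau)%N -> E a j = 0.
  elim/ltn_ind: j a => -[|[|j]] IH a // oa ej h.
    by rewrite E0 ?sphmom_odd // -(addn0 a).
  have ej' : ~~ odd j by move: ej; rewrite /= negbK.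
  rewrite Erec // (IH j) ?(IH j) ?subrr //=; [by rewrite negbK|lia|lia].
(* The recursion lowers the second index by two, down to the known values [E a 0]. *)
have Eeven j a : (2 * a + 2 * j <= tau)%N ->
  E (2 * a)%N (2 * j)%N
  = oddfact a * pochhammer2 n j / pochhammer2 n.+1 (a + j).
  elim: j a => [|j IH] a h.
    rewrite muln0 E0 ?sphmom_even ?addn0; last lia.
    by rewrite /(pochhammer2 n 0) big_ord0 mulr1.
  have -> : (2 * j.+1 = (2 * j).+2)%N by lia.
  rewrite Erec; last lia.
  have -> : ((2 * a).+2 = 2 * a.+1)%N by lia.
  rewrite !IH; [|lia|lia].
  rewrite addSn addnS.
  have -> : oddfact a.+1 = oddfact a * (2 * a + 1)%:R by rewrite /oddfact big_ord_recr.
  have -> : pochhammer2 n j.+1 = pochhammer2 n j * (n + 2 * j)%:R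
    by rewrite /pochhammer2 big_ord_recr.
  have -> : pochhammer2 n.+1 (a + j).+1 = pochhammer2 n.+1 (a + j) * (n.+1 + 2 * (a + j))%:R
    by rewrite /pochhammer2 big_ord_recr.
  have := pochhammer2_neq0 (a + j) (ltn0Sn n).
  have : (n.+1 + 2 * (a + j))%:R != 0 :> R by rewrite pnatr_eq0.
  have -> : (n.+1 + 2 * (a + j) = (n + 2 * j) + (2 * a + 1))%N by lia.
  rewrite natrD => h1 h2.
  move: ((n + 2 * j)%:R : R) ((2 * a + 1)%:R : R) h1 => u v h1; field.
  by rewrite h1 h2.
have [ok|ek] := boolP (odd k).
  rewrite (sphmom_odd _ ok) mul0r big1 // => j _.
  have [oj|ej] := boolP (odd j); first by rewrite (sphmom_odd _ oj) mul0r mulr0.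
  have jk : (j <= k)%N by rewrite -ltnS.
  by rewrite Eodd ?mulr0 ?mul0r ?subnK // oddB // ok (negbTE ej).
rewrite -(even_halfK ek) -mul2n; set l := k./2.
have lt : (2 * l <= tau)%N by rewrite mul2n even_halfK.
(* Terms of odd index vanish. In the others the double factorials turn C(2l, 2j) into C(l, j), which
   leaves the binomial expansion of (x^2 + q)^l. *)
rewrite (@sum_even_index _ (fun j => 'C(2 * l, j)%:R * x ^+ (2 * l - j) *
  E (2 * l - j)%N j * (sphmom n j * q ^+ j./2))); last first.
  by move=> j oj; rewrite (sphmom_odd _ oj) mul0r mulr0.
rewrite mul2n doubleK -mul2n exprDn sphmom_even mulr_sumr.
apply: eq_bigr => j _; have jl : (j <= l)%N by rewrite -ltnS.
rewrite -mulnBr Eeven; last by rewrite -mulnDr subnK.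
have -> : ((2 * j)./2 = j)%N by rewrite mul2n doubleK.
rewrite subnK // sphmom_even exprM -mulr_natl.
transitivity ('C(2 * l, 2 * j)%:R * oddfact (l - j) * oddfact j / pochhammer2 n.+1 l *
  ((x ^+ 2) ^+ (l - j) * q ^+ j)); last by rewrite oddfact_bin //; ring.
by field; rewrite !pochhammer2_neq0.
Qed.

End SphereMoments.

(** * The integral of a polynomial and of a power of a linear form *)

Section SphereIntegral.
Variable R : realType.

Definition slice_point k (c : R) (y : 'rV[R]_k.+1) : 'rV[R]_k.+2 :=
  row_mx (const_mx c : 'rV_1) y.

Lemma sphere_integralS k (f : 'rV[R]_k.+2 -> R) :
  sphere_integral f = \int[lebesgue_measure]_(t in `[0, pi])
    (sin t ^+ k * sphere_integral (fun y : 'rV[R]_k.+1 =>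
      f (slice_point (cos t) (sin t *: y)))).
Proof. by []. Qed.

Lemma Rintegral_trig_sum (I : Type) (r : seq I) (c : I -> R) (a b : I -> nat) :
  \int[lebesgue_measure]_(t in `[0, pi])
     (\sum_(s <- r) c s * (cos t ^+ a s * sin t ^+ b s))
  = \sum_(s <- r) c s * trigmom R (a s) (b s).
Proof.
have cM c' i j : continuous (fun t : R => c' * (cos t ^+ i * sin t ^+ j)).
  by move=> t; apply: cvgM; [exact: cvg_cst|exact: continuous_cosXsinX].
elim: r => [|s r IH].
  under eq_Rintegral do rewrite big_nil.
  by rewrite big_nil Rintegral_cst //= mul0r.
under eq_Rintegral do rewrite big_cons.
have cS r' : continuous (fun t : R => \sum_(s <- r') c s * (cos t ^+ a s * sin t ^+ b s)).
  elim: r' => [|s' r' IH'] t.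
    by under eq_fun do rewrite big_nil; exact: cvg_cst.
  under eq_fun do rewrite big_cons.
  by apply: cvgD; [exact: cM|exact: IH'].
rewrite RintegralD //; try exact: continuous_integrable_0pi.
rewrite IH big_cons RintegralZl //; exact: trigmom_integrable.
Qed.

Lemma slice_coord0 k (c : R) (y : 'rV[R]_k.+1) :
  slice_point c y 0 ord0 = c.
Proof.
have -> : (ord0 : 'I_k.+2) = lshift k.+1 (ord0 : 'I_1) by apply: val_inj.
by rewrite (row_mxEl (const_mx c : 'rV_1) y) mxE.
Qed.

Lemma slice_coordS k (c : R) (y : 'rV[R]_k.+1) i :
  slice_point c y 0 (lift ord0 i) = y 0 i.
Proof.
have -> : (lift ord0 i : 'I_k.+2) = rshift 1 i by apply: val_inj.
by rewrite (row_mxEr (const_mx c : 'rV_1) y).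
Qed.

(** Linearity requires integrability, which is at hand for sums of monomials: slicing turns each
    into cos^a sin^b times an integral over the smaller sphere. *)
Lemma sphere_integral_monomial_sum d (I : Type) (r : seq I) (c : I -> R)
    (e : I -> 'I_d -> nat) :
  sphere_integral (fun x : 'rV[R]_d => \sum_(s <- r) c s * \prod_i x 0 i ^+ e s i)
  = \sum_(s <- r) c s * sphere_integral (fun x : 'rV[R]_d => \prod_i x 0 i ^+ e s i).
Proof.
case: d e => [|d] e; first by rewrite big1 //= => s _; rewrite mulr0.
elim: d I r c e => [|k IH] I r c e.
  rewrite /sphere_integral /= -big_split /=; apply: eq_bigr => s _.
  by rewrite mulrDr.
have mono s t (y : 'rV[R]_k.+1) :
  \prod_i slice_point (cos t) (sin t *: y) 0 i ^+ e s i =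
  cos t ^+ e s ord0 * sin t ^+ (\sum_(i < k.+1) e s (lift ord0 i)) *
  \prod_i y 0 i ^+ e s (lift ord0 i).
  rewrite [LHS]big_ord_recl slice_coord0 -mulrA; congr (_ * _).
  rewrite -prodrXr -big_split /=; apply: eq_bigr => i _.
  by rewrite slice_coordS mxE exprMn.
pose E s := \sum_(i < k.+1) e s (lift ord0 i).
pose J s := sphere_integral (fun y : 'rV[R]_k.+1 => \prod_i y 0 i ^+ e s (lift ord0 i)).
have Jc s t : sphere_integral (fun y : 'rV[R]_k.+1 =>
    \prod_i slice_point (cos t) (sin t *: y) 0 i ^+ e s i)
    = cos t ^+ e s ord0 * sin t ^+ E s * J s.
  have := IH unit [:: tt] (fun=> cos t ^+ e s ord0 * sin t ^+ E s)
    (fun=> fun i => e s (lift ord0 i)).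
  rewrite big_cons big_nil addr0 => <-; congr sphere_integral; apply/funext => y.
  by rewrite big_cons big_nil addr0 mono.
have -> : sphere_integral (fun x : 'rV[R]_k.+2 => \sum_(s <- r) c s * \prod_i x 0 i ^+ e s i)
  = \sum_(s <- r) (c s * J s) * trigmom R (e s ord0) (k + E s).
  rewrite sphere_integralS -Rintegral_trig_sum; apply: eq_Rintegral => t _.
  have -> : (fun y : 'rV[R]_k.+1 => \sum_(s <- r) c s *
     \prod_i slice_point (cos t) (sin t *: y) 0 i ^+ e s i) =
    (fun y => \sum_(s <- r) (c s * (cos t ^+ e s ord0 * sin t ^+ E s)) *
       \prod_i y 0 i ^+ e s (lift ord0 i)).
    by apply/funext => y; apply: eq_bigr => s _; rewrite mono mulrA.
  rewrite IH mulr_sumr; apply: eq_bigr => s _; rewrite -/(J s) exprD; ring.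
apply: eq_bigr => s _; rewrite sphere_integralS -mulrA; congr (_ * _).
under eq_Rintegral do rewrite Jc.
have := Rintegral_trig_sum [:: s] J (fun s => e s ord0) (fun s => k + E s)%N.
rewrite big_cons big_nil addr0 => <-; apply: eq_Rintegral => t _.
rewrite big_cons big_nil addr0 exprD; ring.
Qed.

(** The free bound [k] allows several polynomials to be expanded over one index set. *)
Lemma sphere_integral_poly_fun d k (p : mpoly.mpoly d R) :
  (mpoly.msize p <= k)%N ->
  sphere_integral (poly_fun p) =
    \sum_(m : mpoly.bmultinom d k)
      mpoly.mcoeff (mpoly.bmnm m) p * sphere_integral (poly_fun (mpoly.mpolyX R (mpoly.bmnm m))).
Proof.
move=> pk.
have -> : poly_fun p = fun x : 'rV[R]_d => \sum_(m : mpoly.bmultinom d k)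
    mpoly.mcoeff (mpoly.bmnm m) p * \prod_i x 0 i ^+ mpoly.fun_of_multinom (mpoly.bmnm m) i.
  apply/funext => x; rewrite /poly_fun {1}(mpoly.mpolywE pk) raddf_sum /=.
  by apply: eq_bigr => m _; rewrite mpoly.mevalZ mpoly.mevalX.
rewrite sphere_integral_monomial_sum; apply: eq_bigr => m _; congr (_ * _).
by congr sphere_integral; apply/funext => x; rewrite /poly_fun mpoly.mevalX.
Qed.

Lemma sphere_integralD d (p q : mpoly.mpoly d R) :
  sphere_integral (poly_fun (p + q)) =
  sphere_integral (poly_fun p) + sphere_integral (poly_fun q).
Proof.
pose k := maxn (mpoly.msize (p + q)) (maxn (mpoly.msize p) (mpoly.msize q)).
rewrite (@sphere_integral_poly_fun _ k (p + q)) ?leq_maxl //.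
rewrite (@sphere_integral_poly_fun _ k p) ?leq_max ?leqnn ?orbT //.
rewrite (@sphere_integral_poly_fun _ k q) ?leq_max ?leqnn ?orbT //.
rewrite -big_split /=; apply: eq_bigr => m _.
by rewrite mpoly.mcoeffD mulrDl.
Qed.

Lemma sphere_integralZ d a (p : mpoly.mpoly d R) :
  sphere_integral (poly_fun (a *: p)) = a * sphere_integral (poly_fun p).
Proof.
pose k := maxn (mpoly.msize (a *: p)) (mpoly.msize p).
rewrite (@sphere_integral_poly_fun _ k (a *: p)) ?leq_maxl //.
rewrite (@sphere_integral_poly_fun _ k p) ?leq_max ?leqnn ?orbT //.
rewrite mulr_sumr; apply: eq_bigr => m _.
by rewrite mpoly.mcoeffZ mulrA.
Qed.

Lemma sphere_integral_sum d (I : Type) (r : seq I) (F : I -> mpoly.mpoly d R) :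
  sphere_integral (poly_fun (\sum_(i <- r) F i)) =
  \sum_(i <- r) sphere_integral (poly_fun (F i)).
Proof.
apply: (big_morph (fun p => sphere_integral (poly_fun p))).
  exact: sphere_integralD.
by rewrite -[0 in LHS](scale0r 0) sphere_integralZ mul0r.
Qed.

Definition linear_form d (z : 'rV[R]_d) : mpoly.mpoly d R :=
  \sum_i z 0 i *: mpoly.mpolyX R (mpoly.mnm1 i).

Lemma poly_fun_linear_form d (z : 'rV[R]_d) : poly_fun (linear_form z) = dotp z.
Proof.
apply/funext => x; rewrite /poly_fun raddf_sum; apply: eq_bigr => i _.
by rewrite /= mpoly.mevalZ mpoly.mevalXU.
Qed.

Lemma poly_funX d (p : mpoly.mpoly d R) k :
  poly_fun (p ^+ k) = fun x => poly_fun p x ^+ k.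
Proof. by apply/funext => x; rewrite /poly_fun rmorphXn. Qed.

Lemma poly_funD d (p q : mpoly.mpoly d R) x :
  poly_fun (p + q) x = poly_fun p x + poly_fun q x.
Proof. by rewrite /poly_fun rmorphD. Qed.

Lemma poly_funZ d a (p : mpoly.mpoly d R) x : poly_fun (a *: p) x = a * poly_fun p x.
Proof. by rewrite /poly_fun mpoly.mevalZ. Qed.

Definition tail_row k (z : 'rV[R]_k.+2) : 'rV[R]_k.+1 := \row_i z 0 (lift ord0 i).

Lemma dotp_slice k (z : 'rV[R]_k.+2) c (y : 'rV[R]_k.+1) :
  dotp z (slice_point c y) = z 0 ord0 * c + dotp (tail_row z) y.
Proof.
rewrite {1}/dotp big_ord_recl slice_coord0; congr (_ + _).
by apply: eq_bigr => i _; rewrite slice_coordS mxE.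
Qed.

Lemma dotp_tail k (z : 'rV[R]_k.+2) :
  dotp z z = z 0 ord0 ^+ 2 + dotp (tail_row z) (tail_row z).
Proof.
rewrite {1}/dotp big_ord_recl -expr2; congr (_ + _).
by apply: eq_bigr => i _; rewrite mxE.
Qed.

Lemma dotpZr d c (x y : 'rV[R]_d) : dotp x (c *: y) = c * dotp x y.
Proof.
by rewrite /dotp mulr_sumr; apply: eq_bigr => i _; rewrite mxE mulrCA.
Qed.

Lemma sphere_areaS k : sphere_area R k.+2 = trigmom R 0 k * sphere_area R k.+1.
Proof.
rewrite /sphere_area sphere_integralS /trigmom -RintegralZr //.
  by apply: eq_Rintegral => t _; rewrite expr0 mul1r.
exact: (trigmom_integrable R 0 k).
Qed.

Lemma sphere_area_gt0 k : 0 < sphere_area R k.+1.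
Proof.
elim: k => [|k IH]; first by rewrite /sphere_area /= addr_gt0.
by rewrite sphere_areaS mulr_gt0 ?trigmom0_gt0.
Qed.

(** Induction on the dimension: the power of <z, x> is expanded on each slice, the inner integrals
    are known, and [slice_moments] sums up. *)
Theorem sphere_integral_dotpX d (z : 'rV[R]_d.+1) k :
  sphere_integral (fun x => dotp z x ^+ k) =
  sphere_area R d.+1 * (sphmom R d.+1 k * dotp z z ^+ k./2).
Proof.
elim: d z k => [|n IH] z k.
  rewrite /sphere_area /= /dotp !big_ord1 !mxE mulr1 mulrN1 -mulr2n.
  have [ok|ek] := boolP (odd k).
    by rewrite sphmom_odd // mul0r mulr0 exprNn -signr_odd ok expr1 mulN1r subrr.
  have -> : sphmom R 1 k = 1.
    rewrite /sphmom (negbTE ek) big1 // => i _; rewrite addnC divff //.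
  rewrite mul1r -expr2 -exprM mul2n even_halfK // exprNn -signr_odd (negbTE ek).
  by rewrite expr0 mul1r -mulr2n mulr_natl.
pose b := trigmom R 0 n.
have b0 : b != 0 by rewrite gt_eqF ?trigmom0_gt0.
(* The average of cos^i sin^j for the density sin^n on [0, pi], normalized by [b]. *)
pose E i j := trigmom R i (n + j) / b.
have Erec i j : E i j.+2 = E i j - E i.+2 j.
  by rewrite /E -mulrBl !addnS trigmom_sin2.
have E0 i : E i 0%N = sphmom R n.+2 i.
  have Es i' : (n.+2 + i')%:R * E i'.+2 0 = (i'.+1)%:R * E i' 0.
    rewrite /E !mulrA -trigmom_recl addn0; congr (_%:R * _ / _); lia.
  elim/ltn_ind: i => -[|[|i]] IHi.
  - by rewrite /E addn0 divff // sphmom0.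
  - by rewrite /E trigmom1 mul0r sphmom_odd.
  - apply: (mulfI (x := (n.+2 + i)%:R)); first by rewrite pnatr_eq0.
    by rewrite Es sphmom_recl // IHi.
pose z' := tail_row z.
rewrite sphere_integralS.
have inner t : sphere_integral (fun y : 'rV[R]_n.+1 =>
      dotp z (slice_point (cos t) (sin t *: y)) ^+ k) =
    \sum_(j < k.+1) 'C(k, j)%:R * z 0 ord0 ^+ (k - j) * sphere_area R n.+1 *
      (sphmom R n.+1 j * dotp z' z' ^+ j./2) * (cos t ^+ (k - j) * sin t ^+ j).
  have -> : (fun y : 'rV[R]_n.+1 => dotp z (slice_point (cos t) (sin t *: y)) ^+ k) =
     poly_fun (\sum_(j < k.+1) ('C(k, j)%:R * (z 0 ord0 * cos t) ^+ (k - j) * sin t ^+ j)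
        *: linear_form z' ^+ j).
    apply/funext => y; rewrite dotp_slice exprDn dotpZr -/z'.
    rewrite /poly_fun raddf_sum; apply: eq_bigr => j _ /=.
    rewrite -/(poly_fun _ y) poly_funZ poly_funX poly_fun_linear_form.
    rewrite [(sin t * _) ^+ _]exprMn -mulr_natl; ring.
  rewrite sphere_integral_sum; apply: eq_bigr => j _.
  rewrite sphere_integralZ poly_funX poly_fun_linear_form IH exprMn; ring.
transitivity (\int[lebesgue_measure]_(t in `[0, pi])
    (\sum_(j < k.+1) ('C(k, j)%:R * z 0 ord0 ^+ (k - j) * sphere_area R n.+1 *
      (sphmom R n.+1 j * dotp z' z' ^+ j./2)) * (cos t ^+ (k - j) * sin t ^+ (n + j)))).
  apply: eq_Rintegral => t _; rewrite inner mulr_sumr; apply: eq_bigr => j _.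
  rewrite exprD; ring.
rewrite Rintegral_trig_sum.
have := @slice_moments R n.+1 k E (z 0 ord0) (dotp z' z') k (ltn0Sn _) (leqnn _)
  (fun a j _ => Erec a j) (fun a _ => E0 a).
rewrite dotp_tail -/z' => <-; rewrite sphere_areaS -/b !mulr_sumr.
by apply: eq_bigr => j _; rewrite /E; field.
Qed.

End SphereIntegral.

(** The points a + (b - a) / (i + 2), i < [size p], are distinct zeros of [p], too many for a
    nonzero polynomial. *)
Lemma poly_itv_eq0 (K : numFieldType) (p : {poly K}) (a b : K) :
  a < b -> (forall c, a < c < b -> p.[c] = 0) -> p = 0.
Proof.
move=> ab p0; apply/eqP/negPn/negP => pN0.
pose rs := [seq a + (b - a) / i.+2%:R | i <- iota 0 (size p)].
suff: (size rs < size p)%N by rewrite size_map size_iota ltnn.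
have ba : 0 < b - a by rewrite subr_gt0.
apply: max_poly_roots pN0 _ _.
  apply/allP => _ /mapP[i _ ->]; apply/rootP/p0.
  rewrite ltrDl divr_gt0 ?ltr0n // -ltrBrDl ltr_pdivrMr ?ltr0n //.
  by rewrite -[ltLHS]mulr1 ltr_pM2l // ltr1n.
rewrite map_inj_uniq ?iota_uniq // => i j /addrI/(mulfI (lt0r_neq0 ba))/invr_inj/eqP.
by rewrite eqr_nat !eqSS => /eqP.
Qed.

(** * Designs are detected by powers of linear forms *)

Section DesignCriterion.
Variables (R : realType).

Lemma msize_linear_formX d (z : 'rV[R]_d) k :
  (mpoly.msize (linear_form z ^+ k) <= k.+1)%N.
Proof.
have s2 : (mpoly.msize (linear_form z) <= 2)%N.
  apply: leq_trans (mpoly.mmeasure_sum _ _ _ _) _.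
  apply/bigmax_leqP => i _; apply: leq_trans (mpoly.msizeZ_le _ _) _.
  by rewrite mpoly.msizeX mpoly.mdeg1.
elim: k => [|k IH]; first by rewrite expr0 mpoly.mmeasure1.
have [l0|lN0] := eqVneq (linear_form z) 0.
  by rewrite l0 expr0n mpoly.mmeasure0.
have [e0|eN0] := eqVneq (linear_form z ^+ k) 0.
  by rewrite exprS e0 mulr0 mpoly.mmeasure0.
rewrite exprS mpoly.msizeM //.
move: s2 IH; move: (mpoly.msize _) (mpoly.msize _) => a b; lia.
Qed.

Lemma linear_formD d (z w : 'rV[R]_d) : linear_form (z + w) = linear_form z + linear_form w.
Proof.
by rewrite -big_split; apply: eq_bigr => i _; rewrite mxE scalerDl.
Qed.

Lemma linear_form_delta d c (i : 'I_d) :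
  linear_form (c *: delta_mx 0 i) = c *: mpoly.mpolyX R (mpoly.mnm1 i).
Proof.
rewrite /linear_form (bigD1 i) //= !mxE !eqxx mulr1 big1 ?addr0 // => j ji.
by rewrite !mxE (negbTE ji) mulr0 scale0r.
Qed.

(* Comparing the coefficients of [c] in the power of [z + c e_i] splits one
   coordinate off the power of a linear form; iterating this reaches all
   monomials. *)
Lemma linear_functional_eq0 d t (Phi : mpoly.mpoly d R -> R) :
    {morph Phi : p q / p + q} -> (forall a p, Phi (a *: p) = a * Phi p) ->
    (forall z k, (k <= t)%N -> Phi (linear_form z ^+ k) = 0) ->
  forall p : mpoly.mpoly d R, (mpoly.msize p <= t.+1)%N -> Phi p = 0.
Proof.
move=> PhiD PhiZ Phi0 p pt.
have Phi00 : Phi 0 = 0 by rewrite -[0 in LHS](scale0r 0) PhiZ mul0r.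
have Phisum (I : Type) (r : seq I) (F : I -> mpoly.mpoly d R) :
  Phi (\sum_(i <- r) F i) = \sum_(i <- r) Phi (F i) by exact: big_morph.
have PhiMn q l : Phi (q *+ l) = Phi q *+ l.
  by rewrite -scaler_nat PhiZ mulr_natl.
have key n m k z : mpoly.mdeg m = n -> (n + k <= t)%N ->
    Phi (mpoly.mpolyX R m * linear_form z ^+ k) = 0.
  elim: n m k z => [|n IH] m k z.
    move=> /eqP; rewrite mpoly.mdeg_eq0 => /eqP -> kt.
    by rewrite mpoly.mpolyX0 mul1r Phi0.
  move=> mn nk.
  have [i mi] : exists i, (0 < mpoly.fun_of_multinom m i)%N.
    apply/existsP; apply: contraPT mn; rewrite negb_exists => /forallP m0.
    by rewrite mpoly.mdegE big1 // => i _; move: (m0 i); rewrite lt0n negbK => /eqP.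
  pose m' := mpoly.mnm_sub m (mpoly.mnm1 i).
  have mE : m = mpoly.mnm_add (mpoly.mnm1 i) m'.
    rewrite mpoly.addmC /m' mpoly.submK //.
    by rewrite mpoly.lep1mP -lt0n.
  have m'n : mpoly.mdeg m' = n.
    by move: mn; rewrite mE mpoly.mdegD mpoly.mdeg1 add1n => -[].
  rewrite mE mpoly.mpolyXD.
  pose a (j : nat) := Phi (mpoly.mpolyX R m' * linear_form z ^+ (k.+1 - j)
     * mpoly.mpolyX R (mpoly.mnm1 i) ^+ j) *+ 'C(k.+1, j).
  have P0 : \poly_(j < k.+2) a j = 0.
    apply: (@poly_itv_eq0 _ _ 0 1 ltr01) => c _; rewrite horner_poly.
    transitivity (Phi (mpoly.mpolyX R m' * linear_form (z + c *: delta_mx 0 i) ^+ k.+1));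
      last by apply: IH => //; rewrite addnS.
    rewrite linear_formD linear_form_delta exprDn mulr_sumr Phisum.
    apply: eq_bigr => j _; rewrite /a exprZn mulrnAr -!scalerAr mulrA.
    by rewrite PhiMn PhiZ mulrnAl mulrC.
  (* The coefficient of [c] is k + 1 times the value of [Phi] that is sought. *)
  have := congr1 (fun q : {poly R} => q`_1) P0.
  rewrite coef_poly coef0 /= /a subn1 /= expr1 bin1 => /eqP.
  rewrite mulrn_eq0 /= => /eqP <-; congr Phi; ring.
rewrite (mpoly.mpolyE p) Phisum big_seq big1 // => m mp.
rewrite PhiZ -[mpoly.mpolyX R m]mulr1 -(expr0 (linear_form 0)).
rewrite (key (mpoly.mdeg m)) ?mulr0 // addn0 -ltnS.
exact: leq_trans (mpoly.msize_mdeg_lt mp) pt.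
Qed.

(** The difference between the average over [X] and the average over the sphere is a linear
    functional, so [linear_functional_eq0] reduces the test to powers of linear forms. *)
Theorem spherical_designP n t (X : {fset 'rV[R]_n.+1}) :
  spherical_design t X <->
  [/\ X != fset0, [set` X] `<=` unit_sphere R n.+1
    & forall z k, (k <= t)%N ->
        \sum_(x <- X) dotp z x ^+ k =
        #|` X|%:R * (sphmom R n.+1 k * dotp z z ^+ k./2)].
Proof.
have areaN0 : sphere_area R n.+1 != 0 by rewrite gt_eqF ?sphere_area_gt0.
split=> -[X0 Xs XP]; split=> //.
  have cN0 : (#|` X|%:R != 0 :> R) by rewrite pnatr_eq0 cardfs_eq0.
  move=> z k kt; apply: (mulfI (invr_neq0 cN0)); rewrite mulKf //.
  have := XP (linear_form z ^+ k) (leq_trans (msize_linear_formX z k) _).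
  rewrite poly_funX poly_fun_linear_form sphere_integral_dotpX mulKf // => -> //.
have cN0 : (#|` X|%:R != 0 :> R) by rewrite pnatr_eq0 cardfs_eq0.
move=> p pt; apply/eqP; rewrite -subr_eq0; apply/eqP.
pose Phi (p : mpoly.mpoly n.+1 R) := (#|` X|%:R)^-1 * \sum_(x <- X) poly_fun p x
  - (sphere_area R n.+1)^-1 * sphere_integral (poly_fun p).
apply: (@linear_functional_eq0 _ t Phi) => //.
- move=> p1 p2; rewrite /Phi sphere_integralD.
  under eq_bigr do rewrite poly_funD.
  rewrite big_split /=; ring.
- move=> a q; rewrite /Phi sphere_integralZ.
  under eq_bigr do rewrite poly_funZ.
  rewrite -mulr_sumr; ring.
- move=> z k kt; rewrite /Phi poly_funX poly_fun_linear_form sphere_integral_dotpX.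
  by rewrite XP // !mulKf // subrr.
Qed.

End DesignCriterion.

(** * Existence *)

Section SliceConstruction.
Variable R : realType.

Definition moment_design n t (X : {fset 'rV[R]_n.+1}) :=
  (forall x, x \in X -> dotp x x = 1) /\
  forall z k, (k <= t)%N -> \sum_(x <- X) dotp z x ^+ k =
    #|` X|%:R * (sphmom R n.+1 k * dotp z z ^+ k./2).

Lemma moment_design_spherical n t (X : {fset 'rV[R]_n.+1}) :
  X != fset0 -> moment_design t X -> spherical_design t X.
Proof. by move=> X0 [Xs XP]; apply/spherical_designP; split=> // x /Xs. Qed.

(** Designs of one fixed size that can avoid any finite set [U]. This lets several disjoint slices
    share a height, which realizes integer weights. *)
Definition ample_designs n t N := forall U : {fset 'rV[R]_n.+1},
  exists Y : {fset 'rV[R]_n.+1},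
    [/\ moment_design t Y, [disjoint Y & U]%fset & #|` Y| = N].

Lemma dotp_slice_point n c (y : 'rV[R]_n.+1) :
  dotp (slice_point c y) (slice_point c y) = c ^+ 2 + dotp y y.
Proof.
rewrite dotp_slice slice_coord0 -expr2; congr (_ + dotp _ _).
by apply/rowP => i; rewrite mxE slice_coordS.
Qed.

Lemma tail_slice_point n c (y : 'rV[R]_n.+1) : tail_row (slice_point c y) = y.
Proof. by apply/rowP => i; rewrite mxE slice_coordS. Qed.

(** Each entry s of [T], repetitions included, gets its own copy of a design, scaled by sqrt(1 -
    s^2) and placed at height s away from all earlier points. *)
Lemma slices_exist n t N (T : seq R) : ample_designs n t N ->
    (forall s, s \in T -> s ^+ 2 < 1) ->
  forall U : {fset 'rV[R]_n.+2}, exists X : {fset 'rV[R]_n.+2},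
  [/\ forall x, x \in X -> dotp x x = 1 /\ x 0 ord0 \in T,
      [disjoint X & U]%fset, #|` X| = (N * size T)%N
    & forall z k, (k <= t)%N -> \sum_(x <- X) dotp z x ^+ k =
      \sum_(s <- T) \sum_(j < k.+1) 'C(k, j)%:R * (z 0 ord0 * s) ^+ (k - j) *
        Num.sqrt (1 - s ^+ 2) ^+ j *
        (N%:R * (sphmom R n.+1 j * dotp (tail_row z) (tail_row z) ^+ j./2))].
Proof.
move=> ample; elim: T => [|s T IH] T1 U.
  exists fset0; split=> //.
  - exact: fdisjoint0X.
  - by rewrite cardfs0 muln0.
  - by move=> z k _; rewrite big_nil big_seq_fset0.
have [|X [Xs XU Xc XP]] := IH _ U.
  by move=> u uT; apply: T1; rewrite in_cons uT orbT.
pose r := Num.sqrt (1 - s ^+ 2).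
have r0 : 0 < r by rewrite sqrtr_gt0 subr_gt0 T1 // mem_head.
have r2 : r ^+ 2 = 1 - s ^+ 2 by rewrite sqr_sqrtr // subr_ge0 ltW // T1 // mem_head.
(* The points to avoid, pulled back by the scaling of the slice. *)
pose U' := [fset r^-1 *: tail_row u | u in (U `|` X)%fset]%fset.
have [Y [[Ys YP] YU Yc]] := ample U'.
pose f (y : 'rV[R]_n.+1) := slice_point s (r *: y).
have finj : injective f.
  move=> y y' /(congr1 (@tail_row _ _)); rewrite !tail_slice_point.
  by apply: scalerI; rewrite gt_eqF.
pose Z := [fset f y | y in Y]%fset.
have ZUX : [disjoint Z & (U `|` X)]%fset.
  apply/fdisjointP => _ /imfsetP[y yY ->]; apply/negP => fU.
  have : y \in U'.
    apply/imfsetP; exists (f y) => //.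
    by rewrite tail_slice_point scalerA mulVf ?scale1r // gt_eqF.
  by apply/negP; apply: (fdisjointP YU).
have XZ : perm_eq (X `|` Z)%fset (X ++ [seq f y | y <- Y]).
  apply: uniq_perm; first exact: fset_uniq.
    rewrite cat_uniq fset_uniq map_inj_uniq // fset_uniq andbT /=.
    apply/hasPn => _ /mapP[y yY ->] /=; apply/negP => fX.
    have fZ : f y \in Z by apply/imfsetP; exists y.
    by have := fdisjointP ZUX _ fZ; rewrite in_fsetU fX orbT.
  move=> x; rewrite in_fsetU mem_cat; congr (_ || _).
  by apply/imfsetP/mapP => -[y yY ->]; exists y.
exists (X `|` Z)%fset; split.
- move=> x /fsetUP[/Xs [-> xT]|/imfsetP[y yY ->]].
    by rewrite in_cons xT orbT.
  rewrite dotp_slice_point slice_coord0 mem_head; split=> //.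
  have -> : dotp (r *: y) (r *: y) = r ^+ 2 * dotp y y.
    rewrite dotpZr; have -> : dotp (r *: y) y = r * dotp y y.
      by rewrite /dotp mulr_sumr; apply: eq_bigr => i _; rewrite mxE mulrA.
    by rewrite mulrA.
  by rewrite r2 Ys // mulr1 addrC subrK.
- rewrite fdisjointUX XU /=; apply: fdisjointWr ZUX; exact: fsubsetUl.
- by rewrite (perm_size XZ) size_cat size_map Xc Yc mulnS addnC.
- move=> z k kt; rewrite big_cons (perm_big _ XZ) big_cat /= XP // addrC; congr (_ + _).
  rewrite big_map; under eq_bigr => y _ do rewrite dotp_slice dotpZr exprDn.
  rewrite exchange_big /=; apply: eq_bigr => j _.
  transitivity (\sum_(y <- Y) ('C(k, j)%:R * (z 0 ord0 * s) ^+ (k - j) * r ^+ j) *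
      dotp (tail_row z) y ^+ j).
    apply: eq_bigr => y _; rewrite [(r * _) ^+ _]exprMn -mulr_natl; ring.
  have jt : (j <= t)%N by apply: leq_trans kt; rewrite -ltnS.
  by rewrite -mulr_sumr YP // Yc.
Qed.

(** Heights with the moments of a coordinate on the larger sphere, and slices with those of the
    smaller one, combine by [slice_moments], as in the integral. *)
Theorem ample_slice_design n t N (T : seq R) : ample_designs n t N ->
    (forall s, s \in T -> s ^+ 2 < 1) ->
    (0 < size T)%N ->
    (forall k, (k <= t)%N -> \sum_(s <- T) s ^+ k = (size T)%:R * sphmom R n.+2 k) ->
  forall U : {fset 'rV[R]_n.+2}, exists X : {fset 'rV[R]_n.+2},
  [/\ moment_design t X, [disjoint X & U]%fset, #|` X| = (N * size T)%N
    & forall x, x \in X -> x 0 ord0 \in T].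
Proof.
move=> ample T1 T0 Tmom U; have [X [Xs XU Xc XP]] := slices_exist ample T1 U.
exists X; split=> // [|x /Xs[] //]; split=> [x /Xs[] //|z k kt].
rewrite XP // exchange_big /=.
(* The discrete counterpart of the normalized integrals of cos^a sin^j. *)
pose E a j : R := (size T)%:R^-1 * \sum_(s <- T) s ^+ a * Num.sqrt (1 - s ^+ 2) ^+ j.
have TN0 : (size T)%:R != 0 :> R by rewrite pnatr_eq0 -lt0n.
have Erec a j : (a + j.+2 <= t)%N -> E a j.+2 = E a j - E a.+2 j.
  move=> _; rewrite /E -mulrBr -sumrB; congr (_ * _); rewrite !big_seq.
  apply: eq_bigr => s sT.
  have : Num.sqrt (1 - s ^+ 2) ^+ 2 = 1 - s ^+ 2.
    by rewrite sqr_sqrtr // subr_ge0 ltW // T1.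
  move: (Num.sqrt _) => r r2.
  rewrite -[j.+2]addn2 -[a.+2]addn2 !exprD r2; ring.
have E0 a : (a <= t)%N -> E a 0%N = sphmom R n.+2 a.
  move=> at_; rewrite /E; under eq_bigr do rewrite expr0 mulr1.
  by rewrite Tmom // mulKf.
have := slice_moments (z 0 ord0) (dotp (tail_row z) (tail_row z)) (ltn0Sn n) kt Erec E0.
rewrite -dotp_tail => <-; rewrite Xc mulr_sumr; apply: eq_bigr => j _.
rewrite /E natrM.
under eq_bigr do rewrite exprMn.
transitivity ((\sum_(s <- T) s ^+ (k - j) * Num.sqrt (1 - s ^+ 2) ^+ j) *
  ('C(k, j)%:R * z 0 ord0 ^+ (k - j) *
   (N%:R * (sphmom R n.+1 j * dotp (tail_row z) (tail_row z) ^+ j./2)))).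
  by rewrite mulr_suml; apply: eq_bigr => s _; ring.
by field.
Qed.

End SliceConstruction.

(** * Designs on the circle *)

Section Dodecagon.
Variable R : realType.

Definition vec2 (p : R * R) : 'rV[R]_2 := \row_(i < 2) if i == ord0 then p.1 else p.2.

Lemma dotp_vec2 (z : 'rV[R]_2) p : dotp z (vec2 p) = z 0 ord0 * p.1 + z 0 ord_max * p.2.
Proof.
rewrite /dotp big_ord_recl big_ord1 !mxE /=; congr (_ + z 0 _ * _).
exact: val_inj.
Qed.

Lemma vec2_surj (x : 'rV[R]_2) : x = vec2 (x 0 ord0, x 0 ord_max).
Proof.
apply/rowP => i; rewrite mxE; case: ifPn => [/eqP -> //|]; case: i => -[|[|i]] // i2 _.
by congr (x 0 _); apply: val_inj.
Qed.

Let w : R := Num.sqrt (3 / 4).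
Let w2 : w ^+ 2 = 3 / 4. Proof. by rewrite sqr_sqrtr // divr_ge0. Qed.
Let w_bounds : 5 / 6 < w < 9 / 10.
Proof.
have w0 : 0 <= w by exact: sqrtr_ge0.
have := w2; rewrite expr2 => w2'; apply/andP; split; nra.
Qed.

(** The vertices of the regular dodecagon, in increasing order of 10 y + x, which shows that they
    are distinct. *)
Let roots12 : seq (R * R) :=
  [:: (0, -1); (- (1 / 2), - w); (1 / 2, - w); (- w, - (1 / 2)); (w, - (1 / 2)); (-1, 0);
      (1, 0); (- w, 1 / 2); (w, 1 / 2); (- (1 / 2), w); (1 / 2, w); (0, 1)].

Let roots12_uniq : uniq roots12.
Proof.
have /andP[w1 w3] := w_bounds.
apply: (@map_uniq _ _ (fun p : R * R => 10 * p.2 + p.1)).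
apply: lt_sorted_uniq; rewrite /= !andbA andbT; repeat (apply/andP; split); lra.
Qed.

Let roots12_norm p : p \in roots12 -> p.1 ^+ 2 + p.2 ^+ 2 = 1.
Proof.
have w2' := w2.
rewrite !inE.
by repeat (case/predU1P => [->|]); [..| move/eqP => ->]; rewrite /= ?sqrrN ?w2'; field.
Qed.

(** Degree 9 is what is asked for: stiff configurations are built for m <= 5, and 2m - 1 <= 9. *)
Let roots12_moments k (u v : R) : (k <= 9)%N ->
  \sum_(p <- roots12) (p.1 * u + p.2 * v) ^+ k =
  12 * (sphmom R 2 k * (u ^+ 2 + v ^+ 2) ^+ k./2).
Proof.
have e2 : \sum_(p <- roots12) (p.1 * u + p.2 * v) ^+ 2 =
  2 * u ^+ 2 + 2 * v ^+ 2 + 4 * (w ^+ 2 * u ^+ 2 + v ^+ 2 / 4)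
  + 4 * (u ^+ 2 / 4 + w ^+ 2 * v ^+ 2).
  by rewrite !big_cons big_nil /=; field.
(* [G4] at (a^2, b^2) is half of (a + b)^4 + (a - b)^4, and [G6], [G8] are its analogues. They
   gather the four sign choices of a vertex, so that only w^2 = 3/4 remains. *)
pose G4 (X Y : R) := X ^+ 2 + 6 * X * Y + Y ^+ 2.
have e4 : \sum_(p <- roots12) (p.1 * u + p.2 * v) ^+ 4 =
  2 * u ^+ 4 + 2 * v ^+ 4 + 4 * G4 (w ^+ 2 * u ^+ 2) (v ^+ 2 / 4)
  + 4 * G4 (u ^+ 2 / 4) (w ^+ 2 * v ^+ 2).
  by rewrite !big_cons big_nil /G4 /=; field.
pose G6 (X Y : R) := X ^+ 3 + 15 * X ^+ 2 * Y + 15 * X * Y ^+ 2 + Y ^+ 3.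
have e6 : \sum_(p <- roots12) (p.1 * u + p.2 * v) ^+ 6 =
  2 * u ^+ 6 + 2 * v ^+ 6 + 4 * G6 (w ^+ 2 * u ^+ 2) (v ^+ 2 / 4)
  + 4 * G6 (u ^+ 2 / 4) (w ^+ 2 * v ^+ 2).
  by rewrite !big_cons big_nil /G6 /=; field.
pose G8 (X Y : R) := X ^+ 4 + 28 * X ^+ 3 * Y + 70 * X ^+ 2 * Y ^+ 2 + 28 * X * Y ^+ 3 + Y ^+ 4.
have e8 : \sum_(p <- roots12) (p.1 * u + p.2 * v) ^+ 8 =
  2 * u ^+ 8 + 2 * v ^+ 8 + 4 * G8 (w ^+ 2 * u ^+ 2) (v ^+ 2 / 4)
  + 4 * G8 (u ^+ 2 / 4) (w ^+ 2 * v ^+ 2).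
  by rewrite !big_cons big_nil /G8 /=; field.
case: k => [|[|[|[|[|[|[|[|[|[|//]]]]]]]]]] _.
- by rewrite sphmom0 !big_cons big_nil /= !expr0; ring.
- by rewrite sphmom_odd // !big_cons big_nil /=; field.
- by rewrite e2 w2 !sphmomSS // sphmom0; field.
- by rewrite sphmom_odd // !big_cons big_nil /=; field.
- by rewrite e4 w2 /G4 !sphmomSS // sphmom0; field.
- by rewrite sphmom_odd // !big_cons big_nil /=; field.
- by rewrite e6 w2 /G6 !sphmomSS // sphmom0; field.
- by rewrite sphmom_odd // !big_cons big_nil /=; field.
- by rewrite e8 w2 /G8 !sphmomSS // sphmom0; field.
- by rewrite sphmom_odd // !big_cons big_nil /=; field.
Qed.

Lemma exists_notin (s : seq R) : exists2 a : R, 0 < a <= 1 & a \notin s.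
Proof.
pose rs := [seq i.+1%:R^-1 : R | i <- iota 0 (size s).+1].
have rs_uniq : uniq rs.
  rewrite map_inj_uniq ?iota_uniq // => i j /invr_inj/eqP.
  by rewrite eqr_nat eqSS => /eqP.
have [/allP h|/allPn[a /mapP[i _ ->] ars]] := boolP (all (mem s) rs).
  have := uniq_leq_size rs_uniq h.
  by rewrite size_map size_iota ltnn.
exists i.+1%:R^-1 => //.
by rewrite invr_gt0 ltr0n /= invf_le1 ?ler1n ?ltr0n.
Qed.

(** A rotation with cosine [a] takes a vertex p to u only if a = <p, u>; a cosine outside the finite
    list [bad] therefore avoids [U]. *)
Theorem ample_dodecagons : ample_designs R 1 9 12.
Proof.
move=> U.
pose bad := [seq p.1 * (u : 'rV[R]_2) 0 ord0 + p.2 * u 0 ord_max | p <- roots12, u <- U].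
have [a /andP[a0 a1] abad] := exists_notin bad.
pose b := Num.sqrt (1 - a ^+ 2).
have ab : a ^+ 2 + b ^+ 2 = 1.
  rewrite sqr_sqrtr ?(addrC (a ^+ 2)) ?subrK // subr_ge0 expr_le1 // ltW //.
pose f (p : R * R) := vec2 (p.1 * a - p.2 * b, p.2 * a + p.1 * b).
have fK p : p = (a * f p 0 ord0 + b * f p 0 ord_max, a * f p 0 ord_max - b * f p 0 ord0).
  case: p => p q; rewrite !mxE /=; congr (_, _).
    by rewrite -[LHS]mulr1 -ab; ring.
  by rewrite -[LHS]mulr1 -ab; ring.
have finj : injective f.
  by move=> p q e; rewrite (fK p) (fK q) e.
pose Y := [fset f p | p in roots12]%fset.
have YE : perm_eq Y [seq f p | p <- roots12].
  apply: uniq_perm; first exact: fset_uniq.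
    by rewrite (map_inj_uniq finj) roots12_uniq.
  by move=> x; apply/imfsetP/mapP => -[p pr ->]; exists p.
have Yc : #|` Y| = 12%N by rewrite (perm_size YE) size_map.
exists Y; split=> //; first split.
- move=> x /imfsetP[p /= pr ->]; rewrite dotp_vec2 !mxE /=.
  by rewrite -(roots12_norm pr) -[RHS]mulr1 -ab; ring.
- move=> z k k9; rewrite Yc (perm_big _ YE) big_map /=.
  pose u := z 0 ord0 * a + z 0 ord_max * b; pose v := z 0 ord_max * a - z 0 ord0 * b.
  transitivity (\sum_(p <- roots12) (p.1 * u + p.2 * v) ^+ k).
    by apply: eq_bigr => p _; rewrite dotp_vec2 /u /v /=; congr (_ ^+ _); ring.
  rewrite roots12_moments //; congr (_ * (_ * _ ^+ _)).
  rewrite {2}(vec2_surj z) dotp_vec2 /= /u /v.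
  by rewrite -[RHS]mulr1 -ab; ring.
- apply/fdisjointP => x /imfsetP[p /= pr ->]; apply/negP => fU.
  move/negP: abad; apply; apply/allpairsP; exists (p, f p); split=> //=.
  by rewrite !mxE /= -[LHS]mul1r -(roots12_norm pr); ring.
Qed.

End Dodecagon.

(** * Quadrature nodes with integer weights, and the stiff configurations *)

Section StiffExistence.
Variable R : realType.
Implicit Type ws : seq (R * R).

(** A pair (n, u) stands for the two nodes with square u, each repeated n times; for u = 0 the node
    0 thus occurs 2n times. *)
Definition sym_nodes ws : seq R :=
  flatten [seq nseq (Num.truncn w.1) (Num.sqrt w.2)
    ++ nseq (Num.truncn w.1) (- Num.sqrt w.2) | w <- ws].

Definition weighted_squares ws :=
  forall w, w \in ws -> w.1 \is a Num.nat /\ 0 <= w.2 < 1.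

Lemma sym_nodes_sum ws k : weighted_squares ws ->
  \sum_(s <- sym_nodes ws) s ^+ k =
  if odd k then 0 else 2 * \sum_(w <- ws) w.1 * w.2 ^+ k./2.
Proof.
elim: ws => [|w ws IH] wsP.
  by rewrite !big_nil mulr0 if_same.
have [wN /andP[w0 _]] := wsP w (mem_head _ _).
have nseqE (x : R) : \sum_(s <- nseq (Num.truncn w.1) x) s ^+ k = w.1 * x ^+ k.
  by rewrite big_nseq iter_addr_0 -mulr_natl truncnK.
rewrite /sym_nodes /= !big_cat /= !nseqE -/(sym_nodes ws) IH; last first.
  by move=> w' w'ws; apply: wsP; rewrite in_cons w'ws orbT.
rewrite exprNn -signr_odd; case: ifPn => ok.
  by rewrite expr1 mulN1r mulrN subrr add0r.
have -> : Num.sqrt w.2 ^+ k = w.2 ^+ k./2.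
  by rewrite -{1}(even_halfK ok) -mul2n exprM sqr_sqrtr.
by rewrite expr0 mul1r big_cons; ring.
Qed.

Lemma mem_sym_nodes ws s : s \in sym_nodes ws ->
  exists2 w, w \in ws & s = Num.sqrt w.2 \/ s = - Num.sqrt w.2.
Proof.
case/flatten_mapP => w wws; rewrite mem_cat => /orP[] /nseqP[-> _]; exists w; auto.
Qed.

(** Odd moments vanish by symmetry, so m conditions on u = t^2 give degree 2m - 1 in t. *)
Lemma sym_nodes_moments ws d m : weighted_squares ws ->
    (forall j, (j < m)%N ->
      \sum_(w <- ws) w.1 * w.2 ^+ j = (\sum_(w <- ws) w.1) * sphmom R d (2 * j)) ->
  forall k, (k <= 2 * m - 1)%N ->
    \sum_(s <- sym_nodes ws) s ^+ k = (size (sym_nodes ws))%:R * sphmom R d k.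
Proof.
move=> wsP wsm k kt.
have -> : (size (sym_nodes ws))%:R = 2 * \sum_(w <- ws) w.1 :> R.
  have := sym_nodes_sum 0 wsP; rewrite /=.
  under eq_bigr do rewrite expr0.
  rewrite big_const_seq count_predT iter_addr_0 => ->; congr (2 * _).
  by apply: eq_bigr => w _; rewrite expr0 mulr1.
rewrite sym_nodes_sum //; case: ifPn => ok; first by rewrite sphmom_odd ?mulr0.
have ek : (2 * k./2 = k)%N by rewrite mul2n even_halfK.
case: m => [|m] in wsm kt *; last first.
  by rewrite wsm ?ek ?mulrA //; lia.
have -> : k = 0%N by lia.
by rewrite sphmom0 mulr1; under eq_bigr do rewrite expr0 mulr1.
Qed.

Lemma sym_nodes_size_gt0 ws w : w \in ws -> 1 <= w.1 -> (0 < size (sym_nodes ws))%N.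
Proof.
move=> wws w1; rewrite -has_predT; apply/hasP; exists (Num.sqrt w.2) => //.
apply/flatten_mapP; exists w => //; rewrite mem_cat; apply/orP; left.
by apply/nseqP; rewrite truncn_gt0.
Qed.

Lemma sym_nodes_lt1 ws : weighted_squares ws ->
  forall s, s \in sym_nodes ws -> s ^+ 2 < 1.
Proof.
move=> wsP s /mem_sym_nodes[w /wsP[_ /andP[w0 w1]] [->|->]];
by rewrite ?sqrrN sqr_sqrtr.
Qed.

Lemma weighted_squares_cons w ws :
  w.1 \is a Num.nat -> 0 <= w.2 < 1 -> weighted_squares ws -> weighted_squares (w :: ws).
Proof. by move=> wN w01 wsP v; rewrite in_cons => /predU1P[->|/wsP]. Qed.

Ltac solve_nat_weight :=
  repeat first [exact: natr_nat | exact: rpred1 | apply: rpredD | apply: rpredM | apply: rpredX].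

Lemma weighted_squares_nil : weighted_squares [::].
Proof. by []. Qed.

(* Interpolatory quadrature in u = t^2, exact to degree 4, for the weight of S^(e+2);
   the nodes 0, 1, 3, 5, 10 over e + 12 were found by search so that all weights
   are positive for every e. *)
Let step_weights (x : R) : seq (R * R) :=
  [:: ((1008 * 1000 + 504) + (919 * 1000 + 212) * x + (272 * 1000 + 552) * x ^+ 2
        + (36 * 1000 + 120) * x ^+ 3 + 1792 * x ^+ 4, 0);
      (189 * 1000 + (446 * 1000 + 250) * x + (245 * 1000 + 875) * x ^+ 2
        + (38 * 1000 + 500) * x ^+ 3 + 1750 * x ^+ 4, 1 / (x + 12));
      (1242 * 1000 + (1024 * 1000 + 500) * x + (238 * 1000 + 750) * x ^+ 2
        + (19 * 1000 + 500) * x ^+ 3 + 500 * x ^+ 4, 3 / (x + 12));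
      ((666 * 1000 + 792) + (467 * 1000 + 586) * x + (76 * 1000 + 671) * x ^+ 2
        + (5 * 1000 + 40) * x ^+ 3 + 126 * x ^+ 4, 5 / (x + 12));
      ((862 * 1000 + 704) + (267 * 1000 + 252) * x + (31 * 1000 + 352) * x ^+ 2
        + 1640 * x ^+ 3 + 32 * x ^+ 4, 10 / (x + 12))].

Let step_weightsP e : weighted_squares (step_weights e%:R).
Proof.
have e0 : 0 <= e%:R :> R by rewrite ler0n.
have e12 : 0 < e%:R + 12 :> R by lra.
do 5 (apply: weighted_squares_cons => /=;
  [by solve_nat_weight
  |by apply/andP; split; rewrite ?lexx ?ltr01 ?divr_ge0 ?ltr_pdivrMr //; lra |]).
exact: weighted_squares_nil.
Qed.

Let step_weights_moments e j : (j < 5)%N ->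
  \sum_(w <- step_weights e%:R) w.1 * w.2 ^+ j =
  (\sum_(w <- step_weights e%:R) w.1) * sphmom R e.+3 (2 * j).
Proof.
have e0 : e%:R + 12 != 0 :> R by rewrite -natrD pnatr_eq0 addn_eq0 andbF.
have d3 : e%:R + 3 != 0 :> R by rewrite -natrD pnatr_eq0 addn_eq0 andbF.
have d5 : e%:R + 5 != 0 :> R by rewrite -natrD pnatr_eq0 addn_eq0 andbF.
have d7 : e%:R + 7 != 0 :> R by rewrite -natrD pnatr_eq0 addn_eq0 andbF.
have d9 : e%:R + 9 != 0 :> R by rewrite -natrD pnatr_eq0 addn_eq0 andbF.
have dE i : (e.+3 + i)%:R = e%:R + i.+3%:R :> R by rewrite -natrD !addSn !addnS.
case: j => [|[|[|[|[|//]]]]] _.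
- by rewrite muln0 sphmom0 mulr1; apply: eq_bigr => w _; rewrite expr0 mulr1.
- rewrite -[(2 * 1)%N]/2%N !sphmomSS // sphmom0 !dE !big_cons !big_nil /=; field.
  by rewrite ?d3 ?d5 ?d7 ?d9 e0.
- rewrite -[(2 * 2)%N]/4%N !sphmomSS // sphmom0 !dE !big_cons !big_nil /=; field.
  by rewrite ?d3 ?d5 ?d7 ?d9 e0.
- rewrite -[(2 * 3)%N]/6%N !sphmomSS // sphmom0 !dE !big_cons !big_nil /=; field.
  by rewrite ?d3 ?d5 ?d7 ?d9 e0.
- rewrite -[(2 * 4)%N]/8%N !sphmomSS // sphmom0 !dE !big_cons !big_nil /=; field.
  by rewrite ?d3 ?d5 ?d7 ?d9 e0.
Qed.

(** Induction on the dimension: dodecagons on the circle, then slices at the heights of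
    [step_weights]. *)
Lemma ample_designs_exist n : exists2 N, (0 < N)%N & ample_designs R n.+1 9 N.
Proof.
elim: n => [|e [N N0 ample]]; first by exists 12%N => //; exact: ample_dodecagons.
have wsP := @step_weightsP e.
pose T := sym_nodes (step_weights e%:R).
have T0 : (0 < size T)%N.
  apply: sym_nodes_size_gt0 (mem_head _ _) _ => /=.
  have e0 : 0 <= e%:R :> R by rewrite ler0n.
  have [e2 e3 e4] : [/\ 0 <= (e%:R : R) ^+ 2, 0 <= (e%:R : R) ^+ 3 & 0 <= (e%:R : R) ^+ 4].
    by rewrite !exprn_ge0.
  lra.
exists (N * size T)%N; first by rewrite muln_gt0 N0.
move=> U; have [|X [? ? ? _]] := @ample_slice_design R e.+1 9 N T ample (sym_nodes_lt1 wsP) T0 _ U.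
  exact: (@sym_nodes_moments _ _ 5 wsP (@step_weights_moments e)).
by exists X.
Qed.

(** The point z is the first basis vector: its inner products with the stacked slices are their
    heights, all of them in [L]. *)
Lemma stiff_of_nodes n m ws (L : seq R) : (m <= 5)%N ->
    weighted_squares ws -> (exists2 w, w \in ws & 1 <= w.1) ->
    (forall j, (j < m)%N ->
      \sum_(w <- ws) w.1 * w.2 ^+ j = (\sum_(w <- ws) w.1) * sphmom R n.+3 (2 * j)) ->
    {subset sym_nodes ws <= L} -> (size L <= m)%N ->
  exists X : {fset 'rV[R]_n.+3}, stiff_configuration m X.
Proof.
move=> m5 wsP [w0 w0ws w00] wsm TL Lm.
have [N N0 ample9] := ample_designs_exist n.
have ample : ample_designs R n.+1 (2 * m - 1) N.
  move=> U; have [Y [[Ys YP] YU Yc]] := ample9 U; exists Y; split=> //; split=> // z k km.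
  by apply: YP; lia.
have T0 := sym_nodes_size_gt0 w0ws w00.
have [X [Xd _ Xc XT]] := ample_slice_design ample (sym_nodes_lt1 wsP) T0
  (sym_nodes_moments wsP wsm) fset0.
have X0 : X != fset0 by rewrite -cardfs_gt0 Xc muln_gt0 N0.
exists X; split; first exact: moment_design_spherical.
exists (delta_mx 0 ord0).
  rewrite /unit_sphere /= /dotp big_ord_recl big1 ?mxE ?mulr1 ?addr0 //.
  by move=> i _; rewrite !mxE mul0r.
apply: leq_trans Lm; apply: (@leq_trans (size (undup L))); last exact: size_undup.
apply: uniq_leq_size; first exact: fset_uniq.
move=> _ /imfsetP[x /= xX ->]; rewrite mem_undup; apply: TL.
suff -> : dotp (delta_mx 0 ord0) x = x 0 ord0 by exact: XT.
rewrite /dotp big_ord_recl big1 ?mxE ?mul1r ?addr0 //.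
by move=> i _; rewrite mxE mul0r.
Qed.

Lemma stiff1 n : exists X : {fset 'rV[R]_n.+3}, stiff_configuration 1 X.
Proof.
apply: (@stiff_of_nodes n 1 [:: (1, 0)] [:: 0]) => //.
- apply: weighted_squares_cons; [exact: rpred1| |exact: weighted_squares_nil].
  by rewrite /= lexx ltr01.
- by exists (1, 0); rewrite ?inE.
- by case=> // _; rewrite !big_cons !big_nil /= muln0 sphmom0; ring.
- by move=> s /mem_sym_nodes[w]; rewrite inE => /eqP -> /= []; rewrite sqrtr0 ?oppr0 => ->; rewrite inE.
Qed.

(** The nodes are the zeros of t^2 - 1/d, where d = n + 3. *)
Lemma stiff2 n : exists X : {fset 'rV[R]_n.+3}, stiff_configuration 2 X.
Proof.
pose u : R := n.+3%:R^-1.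
have n0 : n.+3%:R != 0 :> R by rewrite pnatr_eq0.
apply: (@stiff_of_nodes n 2 [:: (1, u)] [:: Num.sqrt u; - Num.sqrt u]) => //.
- apply: weighted_squares_cons; [exact: rpred1| |exact: weighted_squares_nil].
  by rewrite /= invr_ge0 ler0n invf_lt1 ?ltr0n // ltr1n.
- by exists (1, u); rewrite ?inE.
- case=> [|[|//]] _; rewrite !big_cons !big_nil /=.
    by rewrite muln0 sphmom0; ring.
  by rewrite -[(2 * 1)%N]/2%N !sphmomSS // sphmom0 addn0 /u; field.
- by move=> s /mem_sym_nodes[w]; rewrite inE => /eqP -> /= [] ->; rewrite !inE eqxx ?orbT.
Qed.

(** The nodes are the zeros of t^3 - 3 t / (d + 2), where d = n + 3. *)
Lemma stiff3 n : exists X : {fset 'rV[R]_n.+3}, stiff_configuration 3 X.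
Proof.
pose u : R := 3 / (n%:R + 5).
have n3 : n%:R + 3 != 0 :> R by rewrite -natrD pnatr_eq0 addn_eq0 andbF.
have n5 : n%:R + 5 != 0 :> R by rewrite -natrD pnatr_eq0 addn_eq0 andbF.
have ge0 : 0 <= n%:R :> R by rewrite ler0n.
have dE i : (n.+3 + i)%:R = n%:R + i.+3%:R :> R by rewrite -natrD !addSn !addnS.
apply: (@stiff_of_nodes n 3 [:: (2 * (n%:R + 2), 0); (n%:R + 5, u)]
  [:: 0; Num.sqrt u; - Num.sqrt u]) => //.
- do 2 (apply: weighted_squares_cons => /=;
    [by solve_nat_weight
    |by apply/andP; split; rewrite ?lexx ?ltr01 ?divr_ge0 ?ltr_pdivrMr //; lra |]).
  exact: weighted_squares_nil.
- by exists (n%:R + 5, u); rewrite ?inE ?eqxx ?orbT //=; lra.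
- move=> j; rewrite !big_cons !big_nil /= /u.
  case: j => [|[|[|//]]] _.
  + by rewrite muln0 sphmom0; ring.
  + by rewrite -[(2 * 1)%N]/2%N !sphmomSS // sphmom0 !dE; field; rewrite n5 n3.
  + by rewrite -[(2 * 2)%N]/4%N !sphmomSS // sphmom0 !dE; field; rewrite n5 n3.
- move=> s /mem_sym_nodes[w]; rewrite !inE => /orP[] /eqP -> /= [] ->;
  by rewrite ?sqrtr0 ?oppr0 eqxx ?orbT.
Qed.

Lemma subset_sym_nodes2 a b (u v : R) :
  {subset sym_nodes [:: (a, u); (b, v)] <=
     [:: Num.sqrt u; - Num.sqrt u; Num.sqrt v; - Num.sqrt v]}.
Proof.
move=> s /mem_sym_nodes[w]; rewrite !inE => /orP[] /eqP -> /= [] ->;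
by rewrite eqxx ?orbT.
Qed.

Lemma subset_sym_nodes3 c a b (u v : R) :
  {subset sym_nodes [:: (c, 0); (a, u); (b, v)] <=
     [:: 0; Num.sqrt u; - Num.sqrt u; Num.sqrt v; - Num.sqrt v]}.
Proof.
move=> s /mem_sym_nodes[w]; rewrite !inE => /or3P[] /eqP -> /= [] ->;
by rewrite ?sqrtr0 ?oppr0 eqxx ?orbT.
Qed.

Lemma stiff4_of_nodes n (a b u v : R) : a \is a Num.nat -> b \is a Num.nat -> 1 <= a ->
    0 <= u < 1 -> 0 <= v < 1 ->
    (forall j, (j < 4)%N -> a * u ^+ j + b * v ^+ j = (a + b) * sphmom R n.+3 (2 * j)) ->
  exists X : {fset 'rV[R]_n.+3}, stiff_configuration 4 X.
Proof.
move=> aN bN a1 u01 v01 uvm.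
apply: (stiff_of_nodes (n := n) _ _ _ _ (@subset_sym_nodes2 a b u v)) => //.
- by do 2 apply: weighted_squares_cons => //.
- by exists (a, u); rewrite ?inE ?eqxx.
- by move=> j j4; rewrite !big_cons !big_nil /= !addr0 uvm.
Qed.

Lemma stiff5_of_nodes n (c a b u v : R) :
    c \is a Num.nat -> a \is a Num.nat -> b \is a Num.nat -> 1 <= c ->
    0 <= u < 1 -> 0 <= v < 1 ->
    (forall j, (j < 5)%N ->
      c * 0 ^+ j + (a * u ^+ j + b * v ^+ j) = (c + (a + b)) * sphmom R n.+3 (2 * j)) ->
  exists X : {fset 'rV[R]_n.+3}, stiff_configuration 5 X.
Proof.
move=> cN aN bN c1 u01 v01 uvm.
apply: (stiff_of_nodes (n := n) _ _ _ _ (@subset_sym_nodes3 c a b u v)) => //.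
- apply: weighted_squares_cons => //=; first by rewrite lexx ltr01.
  by do 2 apply: weighted_squares_cons => //.
- by exists (c, 0); rewrite ?inE ?eqxx.
- by move=> j j5; rewrite !big_cons !big_nil /= !addr0 uvm.
Qed.

(** For m = 4 the squared nodes are the roots of 3 - 6 (d + 2) u + (d + 2) (d + 4) u^2, here 1/5 and
    1/45; 11 and 81 are proportional to their Gauss weights. *)
Lemma stiff4_23 : exists X : {fset 'rV[R]_23}, stiff_configuration 4 X.
Proof.
apply: (@stiff4_of_nodes 20 11 81 (1 / 5) (1 / 45)); [by solve_nat_weight|by solve_nat_weight|lra|lra|lra|].
case=> [|[|[|[|//]]]] _; rewrite ?muln0 ?sphmom0.
- by ring.
- by rewrite -[(2 * 1)%N]/2%N !sphmomSS // sphmom0; field.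
- by rewrite -[(2 * 2)%N]/4%N !sphmomSS // sphmom0; field.
- by rewrite -[(2 * 3)%N]/6%N !sphmomSS // sphmom0; field.
Qed.

Lemma stiff4_241 : exists X : {fset 'rV[R]_241}, stiff_configuration 4 X.
Proof.
apply: (@stiff4_of_nodes 238 250 2401 (1 / 45) (1 / 441)); [by solve_nat_weight|by solve_nat_weight|lra|lra|lra|].
case=> [|[|[|[|//]]]] _; rewrite ?muln0 ?sphmom0.
- by ring.
- by rewrite -[(2 * 1)%N]/2%N !sphmomSS // sphmom0; field.
- by rewrite -[(2 * 2)%N]/4%N !sphmomSS // sphmom0; field.
- by rewrite -[(2 * 3)%N]/6%N !sphmomSS // sphmom0; field.
Qed.

(** For m = 5 the nonzero squared nodes are the roots of 15 - 10 (d + 4) u + (d + 4) (d + 6) u^2.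
    The weight given for 0 is half of its total, as [sym_nodes] counts 0 twice. *)
Lemma stiff5_241 : exists X : {fset 'rV[R]_241}, stiff_configuration 5 X.
Proof.
apply: (@stiff5_of_nodes 238 (340 * 1000 + 736) (15 * 1000 + 379) (288 * 1000 + 78)
     (3 / 91) (1 / 133)); [by solve_nat_weight|by solve_nat_weight|by solve_nat_weight|lra|lra|lra|].
case=> [|[|[|[|[|//]]]]] _; rewrite ?muln0 ?sphmom0.
- by ring.
- by rewrite -[(2 * 1)%N]/2%N !sphmomSS // sphmom0; field.
- by rewrite -[(2 * 2)%N]/4%N !sphmomSS // sphmom0; field.
- by rewrite -[(2 * 3)%N]/6%N !sphmomSS // sphmom0; field.
- by rewrite -[(2 * 4)%N]/8%N !sphmomSS // sphmom0; field.
Qed.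

Lemma stiff5_1079 : exists X : {fset 'rV[R]_1079}, stiff_configuration 5 X.
Proof.
apply: (@stiff5_of_nodes 1076 ((7 * 1000 + 451) * 1000 + 136) (319 * 1000 + 333)
  ((6 * 1000 + 226) * 1000 + 319) (1 / 133) (1 / 589)); [by solve_nat_weight|by solve_nat_weight|by solve_nat_weight|lra|lra|lra|].
case=> [|[|[|[|[|//]]]]] _; rewrite ?muln0 ?sphmom0.
- by ring.
- by rewrite -[(2 * 1)%N]/2%N !sphmomSS // sphmom0; field.
- by rewrite -[(2 * 2)%N]/4%N !sphmomSS // sphmom0; field.
- by rewrite -[(2 * 3)%N]/6%N !sphmomSS // sphmom0; field.
- by rewrite -[(2 * 4)%N]/8%N !sphmomSS // sphmom0; field.
Qed.

End StiffExistence.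

(** * Gauss quadrature with integer weights *)

Section PolynomialMonotonicity.
Variable R : rcfType.

Lemma deriv_ge0_horner_eq (F : {poly R}) (a b : R) : a < b ->
  (forall x, a < x < b -> 0 <= F^`().[x]) -> F.[a] = F.[b] -> F^`() = 0.
Proof.
move=> ab F'0 Fab.
have mono := @polyrcf.ler_hornerW _ a b F (fun x xab => F'0 x xab).
have e : F - F.[a]%:P = 0.
  apply: (poly_itv_eq0 ab) => c /andP[ac cb].
  rewrite hornerD hornerN hornerC; apply/eqP; rewrite subr_eq0 eq_le.
  rewrite {1}Fab !mono // ?in_itv /= ?lexx ?(ltW ac) ?(ltW cb) ?(ltW ab) //.
by have := congr1 deriv e; rewrite derivB derivC subr0 deriv0.
Qed.

End PolynomialMonotonicity.

(** * The moment functional and the Gegenbauer operator *)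

Section MomentFunctional.
Variables (R : realType) (d : nat).
Hypothesis d_gt0 : (0 < d)%N.
Implicit Types (f g p : {poly R}) (i j k : nat).

(** The average over the sphere of p(t), t being one coordinate, expressed by moments alone. *)
Definition sphfun p : R := \sum_(i < size p) p`_i * sphmom R d i.

Lemma sphfun_widen n p : (size p <= n)%N -> sphfun p = \sum_(i < n) p`_i * sphmom R d i.
Proof.
move=> pn; rewrite /sphfun (big_ord_widen n (fun i => p`_i * sphmom R d i) pn).
rewrite big_mkcond; apply: eq_bigr => i _.
by case: ltnP => // pi; rewrite nth_default // mul0r.
Qed.

Lemma sphfunD p q : sphfun (p + q) = sphfun p + sphfun q.
Proof.
pose n := maxn (size (p + q)) (maxn (size p) (size q)).
rewrite !(@sphfun_widen n) ?leq_max ?leqnn ?orbT // -big_split.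
by apply: eq_bigr => i _; rewrite coefD mulrDl.
Qed.

Lemma sphfunZ a p : sphfun (a *: p) = a * sphfun p.
Proof.
rewrite (@sphfun_widen (size p) (a *: p)) ?size_scale_leq // mulr_sumr.
by apply: eq_bigr => i _; rewrite coefZ mulrA.
Qed.

Lemma sphfunN p : sphfun (- p) = - sphfun p.
Proof. by rewrite -scaleN1r sphfunZ mulN1r. Qed.

Lemma sphfunB p q : sphfun (p - q) = sphfun p - sphfun q.
Proof. by rewrite sphfunD sphfunN. Qed.

Lemma sphfun0 : sphfun 0 = 0.
Proof. by rewrite /sphfun size_poly0 big_ord0. Qed.

Lemma sphfun_sum (I : Type) (r : seq I) (F : I -> {poly R}) :
  sphfun (\sum_(i <- r) F i) = \sum_(i <- r) sphfun (F i).
Proof. by apply: (big_morph sphfun); [exact: sphfunD|exact: sphfun0]. Qed.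

Lemma sphfunXn k : sphfun 'X^k = sphmom R d k.
Proof.
rewrite /sphfun size_polyXn big_ord_recr big1 /= ?add0r ?coefXn ?eqxx ?mul1r // => i _.
by rewrite coefXn ltn_eqF ?mul0r.
Qed.

(** The derivative of (1 - t^2)^((d-1)/2) f, divided by the weight (1 - t^2)^((d-3)/2). *)
Definition stokes f := (1 - 'X^2) * f^`() - (d.-1)%:R *: ('X * f).

Lemma stokesD f g : stokes (f + g) = stokes f + stokes g.
Proof. by rewrite /stokes derivD !mulrDr scalerDr; ring. Qed.

Lemma stokesZ a f : stokes (a *: f) = a *: stokes f.
Proof. by rewrite /stokes derivZ -!scalerAr scalerBr !scalerA [_ * a]mulrC. Qed.

Lemma stokes_sum (I : Type) (r : seq I) (F : I -> {poly R}) :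
  stokes (\sum_(i <- r) F i) = \sum_(i <- r) stokes (F i).
Proof.
apply: (big_morph stokes); first exact: stokesD.
by rewrite -[0 in LHS](scale0r 0) stokesZ scale0r.
Qed.

Lemma stokes_Xn k : stokes 'X^(k.+1) = k.+1%:R *: 'X^k - (d + k)%:R *: 'X^(k.+2).
Proof.
rewrite /stokes derivXn /= -mulr_natl -[d in RHS](prednK d_gt0).
rewrite -!mul_polyC !rmorph_nat -[k.+2]addn2 !exprSr !exprD natrD; ring.
Qed.

Lemma stokes_1 : stokes 1 = - ((d.-1)%:R *: 'X).
Proof. by rewrite /stokes derivC mulr0 mulr1 add0r. Qed.

(* Integration by parts against the weight (1 - t^2)^((d-3)/2). *)
Lemma sphfun_stokes f : sphfun (stokes f) = 0.
Proof.
rewrite -[f]coefK poly_def stokes_sum sphfun_sum big1 // => i _.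
rewrite stokesZ sphfunZ; case: (nat_of_ord i) => [|k].
  by rewrite expr0 stokes_1 sphfunN sphfunZ -['X]expr1 sphfunXn sphmom_odd // mulr0 oppr0 mulr0.
by rewrite stokes_Xn sphfunB !sphfunZ !sphfunXn sphmom_recl // subrr mulr0.
Qed.

(** The Gegenbauer differential operator, self-adjoint for [sphfun], with eigenvalue - m (m + d - 2)
    in degree m. *)
Definition gegen f := (1 - 'X^2) * f^`()^`() - (d.-1)%:R *: ('X * f^`()).

Lemma gegen_stokes f g : stokes (f^`() * g) = gegen f * g + (1 - 'X^2) * (f^`() * g^`()).
Proof. by rewrite /stokes /gegen derivM -!mul_polyC; ring. Qed.

Lemma sphfun_gegen_sym f g : sphfun (gegen f * g) = sphfun (f * gegen g).
Proof.
have h f' g' : sphfun (gegen f' * g') = - sphfun ((1 - 'X^2) * (f'^`() * g'^`())).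
  by apply/eqP; rewrite -addr_eq0 -sphfunD -gegen_stokes sphfun_stokes.
by rewrite h [f * _]mulrC h [f^`() * _]mulrC.
Qed.

Lemma coef_gegen f j :
  (gegen f)`_j = (j.+2 * j.+1)%:R * f`_j.+2 - (j * (j + d).-2)%:R * f`_j.
Proof.
rewrite /gegen mulrBl mul1r coefB coefB coefZ coefXnM coefXM !coef_deriv.
have dE : d%:R = d.-1%:R + 1 :> R by rewrite natr1 prednK.
case: j => [|[|j]].
- by rewrite mul0n /=; ring.
- by rewrite add1n mul1n /=; ring.
- rewrite subSS subSS subn0 !addSn /= !natrM natrD dE; ring.
Qed.

Lemma size_gegen f : (size (gegen f) <= size f)%N.
Proof.
apply/leq_sizeP => j fj; rewrite coef_gegen !nth_default ?mulr0 ?subrr //.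
by do 2 apply: leqW.
Qed.

End MomentFunctional.

(** * Positive definiteness of the moment functional in odd dimension *)

Section OddDimension.
Variables (R : realType) (r : nat).
Implicit Types (f p : {poly R}).

Let d := (2 * r + 3)%N.
Let d_gt0 : (0 < d)%N. Proof. by rewrite /d addn3. Qed.

Definition antideriv p : {poly R} := \poly_(i < (size p).+1) (p`_i.-1 / i%:R).

Lemma antiderivK p : (antideriv p)^`() = p.
Proof.
apply/polyP => i; rewrite coef_deriv coef_poly ltnS.
case: ltnP => [ip|pi]; last by rewrite nth_default // mul0rn.
by rewrite -[LHS]mulr_natr divfK // pnatr_eq0.
Qed.

Let wt : {poly R} := (1 - 'X^2) ^+ r.
(** For d = 2r + 3 the weight is a polynomial, so its integral against p over [-1, 1] is a
    difference of values of an antiderivative. *)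
Let J p : R := (antideriv (wt * p)).[1] - (antideriv (wt * p)).[-1].

Let J_antideriv p F : F^`() = wt * p -> J p = F.[1] - F.[-1].
Proof.
move=> FE; rewrite /J; have := antiderivK (wt * p).
move: (antideriv (wt * p)) => G; rewrite -FE => GF.
have e : (F - G)^`() = 0 by rewrite derivB GF subrr.
suff -> : F = G + (F - G).[0]%:P.
  by rewrite !(hornerD, hornerC); ring.
rewrite addrC; apply/eqP; rewrite -subr_eq; apply/eqP/polyP => -[|i].
  by rewrite coefC horner_coef0.
rewrite coefC /=; have := congr1 (fun q : {poly R} => q`_i) e.
by rewrite /= coef_deriv coef0 => /eqP; rewrite mulrn_eq0 /= => /eqP.
Qed.

Let J_stokes f : J (stokes d f) = 0.
Proof.
have dE : d.-1 = (2 * r.+1)%N by rewrite /d; lia.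
rewrite (@J_antideriv _ ((1 - 'X^2) ^+ r.+1 * f)); last first.
  rewrite derivM deriv_exp derivB derivC derivXn /stokes dE /wt /= scaler_nat (exprS (1 - 'X^2) r).
  by move: ((1 - 'X^2) ^+ r) => W; ring.
have e1 : (1 - 'X^2 : {poly R}).[1] = 0 by rewrite !hornerE expr1n subrr.
have e2 : (1 - 'X^2 : {poly R}).[-1] = 0 by rewrite !hornerE sqrrN expr1n subrr.
by rewrite exprS !hornerM e1 e2 !mul0r subrr.
Qed.

Let J_linear a p q : J (a *: p + q) = a * J p + J q.
Proof.
have -> : J (a *: p + q) = (a *: antideriv (wt * p) + antideriv (wt * q)).[1]
    - (a *: antideriv (wt * p) + antideriv (wt * q)).[-1].
  by apply: J_antideriv; rewrite derivD derivZ !antiderivK mulrDr scalerAr.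
by rewrite /J !hornerD !hornerZ; ring.
Qed.

(** Both functionals vanish on [stokes], and this fixes all moments in terms of the moment of 1. *)
Let J_sphfun p : J p = J 1 * sphfun d p.
Proof.
have J0 : J 0 = 0.
  by have := J_linear (-1) 0 0; rewrite scaler0 addr0 mulN1r addNr.
have JX k : J 'X^k = J 1 * sphmom R d k.
  elim/ltn_ind: k => -[|[|k]] IH.
  - by rewrite expr0 sphmom0 mulr1.
  - have := J_stokes 1; rewrite stokes_1 -scaleNr -[_ *: _]addr0 J_linear J0 addr0.
    move/eqP; rewrite mulf_eq0 oppr_eq0 pnatr_eq0 => /orP[|/eqP JX0].
      by rewrite /d; lia.
    by rewrite expr1 JX0 sphmom_odd ?mulr0.
  - have : J (k.+1%:R *: 'X^k + ((- (d + k)%:R) *: 'X^(k.+2) + 0)) = 0.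
      by rewrite addr0 scaleNr -stokes_Xn // J_stokes.
    rewrite !J_linear J0 addr0 (IH k) ?(leqW (leqnSn _)) // mulNr => /eqP.
    rewrite subr_eq0 mulrCA -sphmom_recl // mulrCA eq_sym => /eqP.
    by move/mulfI => <- //; rewrite pnatr_eq0 -lt0n ltn_addr.
rewrite -{1}[p]coefK poly_def /sphfun mulr_sumr.
elim: (index_enum _) => [|i s IH]; first by rewrite !big_nil.
by rewrite !big_cons J_linear IH JX; ring.
Qed.

(** An antiderivative of the nonnegative polynomial (1 - t^2)^r f^2 takes equal values at -1 and 1,
    hence is constant. *)
Lemma sphfun_sqr_eq0 f : sphfun d (f * f) = 0 -> f = 0.
Proof.
move=> f0; have := J_sphfun (f * f); rewrite f0 mulr0 /J => /eqP; rewrite subr_eq0 => /eqP e.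
have := @deriv_ge0_horner_eq R (antideriv (wt * (f * f))) (-1) 1 _ _ (esym e).
rewrite antiderivK => h.
have : wt * (f * f) = 0.
  apply: h => [|x /andP[x1 x2]]; first by lra.
  rewrite !hornerM mulr_ge0 -?expr2 ?sqr_ge0 // horner_exp exprn_ge0 //.
  rewrite hornerD hornerN hornerC hornerXn subr_ge0.
  by rewrite expr2; nra.
move/eqP; rewrite mulf_eq0 expf_eq0 => /orP[/andP[_]|].
  rewrite subr_eq0 => /eqP/(congr1 (fun p : {poly R} => p`_2)).
  by rewrite coefC coefXn /= => /eqP; rewrite eq_sym oner_eq0.
by rewrite mulf_eq0 orbb => /eqP.
Qed.


End OddDimension.

Lemma size_mul_bound (R : idomainType) (p q : {poly R}) a b c :
  (size p <= a)%N -> (size q <= b)%N -> ((a + b).-1 <= c)%N -> (size (p * q)%R <= c)%N.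
Proof.
by move=> pa qb; apply: leq_trans; apply: leq_trans (size_polyMleq _ _) _; lia.
Qed.

(** * The nodes of a Gauss quadrature with integer weights have rational squares *)

Section GaussNodes.
Variables (R : realType) (r m : nat) (T : seq R) (N : R -> nat) (M : nat).
Let d := (2 * r + 3)%N.
Hypotheses (m_gt0 : (0 < m)%N) (M_gt0 : (0 < M)%N) (T_uniq : uniq T).
Hypotheses (N_gt0 : forall t, t \in T -> (0 < N t)%N) (T_size : (size T <= m)%N).
Hypothesis quad : forall k, (k < 2 * m)%N ->
  \sum_(t <- T) (N t)%:R * t ^+ k = M%:R * sphmom R d k.
Implicit Types (f g p : {poly R}).

Let d_gt0 : (0 < d)%N. Proof. by rewrite /d addn3. Qed.

Definition nodal_poly : {poly R} := \prod_(t <- T) ('X - t%:P).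
Local Notation P := nodal_poly.

Lemma quadrature g : (size g <= 2 * m)%N ->
  \sum_(t <- T) (N t)%:R * g.[t] = M%:R * sphfun d g.
Proof.
move=> gm; rewrite (sphfun_widen _ gm) mulr_sumr.
under eq_bigr => t _ do rewrite (horner_coef_wide _ gm) mulr_sumr.
rewrite exchange_big /=; apply: eq_bigr => i _.
rewrite mulrCA -quad // mulr_sumr; apply: eq_bigr => t _; ring.
Qed.

Let MN0 : M%:R != 0 :> R. Proof. by rewrite pnatr_eq0 -lt0n. Qed.

Let P_root t : t \in T -> P.[t] = 0.
Proof. by move=> tT; apply/eqP; rewrite -[_ == _]/(root P t) root_prod_XsubC. Qed.

Let P_neq0 : P != 0. Proof. exact/monic_neq0/monic_prod_XsubC. Qed.

Let quad_P g : (size (P * g)%R <= 2 * m)%N -> sphfun d (P * g) = 0.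
Proof.
move=> Pg; apply: (mulfI MN0); rewrite -quadrature // mulr0 big_seq big1 // => t tT.
by rewrite hornerM P_root // mul0r mulr0.
Qed.

(** With fewer nodes, P^2 would have degree below 2m, and the quadrature would make its average
    zero. *)
Lemma size_nodes : size T = m.
Proof.
apply/eqP; rewrite eqn_leq T_size leqNgt; apply/negP => Tm.
suff /eqP : P = 0 by rewrite (negbTE P_neq0).
apply: (@sphfun_sqr_eq0 R r); apply: quad_P; apply: leq_trans (size_polyMleq _ _) _; rewrite size_prod_XsubC; lia.
Qed.

Let size_P : size P = m.+1. Proof. by rewrite size_prod_XsubC size_nodes. Qed.
Let P_monic : P`_m = 1.
Proof.
have /monicP := monic_prod_XsubC T xpredT id.
by rewrite /lead_coef -/P size_P.
Qed.
Let P_high j : (m < j)%N -> P`_j = 0.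
Proof. by move=> mj; rewrite nth_default // size_P. Qed.

Lemma nodal_orthogonal g : (size g <= m)%N -> sphfun d (P * g) = 0.
Proof.
move=> gm; apply: quad_P; apply: leq_trans (size_polyMleq _ _) _.
by rewrite size_P; lia.
Qed.

Lemma orthogonal_eq0 g : (size g <= m)%N ->
  (forall f, (size f <= m)%N -> sphfun d (g * f) = 0) -> g = 0.
Proof. by move=> gm /(_ _ gm); exact: sphfun_sqr_eq0. Qed.

(** The leading terms cancel, so the left side has degree below m; by self-adjointness it is
    orthogonal to all such polynomials. *)
Lemma nodal_ode : gegen d P + (m * (m + d).-2)%:R *: P = 0.
Proof.
have coefE j : (gegen d P + (m * (m + d).-2)%:R *: P)`_j =
    (j.+2 * j.+1)%:R * P`_j.+2
    + ((m * (m + d).-2)%:R - (j * (j + d).-2)%:R) * P`_j.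
  by rewrite coefD coef_gegen // coefZ; ring.
apply: orthogonal_eq0 => [|f fm].
  apply/leq_sizeP => j mj; have mj2 : (m < j.+2)%N by lia.
  rewrite coefE (P_high mj2) mulr0 add0r.
  move: mj; rewrite leq_eqVlt => /predU1P[<-|mj]; first by rewrite subrr mul0r.
  by rewrite P_high // mulr0.
rewrite mulrDl sphfunD -scalerAl sphfunZ nodal_orthogonal // mulr0 addr0.
by rewrite sphfun_gegen_sym // nodal_orthogonal // (leq_trans (size_gegen _ _)).
Qed.

Lemma nodal_coef_rec j : (j <= m)%N ->
  (j.+2 * j.+1)%:R * P`_j.+2 = - ((m - j) * (m + j + (d - 2)))%:R * P`_j.
Proof.
move=> jm; have := congr1 (fun q : {poly R} => q`_j) nodal_ode.
rewrite /= coefD coef_gegen // coefZ coef0.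
have -> : (m * (m + d).-2 = j * (j + d).-2 + (m - j) * (m + j + (d - 2)))%N.
  by rewrite /d; nia.
rewrite natrD mulrDl addrA subrK mulNr => /eqP; rewrite addr_eq0 => /eqP.
exact.
Qed.

(** Downward induction along the recursion, starting above degree m. *)
Lemma nodal_coef_parity j : odd (m + j) -> P`_j = 0.
Proof.
have [mj _|jm] := ltnP m j; first exact: P_high.
have [k] : exists k, (m - j = k)%N by exists (m - j)%N.
elim/ltn_ind: k j jm => k IH j jm kE oj.
have jm' : (j < m)%N.
  by rewrite ltn_neqAle jm andbT; apply: contraTneq oj => ->; rewrite addnn odd_double.
have P2 : P`_j.+2 = 0.
  have [|j2] := ltnP m j.+2; first exact: P_high.
  by apply: (IH (m - j.+2)%N) => //; [lia|rewrite !addnS /= negbK].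
have /eqP := nodal_coef_rec jm; rewrite P2 mulr0 eq_sym mulf_eq0 oppr_eq0 pnatr_eq0.
rewrite muln_eq0 addn_eq0 /d => /orP[|/eqP //]; lia.
Qed.

Lemma deriv_nodal_neq0 t : t \in T -> P^`().[t] != 0.
Proof.
move=> tT; have PE : P = ('X - t%:P) * \prod_(s <- rem t T) ('X - s%:P).
  by rewrite /P (perm_big _ (perm_to_rem tT)) big_cons.
rewrite PE derivM derivXsubC mul1r !hornerE subrr mul0r addr0.
rewrite -[_ != _]/(~~ root _ t) root_prod_XsubC.
by rewrite (rem_filter _ T_uniq) mem_filter /= eqxx.
Qed.

(* The Christoffel numbers: the multiplicity of t is inversely proportional to
   (1 - t^2) P'(t)^2, because P/(X - s) - P/(X - t) has degree at most m - 2. *)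
Lemma weight_formula s t : s \in T -> t \in T ->
  (N s)%:R * (1 - s ^+ 2) * P^`().[s] ^+ 2 = (N t)%:R * (1 - t ^+ 2) * P^`().[t] ^+ 2.
Proof.
pose Q u : {poly R} := \prod_(v <- rem u T) ('X - v%:P).
have PE u : u \in T -> P = ('X - u%:P) * Q u.
  by move=> uT; rewrite /P (perm_big _ (perm_to_rem uT)) big_cons.
have Q0 u x : u \in T -> x \in T -> x != u -> (Q u).[x] = 0.
  move=> uT xT xu; apply/eqP; rewrite -[_ == _]/(root _ x) root_prod_XsubC.
  by rewrite (rem_filter _ T_uniq) mem_filter /= xu.
have Qd u : u \in T -> (Q u).[u] = P^`().[u].
  by move=> uT; rewrite (PE u uT) derivM derivXsubC mul1r !hornerE subrr mul0r addr0.
have Qs u : u \in T -> size (Q u) = m.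
  by move=> uT; rewrite size_prod_XsubC size_rem // size_nodes prednK.
have Qm u : u \in T -> (Q u)`_m.-1 = 1.
  by move=> uT; have /monicP := monic_prod_XsubC (rem u T) xpredT id;
     rewrite /lead_coef -/(Q u) Qs.
have [->//|st] := eqVneq s t.
move=> sT tT; have m_gt1 : (1 < m)%N.
  rewrite -size_nodes; apply: (@uniq_leq_size _ [:: s; t]); first by rewrite /= inE st.
  by move=> x; rewrite !inE => /orP[] /eqP ->.
pose G := Q s - Q t.
have Gs : (size G <= m.-1)%N.
  apply/leq_sizeP => j; rewrite leq_eqVlt => /predU1P[<-|mj].
    by rewrite coefB !Qm // subrr.
  by rewrite coefB !nth_default ?subrr // Qs //; move: mj; rewrite prednK.
have G's : (size G^`() <= m.-2)%N.
  apply/leq_sizeP => j mj; rewrite coef_deriv nth_default ?mul0rn //.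
  by apply: leq_trans Gs _; lia.
pose h := (1 - 'X^2) * G^`() - (d.-1)%:R *: ('X * G).
have X2s : (size (1 - 'X^2 : {poly R})%R <= 3)%N.
  apply: leq_trans (size_polyD _ _) _.
  by rewrite size_polyN size_polyXn size_poly1.
have hs : (size h <= m)%N.
  apply: leq_trans (size_polyD _ _) _; rewrite size_polyN geq_max; apply/andP; split.
    by apply: (size_mul_bound X2s G's); lia.
  apply: leq_trans (size_scale_leq _ _) _.
  by apply: (size_mul_bound (leqnn _) Gs); rewrite size_polyX; lia.
(* [A] is [stokes (P * G)] minus P h with h of degree below m, so its average is zero; evaluated by
   the quadrature, it compares the nodes s and t. *)
pose A := (1 - 'X^2) * (P^`() * G).
have As : (size A <= 2 * m)%N.
  have P's : (size P^`() <= m)%N by rewrite -ltnS -size_P lt_size_deriv.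
  by apply: (size_mul_bound X2s (size_mul_bound P's Gs (leqnn _))); lia.
have A0 : sphfun d A = 0.
  have := sphfun_stokes d_gt0 (P * G).
  have -> : stokes d (P * G) = A + P * h.
    by rewrite /stokes /A /h derivM -!mul_polyC; ring.
  by rewrite sphfunD nodal_orthogonal // addr0.
have pickT c u : u \in T -> \sum_(x <- T) c x * (Q u).[x] = c u * P^`().[u].
  move=> uT; rewrite (big_rem u uT) /= Qd // [X in _ + X]big_seq big1 ?addr0 // => x.
  by rewrite (rem_filter _ T_uniq) mem_filter => /andP[/= xu xT]; rewrite Q0 ?mulr0.
have := quadrature As; rewrite A0 mulr0.
pose c x := (N x)%:R * (1 - x ^+ 2) * P^`().[x].
rewrite (eq_bigr (fun x => c x * (Q s).[x] - c x * (Q t).[x])); last first.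
  by move=> x _; rewrite /A /c /G !hornerM !hornerD !hornerN hornerXn hornerC; ring.
rewrite sumrB !pickT // => /eqP; rewrite subr_eq0 /c -!mulrA => /eqP.
by rewrite -!expr2.
Qed.

(** A Sonin function: by the differential equation its derivative is 2 (d - 2) t P'(t)^2, which has
    the sign of t. *)
Let energy : {poly R} := (m * (m + d).-2)%:R *: P ^+ 2 + (1 - 'X^2) * P^`() ^+ 2.

Let deriv_energy : energy^`() = (2 * (d - 2))%:R *: ('X * P^`() ^+ 2).
Proof.
have ode := nodal_ode; rewrite /gegen in ode.
have dE : d.-1 = (d - 2).+1 by rewrite /d; lia.
rewrite /energy !expr2 !(derivD, derivN, derivZ, derivM, derivX, derivC).
have e : (1 - 'X^2) * P^`()^`() = (d.-1)%:R *: ('X * P^`()) - (m * (m + d).-2)%:R *: P.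
  by apply/eqP; rewrite -subr_eq0 opprB addrCA addrC ode.
transitivity (2%:R *: P^`() * ((m * (m + d).-2)%:R *: P + (1 - 'X^2) * P^`()^`() - 'X * P^`())).
  rewrite -!mul_polyC; ring.
rewrite e dE -!mul_polyC natrM -natr1 !rmorphM !rmorphD !rmorph1 /=; ring.
Qed.

Let horner_parity_sqr p a x : (forall i, odd (a + i) -> p`_i = 0) -> p.[- x] ^+ 2 = p.[x] ^+ 2.
Proof.
move=> pa; suff -> : p.[- x] = (-1) ^+ a * p.[x] by rewrite exprMn sqrr_sign mul1r.
rewrite !horner_coef mulr_sumr; apply: eq_bigr => i _.
have [/pa ->|e] := boolP (odd (a + i)); first by rewrite !mul0r mulr0.
rewrite (exprNn x) [RHS]mulrCA; congr (_ * (_ * _)).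
by rewrite -signr_odd -[RHS]signr_odd; move: e; rewrite oddD negb_add => /eqP ->.
Qed.

Let horner_energy x : energy.[x] =
  (m * (m + d).-2)%:R * P.[x] ^+ 2 + (1 - x ^+ 2) * P^`().[x] ^+ 2.
Proof.
by rewrite /energy !expr2 !(hornerD, hornerN, hornerZ, hornerM, hornerX, hornerC).
Qed.

Let energy_even x : energy.[- x] = energy.[x].
Proof.
have hP := @horner_parity_sqr P m x nodal_coef_parity.
have hP' : P^`().[- x] ^+ 2 = P^`().[x] ^+ 2.
  apply: (@horner_parity_sqr _ m.-1) => i oi.
  rewrite coef_deriv nodal_coef_parity ?mul0rn // addnS.
  by move: oi; rewrite -[m in odd (m + i).+1](prednK m_gt0) addSn /= negbK.
by rewrite !horner_energy hP hP' sqrrN.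
Qed.

Let energy_inj_nonneg x y : 0 <= x < y -> energy.[x] != energy.[y].
Proof.
move=> /andP[x0 xy]; apply/negP => /eqP e.
have /eqP : energy^`() = 0.
  apply: (deriv_ge0_horner_eq xy _ e) => z /andP[xz _].
  rewrite deriv_energy hornerZ hornerM horner_exp hornerX.
  by rewrite mulr_ge0 ?ler0n // mulr_ge0 ?sqr_ge0 // (le_trans x0 (ltW xz)).
rewrite deriv_energy scaler_eq0 pnatr_eq0 => /orP[|]; first by rewrite /d; lia.
rewrite mulf_eq0 polyX_eq0 /= expf_eq0 /= => /eqP P'0.
have : (0 < size T)%N by rewrite size_nodes.
case: T deriv_nodal_neq0 => // t T' /(_ t (mem_head _ _)).
by rewrite P'0 horner0 eqxx.
Qed.

(* Equal multiplicities force equal squares: on the nodes, [energy] is inversely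
   proportional to the multiplicity, and it is strictly increasing in |t|. *)
Lemma eq_weight_eq_sqr s t : s \in T -> t \in T -> N s = N t -> s ^+ 2 = t ^+ 2.
Proof.
move=> sT tT Nst.
have eE u : u \in T -> energy.[u] = (1 - u ^+ 2) * P^`().[u] ^+ 2.
  by move=> uT; rewrite horner_energy P_root // expr0n mulr0 add0r.
have e : energy.[s] = energy.[t].
  rewrite !eE //; apply: (mulfI (x := (N s)%:R)).
    by rewrite pnatr_eq0 -lt0n N_gt0.
  by have := weight_formula sT tT; rewrite -!mulrA -Nst.
have abs u : energy.[u] = energy.[`|u|].
  by have [_|_] := ger0P u; rewrite ?energy_even.
rewrite -[s ^+ 2]real_normK ?num_real // -[t ^+ 2]real_normK ?num_real //.
move: e; rewrite (abs s) (abs t).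
have [st|ts|->//] := ltgtP `|s| `|t|.
  by move/eqP; rewrite (negbTE (energy_inj_nonneg _)) // normr_ge0.
by move/esym/eqP; rewrite (negbTE (energy_inj_nonneg _)) // normr_ge0.
Qed.

Definition is_ratr (x : R) := exists q : rat, x = ratr q.

Let is_ratrM x y : is_ratr x -> is_ratr y -> is_ratr (x * y).
Proof. by case=> p -> [q ->]; exists (p * q); rewrite rmorphM. Qed.

Let is_ratrD x y : is_ratr x -> is_ratr y -> is_ratr (x + y).
Proof. by case=> p -> [q ->]; exists (p + q); rewrite rmorphD. Qed.

Let is_ratr_nat n : is_ratr n%:R.
Proof. by exists n%:R; rewrite rmorph_nat. Qed.

Let is_ratrV x : is_ratr x -> is_ratr x^-1.
Proof. by case=> p ->; exists p^-1; rewrite fmorphV. Qed.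

Let is_ratrN x : is_ratr x -> is_ratr (- x).
Proof. by case=> p ->; exists (- p); rewrite rmorphN. Qed.

Let is_ratr_sum n (F : 'I_n -> R) : (forall i, is_ratr (F i)) -> is_ratr (\sum_i F i).
Proof.
by move=> h; apply: big_ind => //; exact: (is_ratr_nat 0).
Qed.

Let is_ratr_sphmom k : is_ratr (sphmom R d k).
Proof.
rewrite /sphmom; case: ifP => _; first exact: (is_ratr_nat 0).
elim: (k./2) => [|n IH]; first by rewrite big_ord0; exact: (is_ratr_nat 1).
by rewrite big_ord_recr; apply: is_ratrM => //; apply: is_ratrM => //; apply: is_ratrV.
Qed.

Let is_ratr_poly p : (forall i, is_ratr p`_i) -> exists p0 : {poly rat}, p = map_poly ratr p0.
Proof.
move=> pr; have [q qE] := choice pr.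
exists (\poly_(i < size p) q i); apply/polyP => i; rewrite coef_map coef_poly.
by case: ltnP => [ip|pi]; rewrite /= -?qE // nth_default // rmorph0.
Qed.

Let is_ratr_nodal j : is_ratr P`_j.
Proof.
have [mj|jm] := ltnP m j; first by rewrite P_high //; exact: (is_ratr_nat 0).
have [k] : exists k, (m - j = k)%N by exists (m - j)%N.
elim/ltn_ind: k j jm => k IH j jm kE.
move: (jm); rewrite leq_eqVlt => /predU1P[->|jm'].
  by rewrite P_monic; exact: (is_ratr_nat 1).
have P2 : is_ratr P`_j.+2.
  have [mj2|j2] := ltnP m j.+2; first by rewrite P_high //; exact: (is_ratr_nat 0).
  by apply: (IH (m - j.+2)%N) => //; lia.
have cN0 : - ((m - j) * (m + j + (d - 2)))%:R != 0 :> R.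
  by rewrite oppr_eq0 pnatr_eq0 muln_eq0 addn_eq0 /d; lia.
rewrite -[P`_j](mulKf cN0) -nodal_coef_rec //.
by apply: is_ratrM; [exact/is_ratrV/is_ratrN|exact: is_ratrM].
Qed.

(* The coefficients of the sum over t of N t * (P - P(t)) / (X - t), in terms of
   the (rational) moments. *)
Let interp : {poly R} := \sum_(j < m) P`_j.+1 *:
  \sum_(a < j.+1) (M%:R * sphmom R d (j - a)) *: 'X^a.

Let interp_coef i : is_ratr interp`_i.
Proof.
rewrite /interp coef_sum; apply: is_ratr_sum => j; rewrite coefZ coef_sum.
apply: is_ratrM => //; apply: is_ratr_sum => a; rewrite coefZ coefXn.
by apply: is_ratrM => //; exact: is_ratrM.
Qed.

(** At nodes s and t, the divided difference of P is zero for t different from s and P'(s) for t =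
    s. *)
Let interpE s : s \in T -> interp.[s] = (N s)%:R * P^`().[s].
Proof.
move=> sT.
pose dd t := \sum_(j < m) P`_j.+1 * \sum_(a < j.+1) t ^+ (j - a) * s ^+ a.
have -> : interp.[s] = \sum_(t <- T) (N t)%:R * dd t.
  rewrite /interp /dd horner_sum; under [RHS]eq_bigr do rewrite mulr_sumr.
  rewrite exchange_big /=; apply: eq_bigr => j _.
  rewrite hornerZ horner_sum; under [RHS]eq_bigr do rewrite mulrCA mulr_sumr.
  rewrite -mulr_sumr exchange_big /=; congr (_ * _); apply: eq_bigr => a _.
  rewrite hornerZ hornerXn -quad; last by have := ltn_ord j; lia.
  by rewrite mulr_suml; apply: eq_bigr => t _; rewrite mulrA.
rewrite (big_rem s sT) /= [X in _ + X]big_seq big1 ?addr0 => [|t].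
  have P's : (size P^`() <= m)%N by rewrite -ltnS -size_P lt_size_deriv.
  congr (_ * _); rewrite /dd (horner_coef_wide _ P's).
  apply: eq_bigr => j _; rewrite coef_deriv -mulr_natr -mulrA; congr (_ * _).
  rewrite (eq_bigr (fun=> s ^+ j)) => [|a _]; first by rewrite sumr_const card_ord mulr_natl.
  by rewrite -exprD subnK // -ltnS.
rewrite (rem_filter _ T_uniq) mem_filter => /andP[/= ts tT].
suff -> : dd t = 0 by rewrite mulr0.
have ts0 : t - s != 0 by rewrite subr_eq0.
apply: (mulfI ts0); rewrite mulr0 /dd mulr_sumr.
transitivity (\sum_(j < m) (P`_j.+1 * t ^+ j.+1 - P`_j.+1 * s ^+ j.+1)).
  by apply: eq_bigr => j _; rewrite mulrCA -mulrBr subrXX.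
have hE x : P.[x] = P`_0 + \sum_(j < m) P`_j.+1 * x ^+ j.+1.
  by rewrite (@horner_coef_wide _ m.+1) ?size_P // big_ord_recl expr0 mulr1.
rewrite sumrB; apply/eqP; rewrite subr_eq0; apply/eqP/(addrI (P`_0)).
by rewrite -!hE !P_root.
Qed.

(** The nodes of the same weight as x are the common zeros of P and [interp] - N(x) P'. The gcd of
    these rational polynomials has no zero besides x and -x, so its coefficients yield x^2. *)
Theorem nodes_sqr_rational x : x \in T -> is_ratr (x ^+ 2).
Proof.
move=> xT.
have [P0 P0E] := is_ratr_poly is_ratr_nodal.
have [Q0 Q0E] := is_ratr_poly interp_coef.
pose H0 := Q0 - (N x)%:R *: P0^`(); pose g0 := gcdp P0 H0.
pose H := interp - (N x)%:R *: P^`().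
have HE : map_poly ratr H0 = H.
  by rewrite /H0 /H rmorphB /= map_polyZ /= rmorph_nat -deriv_map -P0E Q0E.
have gE : map_poly ratr g0 = gcdp P H by rewrite /g0 gcdp_map HE -P0E.
have [ms] := dvdp_prod_XsubC (dvdp_gcdl P H).
set S := mask ms T => gS.
have S_uniq : uniq S by exact: mask_uniq.
have Sroot t : (t \in S) = root P t && root H t.
  by rewrite -root_gcd (eqp_root gS) root_prod_XsubC.
have xS : x \in S.
  rewrite Sroot /root P_root // eqxx /= /H hornerD hornerN hornerZ interpE //.
  by rewrite subrr.
have SP t : t \in S -> t ^+ 2 = x ^+ 2.
  rewrite Sroot => /andP[]; rewrite root_prod_XsubC => tT.
  rewrite /root /H hornerD hornerN hornerZ interpE // -mulrBl mulf_eq0.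
  rewrite (negbTE (deriv_nodal_neq0 tT)) orbF subr_eq0 eqr_nat => /eqP Ntx.
  exact: eq_weight_eq_sqr.
have gr i : is_ratr (gcdp P H)`_i by rewrite -gE coef_map; exists (g0`_i).
have /eqpP[[c1 c2] /= /andP[c1N0 c2N0] cE] := gS.
have coefg i : (gcdp P H)`_i = c2 / c1 * (\prod_(t <- S) ('X - t%:P))`_i.
  have := congr1 (fun q : {poly R} => q`_i) cE; rewrite /= !coefZ => e.
  by rewrite mulrAC -e [c1 * _]mulrC mulfK.
have cN0 : c2 / c1 != 0 by rewrite mulf_neq0 ?invr_eq0.
(* The gcd is a multiple of X^2 - x^2 or of X - x; the case x = 0 belongs to the latter. *)
have [xN|xN] := boolP ((- x \in S) && (- x != x)).
  have /andP[mxS mxx] := xN.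
  have SE : perm_eq S [:: x; - x].
    apply: uniq_perm => //; first by rewrite /= inE eq_sym mxx.
    move=> t; rewrite !inE; apply/idP/idP => [/SP/eqP|/orP[] /eqP -> //].
    by rewrite eqf_sqr.
  have prodE : \prod_(t <- S) ('X - t%:P) = 'X^2 - (x ^+ 2)%:P.
    rewrite (perm_big _ SE) /= !big_cons big_nil /= mulr1 rmorphN rmorphXn /=; ring.
  have e0 := coefg 0%N; have e2 := coefg 2%N.
  rewrite prodE !coefB !coefXn !coefC /= in e0 e2.
  have -> : x ^+ 2 = - (gcdp P H)`_0 / (gcdp P H)`_2.
    by rewrite e0 e2; field; rewrite c1N0 c2N0.
  by apply: is_ratrM; [exact: is_ratrN|exact: is_ratrV].
have SE : perm_eq S [:: x].
  apply: uniq_perm => // t; rewrite !inE; apply/idP/idP => [tS|/eqP -> //].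
  have /eqP := SP _ tS; rewrite eqf_sqr => /orP[//|/eqP tx].
  by move: xN; rewrite -tx tS /= negbK.
have prodE : \prod_(t <- S) ('X - t%:P) = 'X - x%:P.
  by rewrite (perm_big _ SE) /= big_cons big_nil /= mulr1.
have e0 := coefg 0%N; have e1 := coefg 1%N.
rewrite prodE !coefB !coefX !coefC /= in e0 e1.
have -> : x ^+ 2 = (- (gcdp P H)`_0 / (gcdp P H)`_1) * (- (gcdp P H)`_0 / (gcdp P H)`_1).
  by rewrite e0 e1; field; rewrite c1N0 c2N0.
by apply: is_ratrM; apply: is_ratrM; do ?[exact: is_ratrN|exact: is_ratrV].
Qed.

End GaussNodes.

(** * Newton polygons *)

Section RationalRoots.
Local Open Scope nat_scope.

(** Separating the signs keeps the coefficients natural, so that [logn] gives their valuations. *)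
Definition alt_horner (C : nat -> nat) k (u : rat) : rat :=
  (\sum_(j < k.+1) (-1) ^+ j * (C j)%:R * u ^+ j)%R.

(** After clearing denominators the terms sum to zero, so a common divisor of all terms but one
    divides that one too. *)
Lemma alt_horner_root C k u : alt_horner C k u = 0%R ->
  forall q j0, j0 <= k ->
    (forall j, j <= k -> j != j0 -> q %| C j * `|numq u| ^ j * `|denq u| ^ (k - j)) ->
  q %| C j0 * `|numq u| ^ j0 * `|denq u| ^ (k - j0).
Proof.
move=> Cu0 q j0 j0k qd.
pose F j : int := ((-1) ^+ j * (C j)%:Z * numq u ^+ j * denq u ^+ (k - j))%R.
have absF j : `|F j| = C j * `|numq u| ^ j * `|denq u| ^ (k - j).
  by rewrite /F !abszM !abszX abszN1 exp1n mul1n.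
have F0 : (\sum_(j < k.+1) F j = 0)%R.
  apply: (@intr_inj rat); rewrite rmorph_sum /= rmorph0.
  have dN0 : ((denq u)%:~R : rat) != 0%R by rewrite intr_eq0 denq_neq0.
  transitivity ((denq u)%:~R ^+ k * alt_horner C k u)%R; last by rewrite Cu0 mulr0.
  rewrite mulr_sumr; apply: eq_bigr => j _.
  have jk : (j <= k)%N by rewrite -ltnS.
  rewrite /F !rmorphM !rmorphXn /= rmorphN1.
  have -> : (u ^+ j = (numq u)%:~R ^+ j / (denq u)%:~R ^+ j)%R.
    by rewrite -expr_div_n divq_num_den.
  rewrite -[in X in _ = (X * _)%R](subnK jk) exprD -pmulrn.
  by field; rewrite expf_neq0.
have {}F0 : (F j0 = - \sum_(j < k.+1 | j != inord j0) F j)%R.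
  have ij : (inord j0 : 'I_k.+1) = j0 :> nat by rewrite inordK // ltnS.
  by move: F0; rewrite (bigD1 (inord j0 : 'I_k.+1)) //= ij => /eqP; rewrite addr_eq0 => /eqP.
rewrite -absF -[_ %| _]/((q%:Z %| F j0)%Z) F0 rpredN rpred_sum // => j jN.
have h : q %| `|F j|.
  rewrite absF; apply: qd; first by rewrite -ltnS ltn_ord.
  by apply: contraNneq jN => <-; rewrite inord_val.
exact: h.
Qed.

(* The slopes of the Newton polygon: among the valuations of the terms, the
   minimum cannot be attained only once. *)
Lemma newton_polygon_absurd C k u p j0 : prime p -> alt_horner C k u = 0%R -> u != 0%R ->
    j0 <= k -> (forall j, j <= k -> 0 < C j) ->
    (forall j, j <= k -> j != j0 ->
      logn p (C j0) + j0 * logn p `|numq u| + (k - j0) * logn p `|denq u|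
      < logn p (C j) + j * logn p `|numq u| + (k - j) * logn p `|denq u|) ->
  False.
Proof.
move=> pp Cu0 u0 j0k C0 lt.
have a0 : 0 < `|numq u| by rewrite absz_gt0 numq_eq0.
have b0 : 0 < `|denq u| by rewrite absz_gt0 denq_neq0.
have pos j : j <= k -> 0 < C j * `|numq u| ^ j * `|denq u| ^ (k - j).
  by move=> jk; rewrite !muln_gt0 C0 // !expn_gt0 a0 b0.
have val j : j <= k -> logn p (C j * `|numq u| ^ j * `|denq u| ^ (k - j)) =
    logn p (C j) + j * logn p `|numq u| + (k - j) * logn p `|denq u|.
  by move=> jk; rewrite !lognM ?lognX // ?muln_gt0 ?C0 // !expn_gt0 ?a0 ?b0.
set s := logn p (C j0) + _ + _ in lt.
have := @alt_horner_root C k u Cu0 (p ^ s.+1) j0 j0k _.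
rewrite pfactor_dvdn ?pos // val // -/s ltnn => h.
have // : false by apply: h => j jk jN; rewrite pfactor_dvdn ?pos // val // lt.
Qed.

Lemma coprime_logn_num_den p (u : rat) : prime p ->
  logn p `|numq u| = 0 \/ logn p `|denq u| = 0.
Proof.
move=> pp; have := coprime_num_den u.
have [pd|pd] := boolP (p %| `|denq u|); last by right; rewrite logn_coprime ?prime_coprime.
rewrite coprime_sym => /(coprime_dvdl pd); rewrite prime_coprime // => pn.
by left; rewrite logn_coprime ?prime_coprime.
Qed.

(** If b is the valuation of the denominator, then v = (k - i0) b: otherwise the term k or the term
    i0 alone would have the least valuation. *)
Lemma newton_slope C k u p i0 v : prime p -> alt_horner C k u = 0%R -> u != 0%R ->
    i0 < k -> (forall j, j <= k -> 0 < C j) ->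
    (forall j, j <= i0 -> logn p (C j) = 0) ->
    (forall j, i0 < j -> j <= k -> logn p (C j) = v) ->
    p %| `|denq u| ->
  k - i0 %| v.
Proof.
move=> pp Cu0 u0 i0k C0 low high pd.
have b1 : 0 < logn p `|denq u|.
  by rewrite logn_gt0 mem_primes pp pd absz_gt0 denq_neq0.
have [a0|b0] := coprime_logn_num_den u pp; last by rewrite b0 in b1.
have [lt|gt|->] := ltngtP v ((k - i0) * logn p `|denq u|); last exact: dvdn_mulr.
  exfalso; apply: (@newton_polygon_absurd C k u p k) => // j jk jN.
  rewrite a0 !muln0 subnn mul0n !addn0 high //.
  have jk' : j < k by rewrite ltn_neqAle jN.
  have [ji|ij] := leqP j i0; last by rewrite high // -[X in X < _]addn0 ltn_add2l muln_gt0 subn_gt0 jk'.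
  rewrite low // add0n; apply: leq_trans lt _.
  by rewrite leq_mul2r leq_sub2l ?orbT.
exfalso; apply: (@newton_polygon_absurd C k u p i0) => //; first exact: ltnW.
move=> j jk jN; rewrite a0 !muln0 !addn0 low // add0n.
have [ji|ij] := leqP j i0; last by rewrite high // ltn_addr.
have ji' : j < i0 by rewrite ltn_neqAle jN.
rewrite low // add0n ltn_mul2r b1 /=; lia.
Qed.

(** Completing the square for u = a/b shows that the discriminant times b^2 is a square. The
    inequality makes the truncated subtraction exact. *)
Lemma quadratic_discriminant_square C u : alt_horner C 2 u = 0%R ->
  4 * C 0 * C 2 <= C 1 ^ 2 -> exists s, (C 1 ^ 2 - 4 * C 0 * C 2 = s ^ 2)%N.
Proof.
move=> Cu0 le.
have b0 : 0 < `|denq u| by rewrite absz_gt0 denq_neq0.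
pose a := numq u; pose b := denq u.
have bN0 : (b%:~R : rat) != 0%R by rewrite intr_eq0 denq_neq0.
have e : ((C 0)%:Z * b ^+ 2 - (C 1)%:Z * a * b + (C 2)%:Z * a ^+ 2 = 0)%R.
  apply: (@intr_inj rat).
  transitivity (b%:~R ^+ 2 * alt_horner C 2 u)%R; last by rewrite Cu0 mulr0.
  have uE : u = (a%:~R / b%:~R)%R by rewrite divq_num_den.
  rewrite /alt_horner !big_ord_recr big_ord0 /= uE !expr2 !(rmorphD, rmorphN, rmorphM) /= -!pmulrn.
  by field.
have sq : ((C 1 ^ 2 - 4 * C 0 * C 2)%N%:Z * b ^+ 2
    = (2 * (C 2)%:Z * a - (C 1)%:Z * b) ^+ 2)%R.
  rewrite -subzn // !PoszM -[Posz 4]/(4%R : int).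
  move: e; move: (Posz (C 0)) (Posz (C 1)) (Posz (C 2)) => c0 c1 c2 e.
  transitivity ((2 * c2 * a - c1 * b) ^+ 2 - 4 * c2 * (c0 * b ^+ 2 - c1 * a * b + c2 * a ^+ 2))%R; first by ring.
  by rewrite e mulr0 subr0.
have {sq} := congr1 absz sq; rewrite abszM !abszX => sq.
have bd : `|b| %| `|(2 * (C 2)%:Z * a - (C 1)%:Z * b)%R|.
  by rewrite -(@dvdn_pexp2r _ _ 2) // -sq dvdn_mull.
exists (`|(2 * (C 2)%:Z * a - (C 1)%:Z * b)%R| %/ `|b|).
apply/eqP; rewrite -(eqn_pmul2r (m := `|b| ^ 2)) ?expn_gt0 ?b0 //.
by rewrite sq -expnMn divnK.
Qed.

End RationalRoots.

(** * Coefficients and rational roots of the Gegenbauer polynomial in t^2 *)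

Section GegenbauerRoots.
Variables (R : realType) (r m : nat) (T : seq R) (N : R -> nat) (M : nat).
Let d := (2 * r + 3)%N.
Hypotheses (m_gt0 : (0 < m)%N) (M_gt0 : (0 < M)%N) (T_uniq : uniq T).
Hypotheses (N_gt0 : forall t, t \in T -> (0 < N t)%N) (T_size : (size T <= m)%N).
Hypothesis quad : forall k, (k < 2 * m)%N ->
  \sum_(t <- T) (N t)%:R * t ^+ k = M%:R * sphmom R d k.

Let k := m./2.
Let eps : nat := odd m.
Let mE : m = (2 * k + eps)%N.
Proof. by rewrite /k /eps mul2n addnC odd_double_half. Qed.

(** What remains on the two sides of the coefficient recursion once 2 (m./2 - i), respectively 2 (i
    + 1), is split off. *)
Definition num_factor (m d i : nat) : nat := (m + odd m + (d - 2) + 2 * i)%N.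
Definition den_factor (m i : nat) : nat := (2 * i + 1 + 2 * odd m)%N.
(* Up to sign and a common factor, the coefficient of t^(2j + odd m) in the
   Gegenbauer polynomial of degree m for the weight (1 - t^2)^((d-3)/2). *)
Definition gegen_coef (m d j : nat) : nat :=
  ('C(m./2, j) * \prod_(0 <= i < j) num_factor m d i * \prod_(j <= i < m./2) den_factor m i)%N.

Lemma gegen_coef_rec (m' d' j : nat) : (j < m'./2)%N ->
  (gegen_coef m' d' j.+1 * (j.+1 * den_factor m' j) =
   gegen_coef m' d' j * ((m'./2 - j) * num_factor m' d' j))%N.
Proof.
move=> jk; rewrite /gegen_coef big_nat_recr //= [\prod_(j <= i < _) _]big_ltn //.
have := mul_bin_left (m'./2) j; move: (bigop _ _ _) (bigop _ _ _) => A B e.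
transitivity (j.+1 * 'C(m'./2, j.+1) * (B * num_factor m' d' j) * A * den_factor m' j)%N; first by ring.
by rewrite e; ring.
Qed.

Lemma gegen_coef_gt0 (m' d' j : nat) : (0 < m')%N -> (j <= m'./2)%N -> (0 < gegen_coef m' d' j)%N.
Proof.
move=> m0 jk; rewrite /gegen_coef !muln_gt0 bin_gt0 jk /=; apply/andP; split.
  by apply: prodn_gt0 => i; rewrite /num_factor -!addnA ltn_addr.
by apply: prodn_gt0 => i; rewrite /den_factor addn1.
Qed.

Local Notation P := (nodal_poly T).
Let e j : R := P`_(2 * j + eps).

Let e_rec j : (j < k)%N ->
  (j.+1 * den_factor m j)%:R * e j.+1 = - ((k - j) * num_factor m d j)%:R * e j.
Proof.
move=> jk; have jm : (2 * j + eps <= m)%N by have := mE; lia.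
have := nodal_coef_rec m_gt0 M_gt0 T_uniq T_size quad jm.
rewrite -/d /e; have -> : ((2 * j + eps).+2 = 2 * j.+1 + eps)%N by lia.
have -> : ((2 * j.+1 + eps) * (2 * j + eps).+1 = 2 * (j.+1 * den_factor m j))%N.
  by rewrite /den_factor -/eps /eps; case: (odd m) => /=; ring.
have -> : ((m - (2 * j + eps)) * (m + (2 * j + eps) + (d - 2)) = 2 * ((k - j) * num_factor m d j))%N.
  have -> : (m - (2 * j + eps) = 2 * (k - j))%N by have := mE; lia.
  rewrite /num_factor -/eps; ring.
rewrite !(natrM _ 2) -mulrN -!mulrA => /mulfI; apply.
by rewrite pnatr_eq0.
Qed.

Let e_coef j : (j <= k)%N ->
  (gegen_coef m d 0)%:R * e j = (-1) ^+ j * (gegen_coef m d j)%:R * e 0.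
Proof.
elim: j => [|j IH] jk; first by rewrite expr0 mul1r.
have qN0 : (j.+1 * den_factor m j)%:R != 0 :> R.
  by rewrite pnatr_eq0 muln_eq0 /den_factor; lia.
apply: (mulfI qN0); rewrite mulrCA e_rec // mulrCA IH ?(ltnW jk) //.
have := congr1 (fun n => n%:R : R) (gegen_coef_rec d jk); rewrite /= !(natrM _ (gegen_coef _ _ _)).
rewrite -/k => eC; rewrite exprS.
transitivity (- ((-1) ^+ j * ((gegen_coef m d j)%:R * ((k - j) * num_factor m d j)%:R) * e 0)); first by ring.
by rewrite -eC; ring.
Qed.

Let sizeT : size T = m := size_nodes m_gt0 M_gt0 T_uniq T_size quad.

Let e_k : e k = 1.
Proof.
have := monic_prod_XsubC T xpredT id; rewrite /e -mE => /monicP.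
by rewrite /lead_coef size_prod_XsubC sizeT.
Qed.

Let e_0 : e 0 = (-1) ^+ k * (gegen_coef m d 0)%:R / (gegen_coef m d k)%:R.
Proof.
have CN0 : (gegen_coef m d k)%:R != 0 :> R.
  by rewrite pnatr_eq0 -lt0n gegen_coef_gt0.
have := e_coef (leqnn k); rewrite e_k mulr1 => ->.
rewrite !mulrA -exprMn mulrNN mul1r expr1n mul1r.
by field.
Qed.

Let e_0_neq0 : e 0 != 0.
Proof.
rewrite e_0 mulf_neq0 ?invr_eq0 // ?mulf_neq0 ?signr_eq0 //;
by rewrite pnatr_eq0 -lt0n gegen_coef_gt0.
Qed.

Let horner_P t : P.[t] = t ^+ eps * \sum_(j < k.+1) e j * (t ^+ 2) ^+ j.
Proof.
have sP : (size P <= (2 * k + eps).+1)%N by rewrite size_prod_XsubC sizeT -mE.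
have odd0 i : odd (m + i) -> P`_i = 0.
  exact: (nodal_coef_parity m_gt0 M_gt0 T_uniq T_size quad).
rewrite (horner_coef_wide _ sP) /e /eps; move: odd0.
have [om|/negbTE om] := boolP (odd m) => odd0 /=.
  have P0 : P`_0 = 0 by apply: odd0; rewrite addn0 om.
  rewrite addn1 [LHS]big_ord_recl.
  have -> : P`_(ord0 : 'I_(2 * k).+2) = 0 by exact: P0.
  rewrite mul0r add0r expr1 mulr_sumr.
  rewrite (@sum_even_index R k (fun j => P`_j.+1 * t ^+ j.+1)) => [|j oj].
    by apply: eq_bigr => j _; rewrite addn1 exprS exprM mulrCA.
  by rewrite odd0 ?mul0r // oddD om /= negbK.
rewrite addn0 (@sum_even_index R k (fun j => P`_j * t ^+ j)) => [|j oj].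
  by rewrite expr0 mul1r; apply: eq_bigr => j _; rewrite addn0 exprM.
by rewrite odd0 ?mul0r // oddD om.
Qed.

Let alt_horner_node t (q : rat) : t \in T -> t != 0 -> t ^+ 2 = ratr q ->
  alt_horner (gegen_coef m d) k q = 0.
Proof.
move=> tT t0 tq; apply: (fmorph_inj (@ratr R)); rewrite rmorph0.
apply: (mulfI e_0_neq0); rewrite mulr0.
have : P.[t] = 0 by apply/eqP; rewrite -[_ == _]/(root P t) root_prod_XsubC.
rewrite horner_P => /eqP; rewrite mulf_eq0 expf_eq0 (negbTE t0) andbF /= => /eqP h.
transitivity ((gegen_coef m d 0)%:R * (\sum_(j < k.+1) e j * (t ^+ 2) ^+ j)); last first.
  by rewrite h mulr0.
rewrite /alt_horner rmorph_sum !mulr_sumr; apply: eq_bigr => j _ /=.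
have -> : ratr ((-1) ^+ j * (gegen_coef m d j)%:R * q ^+ j)
    = (-1) ^+ j * (gegen_coef m d j)%:R * (t ^+ 2) ^+ j :> R.
  by rewrite tq rmorphM rmorphM rmorphXn rmorphXn rmorphN1 rmorph_nat.
have jk : (j <= k)%N by rewrite -ltnS ltn_ord.
rewrite [RHS]mulrA (e_coef jk).
by move: (_ ^+ j) (_ ^+ j) (e 0) (_%:R) => a b c x; ring.
Qed.

(** Vieta: 0 is a node exactly for odd m, so [e 0] is the product of the nonzero nodes up to
    sign. *)
Let prod_nodes_sqr : \prod_(t <- T | t != 0) t ^+ 2 = e 0 ^+ 2.
Proof.
have sq (s : seq R) (Q : pred R) : (\prod_(t <- s | Q t) (0 - t)) ^+ 2 = \prod_(t <- s | Q t) t ^+ 2.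
  by rewrite -prodrXl; apply: eq_bigr => t _; rewrite sub0r sqrrN.
rewrite -sq; congr (_ ^+ 2).
have T0 : (0 \in T) = odd m.
  rewrite -root_prod_XsubC -/P /root horner_P /eps expr0n.
  case: (odd m) => /=; first by rewrite mul0r eqxx.
  rewrite mul1r big_ord_recl expr0 mulr1 big1 ?addr0 ?(negbTE e_0_neq0) // => j _.
  by rewrite expr0n /= expr0n /= mulr0.
have [om|em] := boolP (odd m); last first.
  rewrite big_seq_cond (eq_bigl (mem T)) => [|t /=]; last first.
    by case tT: (t \in T) => //=; apply/negP => /eqP t0; move: em; rewrite -T0 -t0 tT.
  rewrite -big_seq; have := horner_P 0; rewrite /eps (negbTE em) expr0 mul1r.
  rewrite big_ord_recl expr0 mulr1 big1 ?addr0 => [<-|j _]; last first.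
    by rewrite expr0n /= expr0n /= mulr0.
  by rewrite horner_prod; apply: eq_bigr => t _; rewrite hornerXsubC.
have PE : P = 'X * \prod_(t <- T | t != 0) ('X - t%:P).
  have zT : 0 \in T by rewrite T0.
  rewrite /nodal_poly (big_rem 0 zT) /= subr0; congr (_ * _).
  by rewrite (rem_filter _ T_uniq) big_filter.
rewrite /e /eps om muln0 add0n PE coefXM /= -horner_coef0 horner_prod.
by apply: eq_bigr => t _; rewrite hornerXsubC.
Qed.

Lemma gegen_rational_root : (1 < m)%N ->
  exists2 u : rat, u != 0 & alt_horner (gegen_coef m d) m./2 u = 0.
Proof.
move=> m1.
have [t tT t0] : exists2 t, t \in T & t != 0.
  apply/hasP; rewrite -[has _ _]negbK; apply/negP => /hasPn h.
  have : (size T <= size [:: (0%R : R)])%N.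
    by apply: uniq_leq_size => // t /h; rewrite negbK inE.
  by rewrite sizeT leqNgt m1.
have [q tq] := nodes_sqr_rational m_gt0 M_gt0 T_uniq N_gt0 T_size quad tT.
exists q; last exact: alt_horner_node tq.
by have := expf_eq0 t 2; rewrite tq fmorph_eq0 (negbTE t0) => ->.
Qed.

(* The product of the roots has negative valuation, so that some root has a
   denominator divisible by p. *)
Theorem gegen_slope p i0 v : prime p -> (i0 < m./2)%N -> (0 < v)%N ->
    (forall j, (j <= i0)%N -> logn p (gegen_coef m d j) = 0%N) ->
    (forall j, (i0 < j)%N -> (j <= m./2)%N -> logn p (gegen_coef m d j) = v) ->
  (m./2 - i0 %| v)%N.
Proof.
move=> pp i0k v0 low high.
have [f fE] : exists f : R -> rat, forall t, t \in T -> t ^+ 2 = ratr (f t).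
  suff /choice[f fE] : forall t, exists q : rat, t \in T -> t ^+ 2 = ratr q by exists f.
  move=> t; case tT: (t \in T); last by exists 0.
  have [q tq] := nodes_sqr_rational m_gt0 M_gt0 T_uniq N_gt0 T_size quad tT.
  by exists q.
have C0 j : (j <= k)%N -> (0 < gegen_coef m d j)%N by exact: gegen_coef_gt0.
have [/hasP[t tT /andP[t0 pt]]|/hasPn nop] :=
    boolP (has (fun t => (t != 0) && (p %| `|denq (f t)|)%N) T).
  apply: (@newton_slope (gegen_coef m d) k (f t)) pt => //.
    exact: alt_horner_node (fE t tT).
  have := expf_eq0 t 2; rewrite (fE t tT) fmorph_eq0 => ->.
  by rewrite (negbTE t0).
exfalso.
(* If p divides no denominator, it does not divide that of the product of the squares. *)
have [A [B pB AB]] : exists A, exists2 B : nat, ~~ (p %| B)%N &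
    \prod_(t <- T | t != 0) f t * B%:R = (A : int)%:~R.
  elim: T nop => [|t s IH] nop.
    by exists 1, 1%N; rewrite ?big_nil ?mulr1 // dvdn1; case: eqP pp => // ->.
  have [|A [B pB AB]] := IH; first by move=> x xs; apply: nop; rewrite inE xs orbT.
  have [t0|t0] := eqVneq t 0; first by exists A, B => //; rewrite big_cons t0 eqxx.
  exists (numq (f t) * A), (`|denq (f t)| * B)%N.
    rewrite Euclid_dvdM // negb_or pB andbT.
    by have := nop t (mem_head _ _); rewrite t0.
  rewrite big_cons t0 natrM rmorphM /= -AB -{1}[f t]divq_num_den.
  have -> : (`|denq (f t)|%:R : rat) = (denq (f t))%:~R.
    by rewrite pmulrn absz_denq.
  have dN0 : ((denq (f t))%:~R : rat) != 0 by rewrite intr_eq0 denq_neq0.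
  by field.
(* This product is the square of the first [gegen_coef] over the last; p divides the last one only,
   a contradiction. *)
have prodE : \prod_(t <- T | t != 0) f t * (gegen_coef m d k)%:R ^+ 2
    = (gegen_coef m d 0)%:R ^+ 2.
  apply: (fmorph_inj (@ratr R)); rewrite rmorphM rmorph_prod !rmorphXn /= !rmorph_nat.
  rewrite big_seq_cond (eq_bigr (fun t => t ^+ 2)) => [|t /andP[tT _]]; last by rewrite fE.
  rewrite -big_seq_cond prod_nodes_sqr e_0.
  have CN0 : (gegen_coef m d k)%:R != 0 :> R by rewrite pnatr_eq0 -lt0n C0.
  by rewrite !exprMn sqrr_sign; field.
have : (A * (gegen_coef m d k ^ 2)%N%:Z = (B * gegen_coef m d 0 ^ 2)%N%:Z)%R.
  apply: (@intr_inj rat); rewrite [LHS]rmorphM /= -AB -!pmulrn (natrM _ B) !natrX -prodE.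
  by ring.
move/(congr1 absz); rewrite abszM !absz_nat => AE.
have : (p %| B * gegen_coef m d 0 ^ 2)%N.
  rewrite -AE dvdn_mull // dvdn_exp //.
  have := high k i0k (leqnn k); have := C0 k (leqnn k).
  by move=> Ck0 vE; rewrite -[p]expn1 pfactor_dvdn // vE.
rewrite Euclid_dvdM // (negbTE pB) Euclid_dvdX // => /andP[pD _].
have := low 0%N (leq0n _); have := C0 0%N (leq0n _) => D0.
by apply/eqP; rewrite -lt0n -pfactor_dvdn // expn1.
Qed.

End GegenbauerRoots.

(** * Primes in intervals *)

Section TrialDivision.
Local Open Scope nat_scope.
Local Arguments N.add : simpl never.
Local Arguments N.mul : simpl never.

Lemma N_to_nat_mod a b : (0 <? b)%num -> N.to_nat (a mod b) = N.to_nat a %% N.to_nat b.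
Proof.
move=> b0; have ab : a = (b * (a / b) + a mod b)%num by apply: N.div_mod'.
have lt : (a mod b <? b)%num by apply/N.ltb_lt/N.mod_lt; lia.
have -> : N.to_nat a = N.to_nat (a / b) * N.to_nat b + N.to_nat (a mod b).
  by rewrite {1}ab; lia.
by rewrite modnMDl modn_small //; lia.
Qed.

Lemma N_mod_eq0 a b : (0 <? b)%num -> ((a mod b =? 0)%num) = (N.to_nat b %| N.to_nat a).
Proof. by move=> b0; rewrite /dvdn -N_to_nat_mod //; apply/idP/idP; lia. Qed.

(** Exhausted fuel answers [false], so that [true] is always reliable. *)
Fixpoint no_divisor_from (fuel : nat) (b n : N) : bool :=
  if (n <? b * b)%num then true else
  if fuel is f.+1 then ~~ (n mod b =? 0)%num && no_divisor_from f (b + 1)%num n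
  else false.

Lemma no_divisor_fromP fuel b n : (1 <? b)%num -> no_divisor_from fuel b n ->
  forall q, N.to_nat b <= q -> q ^ 2 <= N.to_nat n -> ~~ (q %| N.to_nat n).
Proof.
elim: fuel b => [|f IH] b b1 /=; case: ifP => //.
- by move=> lt _ q bq; rewrite -mulnn => qn; have := leq_mul bq bq; lia.
- by move=> lt _ q bq; rewrite -mulnn => qn; have := leq_mul bq bq; lia.
move=> _ /andP[nb /IH h] q; rewrite leq_eqVlt => /orP[/eqP <- _|bq qn].
  by rewrite -N_mod_eq0 //; lia.
by apply: h => //; lia.
Qed.

(** Fuel 400 decides all numbers below 402^2; the largest one tested is 139981. *)
Definition trial_prime (n : N) : bool := (1 <? n)%num && no_divisor_from 400 2 n.

Lemma trial_primeP n : trial_prime n -> prime (N.to_nat n).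
Proof.
case/andP=> n1 /no_divisor_fromP h; apply: contraT => /primePns[|[q [pq qn qd]]]; first by lia.
by have := h isT q (prime_gt1 pq) qn; rewrite qd.
Qed.

(** A search for the largest prime factor. Its result is checked by [slope_witness]. *)
Fixpoint top_factor (fuel : nat) (b n : N) : N :=
  if (n <? b * b)%num then n else
  if fuel is f.+1 then
    if (n mod b =? 0)%num then top_factor f b (n / b) else top_factor f (b + 1)%num n
  else n.

End TrialDivision.

(** * Primes that force a slope, for small and medium m *)

Section SlopePrimes.
Local Open Scope nat_scope.
Local Arguments N.add : simpl never.
Local Arguments N.mul : simpl never.
Local Arguments N.sub : simpl never.
Local Arguments top_factor : simpl never.

(* With e = 2m + d - 2, the number e - 2 rho is the factor [num_factor m d (m./2 - rho)];
   being the only factor divisible by p, it produces a segment of width rho in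
   the p-adic Newton polygon of the Gegenbauer polynomial. *)
Definition slope_prime (m e : nat) : Prop := exists rho p,
  [/\ 1 < rho, 2 * rho <= m, prime p, m < p &
      p %| e - 2 * rho /\ ~~ (rho %| logn p (e - 2 * rho))].

(** The valuation of n at p is 1, or it is at most 2 and rho exceeds 2; either way rho does not
    divide it. *)
Definition slope_witness (n rho p : N) : bool :=
  [&& trial_prime p, (n mod p =? 0)%num &
    ~~ ((n / p) mod p =? 0)%num
    || (2 <? rho)%num && ~~ ((n / p / p) mod p =? 0)%num].

Lemma slope_witnessP n rho p : (1 <? rho)%num -> (0 <? n)%num -> slope_witness n rho p ->
  [/\ prime (N.to_nat p), N.to_nat p %| N.to_nat n &
      ~~ (N.to_nat rho %| logn (N.to_nat p) (N.to_nat n))].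
Proof.
move=> r1 n0 /and3P[/trial_primeP pp pn h].
have p0 : (0 <? p)%num by have := prime_gt0 pp; lia.
have div a : (a mod p =? 0)%num -> N.to_nat a = N.to_nat p * N.to_nat (a / p).
  by move=> ap; have := N.div_mod' a p; lia.
split => //; first by rewrite -N_mod_eq0.
have n'0 : 0 < N.to_nat (n / p) by have := div _ pn; nia.
have lognp b : 0 < b -> logn (N.to_nat p) (N.to_nat p * b) = (logn (N.to_nat p) b).+1.
  by move=> b0; rewrite (lognM _ (prime_gt0 pp) b0) (logn_prime _ pp) eqxx.
rewrite (div _ pn) lognp //.
have [d1|d1] := boolP ((n / p) mod p =? 0)%num.
  move: h; rewrite d1 /= => /andP[r2 d2].
  have n''0 : 0 < N.to_nat (n / p / p) by have := div _ d1; nia.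
  rewrite (div _ d1) lognp // logn_coprime ?gtnNdvd //; first by lia.
  by rewrite prime_coprime // -N_mod_eq0.
rewrite logn_coprime ?gtnNdvd //; first by lia.
by rewrite prime_coprime // -N_mod_eq0.
Qed.

(* The slope lengths [rho] are tried in increasing order; all [m] below [M]
   have been settled. *)
Fixpoint slope_cover (fuel : nat) (e rho M goal : N) : bool :=
  if (goal <=? M)%num then true else
  if fuel is f.+1 then
    let n := (e - 2 * rho)%num in
    let p := top_factor 60 2 n in
    slope_cover f e (rho + 1)%num
      (if (2 * rho <=? M)%num && slope_witness n rho p then N.max M p else M) goal
  else false.

(** A witness p for rho serves every m with 2 rho <= m < p, so the settled range grows up to p as
    soon as 2 rho <= M. *)
Lemma slope_coverP fuel e rho M goal m0 : (1 <? rho)%num -> slope_cover fuel e rho M goal ->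
  (forall m, m0 <= m < N.to_nat M -> slope_prime m (N.to_nat e)) ->
  forall m, m0 <= m < N.to_nat goal -> slope_prime m (N.to_nat e).
Proof.
elim: fuel rho M => [|f IH] rho M r1 /=; case: ifP => //.
- by move=> gM _ h m /andP[m0m mg]; apply: h; lia.
- by move=> gM _ h m /andP[m0m mg]; apply: h; lia.
set n := (e - 2 * rho)%num; set p := top_factor _ _ _.
move=> _ cov h; apply: (IH _ _ _ cov); first by lia.
case: ifP => // /andP[rM wit] m /andP[m0m mM].
have [mM'|Mm] := ltnP m (N.to_nat M); first by apply: h; rewrite m0m.
have mp : m < N.to_nat p by lia.
have [n0|n0] := boolP (0 <? n)%num.
  have [pp pn nr] := slope_witnessP r1 n0 wit.
  exists (N.to_nat rho), (N.to_nat p); have eE : N.to_nat n = N.to_nat e - 2 * N.to_nat rho by lia.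
  by rewrite -eE; split => //; lia.
move: mp; rewrite /p; have -> : n = 0%num by lia.
by rewrite /=; lia.
Qed.

Local Arguments slope_cover : simpl never.

(* e = 31 and e = 249 come from the pairs (d, m) = (21, 6), (19, 7) and
   (239, 6), (237, 7), for which there is no suitable prime. *)
Fixpoint slope_table (len : nat) (e : N) : bool :=
  if len is l.+1 then
    slope_cover 20 e 2 (if (e =? 31)%num || (e =? 249)%num then 8 else 6)%num
      (N.min 40 ((e + 1) / 2)) && slope_table l (e + 2)%num
  else true.

Lemma slope_tableP len e : slope_table len e -> forall i, i < len ->
  slope_cover 20 (e + 2 * N.of_nat i)%num 2
    (if (e + 2 * N.of_nat i =? 31)%num || (e + 2 * N.of_nat i =? 249)%num then 8 else 6)%num
    (N.min 40 ((e + 2 * N.of_nat i + 1) / 2)).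
Proof.
elim: len e => //= l IH e /andP[h /IH hl] [|i] il.
  by have -> : (e + 2 * N.of_nat 0 = e)%num by lia.
have -> : (e + 2 * N.of_nat i.+1 = e + 2 + 2 * N.of_nat i)%num by lia.
exact: hl.
Qed.

Lemma slope_table_true : slope_table 1040 13.
Proof. by vm_compute. Qed.

(** For e = 2m + d - 2 the bounds on e follow from 3 <= d <= 1999; the table covers the odd e from
    13 to 2091. *)
Lemma slope_prime_small m e : 6 <= m < 40 -> 2 * m + 1 <= e -> e <= 2075 -> odd e ->
  (m < 8 -> e \notin [:: 31; 249]) -> slope_prime m e.
Proof.
move=> /andP[m6 m40] me e1 oe exc.
have [i eE] : exists i, e = 13 + 2 * i.
  by exists ((e - 13)./2); have := odd_double_half (e - 13); rewrite oddB ?oe /= ?add0n; lia.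
have il : i < 1040 by lia.
have := slope_tableP slope_table_true il.
have -> : (13 + 2 * N.of_nat i = N.of_nat e)%num by lia.
set s := (if _ then _ else _)%num; set g := N.min _ _ => cov.
have := @slope_coverP _ _ _ _ _ (N.to_nat s) _ cov; rewrite (_ : N.to_nat (N.of_nat e) = e); last by lia.
apply=> //.
- by move=> m' /andP[h1 h2]; lia.
apply/andP; split.
  rewrite /s; case: ifP => // ex; case: ltnP => // m8.
  have := exc m8; rewrite !inE; lia.
rewrite /g; clear -m40 me; have h := N.div_mod' (N.of_nat e + 1) 2; have h2 := N.mod_lt (N.of_nat e + 1) 2 ltac:(by []).
by lia.
Qed.

(* An admissible step from q to q' leaves a prime in [a, a + m - 4] whenever
   q < a <= q': either the gap is at most 37 <= m - 3, or m >= a - 1997 is large. *)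
Fixpoint prime_chain (q : N) (s : seq N) : bool :=
  if s is q' :: s' then
    [&& trial_prime q', (q' <=? q + 37)%num || (q' + 1999 <=? 2 * q)%num & prime_chain q' s']
  else true.

Lemma prime_chainP q s : prime_chain q s -> forall a m, 40 <= m -> m + 1 <= a -> a <= m + 1997 ->
  N.to_nat q < a <= N.to_nat (last q s) ->
  exists p, [/\ prime p, a <= p & p + 4 <= a + m].
Proof.
elim: s q => [|q' s IH] q /=; first by move=> _ a m _ _ _; lia.
case/and3P=> /trial_primeP pq' gap /IH h a m m40 ma am /andP[qa al].
have [aq|qa'] := leqP a (N.to_nat q'); last by apply: h => //; rewrite qa'.
by exists (N.to_nat q'); split => //; lia.
Qed.

(** Gaps are at most 37 up to 2069; beyond, the next prime is at most 2q - 1999. At 139981 the range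
    of [prime_interval_large] has begun. *)
Definition prime_steps : seq N := [:: 41; 73; 109; 139; 173; 199; 233; 269; 293;
  317; 353; 389; 421; 457; 491; 523; 557; 593; 619; 653; 683; 719; 751; 787; 823;
  859; 887; 919; 953; 983; 1019; 1051; 1087; 1123; 1153; 1187; 1223; 1259; 1291;
  1327; 1361; 1381; 1409; 1439; 1471; 1499; 1531; 1567; 1601; 1637; 1669; 1699;
  1733; 1759; 1789; 1823; 1847; 1879; 1913; 1949; 1979; 2011; 2039; 2069; 2137;
  2273; 2543; 3083; 4159; 6317; 10631; 19259; 36497; 70991; 139981]%num.

Lemma prime_chain_true : prime_chain 40 prime_steps.
Proof. by vm_compute. Qed.

Lemma prime_interval_middle a m : 40 <= m -> m + 1 <= a -> a <= m + 1997 ->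
  (N.of_nat a <? 139981)%num -> exists p, [/\ prime p, a <= p & p + 4 <= a + m].
Proof.
move=> m40 ma am al; apply: (prime_chainP prime_chain_true) => //=; lia.
Qed.

End SlopePrimes.

(** * Primes between m + 1997 and 2m - 3 for large m *)

Section ErdosBertrand.
Local Open Scope nat_scope.

Lemma prod_pfactors N n : 0 < n -> n <= N -> n = \prod_(0 <= p < N.+1) p ^ logn p n.
Proof. by move=> n0 nN; rewrite -(@widen_partn N predT) // partnT. Qed.

Lemma pfactor_gt0 p n : 0 < p ^ logn p n.
Proof. by case: p => [|p]; rewrite ?expn_gt0 //= lognE. Qed.

Lemma prod_primes_dividing_le N n (P : pred nat) : 0 < n ->
    (forall p, prime p -> P p -> p %| n) ->
  \prod_(0 <= p < N | prime p && P p) p <= n.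
Proof.
move=> n0 Pn; rewrite [leqRHS](@prod_pfactors (N + n)) ?leq_addl //.
have NNn : N <= (N + n).+1 by lia.
rewrite (big_cat_nat (leq0n N) NNn) /=.
rewrite -[leqLHS]muln1 leq_mul //; last by rewrite prodn_gt0 // => p; exact: pfactor_gt0.
rewrite big_mkcond /= leq_prod // => p _; case: ifP => [/andP[pp /(Pn _ pp) pn]|_].
  by rewrite -{1}[p]expn1; apply: leq_pexp2l; [exact: prime_gt0|rewrite logn_gt0 mem_primes pp n0].
exact: pfactor_gt0.
Qed.

(** The two equal middle coefficients are among the terms of the expansion of (1 + 1)^(2k+1). *)
Lemma bin_half_le k : 'C((2 * k).+1, k) <= 4 ^ k.
Proof.
have : 'C((2 * k).+1, k) + 'C((2 * k).+1, k.+1) <= 2 ^ (2 * k).+1.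
  rewrite -[2 in leqRHS]/(1 + 1) expnDn.
  have kn : k < (2 * k).+2 by lia.
  have kn' : k.+1 < (2 * k).+2 by lia.
  rewrite (bigD1 (Ordinal kn)) //= (bigD1 (Ordinal kn')) /=; last first.
    by rewrite -val_eqE /=; lia.
  by rewrite !exp1n !muln1 leq_add2l leq_addr.
have -> : 'C((2 * k).+1, k.+1) = 'C((2 * k).+1, k).
  by rewrite -bin_sub; [congr 'C(_, _); lia|lia].
by rewrite addnn -mul2n expnS leq_pmul2l // expnM.
Qed.

(** For n = 2k + 1 the primes above k + 1 all divide C(2k + 1, k) <= 4^k; the others are covered by
    induction. An even n > 2 adds no prime. *)
Lemma primorial_le N n : \prod_(0 <= p < N | prime p && (p <= n)) p <= 4 ^ n.
Proof.
elim/ltn_ind: n => n IH.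
have [n1|n1] := leqP n 1.
  rewrite big1 ?expn_gt0 // => p /andP[pp pn].
  by have := prime_gt1 pp; lia.
have [->|n2] := eqVneq n 2.
  apply: (@leq_trans 2) => //; apply: prod_primes_dividing_le => // p pp p2.
  by have -> : p = 2 by have := prime_gt1 pp; lia.
have [on|en] := boolP (odd n); last first.
  have nprime : ~~ prime n.
    by apply: contra en => /even_prime[] // n2'; rewrite n2' eqxx in n2.
  rewrite (eq_bigl (fun p => prime p && (p <= n.-1))) => [|p]; last first.
    have [->|pn] := eqVneq p n; first by rewrite (negbTE nprime).
    by congr (_ && _); apply/idP/idP; lia.
  apply: leq_trans (IH _ _) _; first by lia.
  by rewrite leq_exp2l // leq_pred.
have [k nE] : exists k, n = (2 * k).+1.
  by exists n./2; have := odd_double_half n; rewrite on; lia.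
rewrite (bigID (fun p => p <= k.+1)) /= (_ : 4 ^ n = 4 ^ k.+1 * 4 ^ k); last first.
  by rewrite -expnD; congr (4 ^ _); lia.
apply: leq_mul.
  rewrite (eq_bigl (fun p => prime p && (p <= k.+1))) => [|p]; first by apply: IH; lia.
  by rewrite -andbA; congr (_ && _); apply/idP/idP; lia.
apply: leq_trans (bin_half_le k).
rewrite (eq_bigl (fun p => prime p && ((p <= n) && ~~ (p <= k.+1)))) => [|p]; last by rewrite andbA.
apply: prod_primes_dividing_le => [|p pp /andP[pn kp]]; first by rewrite bin_gt0; lia.
have : p %| n`! by rewrite dvdn_fact // prime_gt0.
rewrite nE -(@bin_fact (2 * k).+1 k); last by lia.
rewrite !Euclid_dvdM // => /orP[//|].
have ndvd j : j < p -> ~~ (p %| j`!).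
  elim: j => [_|j IHj jp]; first by rewrite dvdn1; have := prime_gt1 pp; lia.
  by rewrite factS Euclid_dvdM // negb_or gtnNdvd //= IHj // ltnW.
by rewrite (negbTE (ndvd _ _)) ?(negbTE (ndvd _ _)) //; lia.
Qed.

Lemma central_bin_lower m : 0 < m -> 4 ^ m <= 2 * m * 'C(2 * m, m).
Proof.
elim: m => // -[_ _|m IH _]; first by [].
have e : m.+2 * 'C(2 * m.+2, m.+2) = 2 * (2 * m + 3) * 'C(2 * m.+1, m.+1).
  have -> : 2 * m.+2 = (2 * m).+4 by lia.
  have -> : 2 * m.+1 = (2 * m).+2 by lia.
  rewrite -(mul_bin_diag (2 * m).+4 m.+1).
  have := mul_bin_down (2 * m).+3 m.+1.
  have -> : (2 * m).+3 - m.+1 = m.+2 by lia.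
  rewrite /=; move: 'C(_, _) 'C(_, _) => a b h.
  have -> : (2 * m).+4 * a = 2 * (m.+2 * a) by lia.
  by rewrite -h; lia.
have := IH isT; rewrite (expnS 4 m.+1); move: ('C(_, _)) ('C(_, _)) (4 ^ _) e => a b c e h.
nia.
Qed.

Lemma sum_leq_const N L : \sum_(1 <= k < N) (k <= L) <= L.
Proof.
have [N0|N0] := leqP N 1; first by rewrite big_geq.
suff : \sum_(1 <= k < N) (k <= L) <= minn N.-1 L by move=> h; apply: leq_trans h (geq_minr _ _).
elim: N N0 => // N IH; rewrite ltnS leq_eqVlt => /orP[/eqP <-|N1]; first by rewrite big_nat1; lia.
by rewrite big_nat_recr //=; have := IH N1; lia.
Qed.

Section CentralBinomial.
Variables (m p : nat).
Hypothesis pp : prime p.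

Let fact_sum N n : n <= N -> logn p n`! = \sum_(1 <= k < N.+1) n %/ p ^ k.
Proof.
move=> nN; rewrite logn_fact // [RHS](@big_cat_nat _ _ _ n.+1) //=.
rewrite [X in _ = _ + X]big_nat_cond [X in _ = _ + X]big1 ?addn0 // => k /andP[/andP[nk _] _].
by apply: divn_small; apply: leq_trans (ltn_expl n (prime_gt1 pp)) _; rewrite leq_exp2l ?prime_gt1 // ltnW.
Qed.

(** Legendre's formula for (2m)! and m!, in additive form to avoid truncated subtraction. *)
Lemma logn_central_bin :
  logn p 'C(2 * m, m) + 2 * \sum_(1 <= k < (2 * m).+1) m %/ p ^ k
    = \sum_(1 <= k < (2 * m).+1) (2 * m) %/ p ^ k.
Proof.
have mm : m <= 2 * m by lia.
rewrite -!fact_sum // -(bin_fact mm) !lognM ?muln_gt0 ?fact_gt0 ?bin_gt0 //.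
have -> : 2 * m - m = m by lia.
by lia.
Qed.

(** Each power p^k <= 2m contributes at most 1 to the difference of the two sums, and larger powers
    contribute 0. *)
Lemma logn_central_bin_le : logn p 'C(2 * m, m) <= trunc_log p (2 * m).
Proof.
rewrite -(leq_add2r (2 * \sum_(1 <= k < (2 * m).+1) m %/ p ^ k)) logn_central_bin.
apply: (@leq_trans (\sum_(1 <= k < (2 * m).+1) ((k <= trunc_log p (2 * m)) + 2 * (m %/ p ^ k)))); last first.
  by rewrite big_split -big_distrr /= leq_add2r sum_leq_const.
apply: leq_sum => k _; have [kL|kL] := leqP k (trunc_log p (2 * m)).
  have pk0 : 0 < p ^ k by rewrite expn_gt0 prime_gt0.
  rewrite -ltnS ltn_divLR //; have := ltn_ceil m pk0; nia.
rewrite divn_small //; apply: leq_trans (trunc_log_ltn _ (prime_gt1 pp)) _.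
by rewrite leq_exp2l ?prime_gt1.
Qed.

Lemma pfactor_central_bin_le : 0 < m -> p ^ logn p 'C(2 * m, m) <= 2 * m.
Proof.
move=> m0; apply: leq_trans (trunc_logP (prime_gt1 pp) _); last by lia.
by rewrite leq_exp2l ?prime_gt1 // logn_central_bin_le.
Qed.

Lemma logn_central_bin_le1 : 2 * m < p ^ 2 -> logn p 'C(2 * m, m) <= 1.
Proof.
move=> p2; apply: leq_trans logn_central_bin_le _.
have [->|m0] := posnP (2 * m); first by rewrite trunc_log0.
rewrite -ltnS -(@ltn_exp2l p) ?prime_gt1 //.
exact: leq_ltn_trans (trunc_logP (prime_gt1 pp) m0) p2.
Qed.

(** Here p goes once into m and twice into 2m, and higher powers exceed 2m. *)
Lemma logn_central_bin_eq0 : 2 * m < p ^ 2 -> p <= m -> 2 * m < 3 * p ->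
  logn p 'C(2 * m, m) = 0.
Proof.
move=> p2 pm mp; have := logn_central_bin; rewrite big_distrr /=.
suff -> : \sum_(1 <= k < (2 * m).+1) 2 * (m %/ p ^ k) = \sum_(1 <= k < (2 * m).+1) (2 * m) %/ p ^ k by lia.
apply: eq_big_nat => -[//|[_|k _]].
  rewrite expn1; have -> : m %/ p = 1 by have := prime_gt0 pp; nia.
  by have := prime_gt0 pp; nia.
have big : 2 * m < p ^ k.+2 
  by apply: (leq_trans p2); apply: leq_pexp2l; rewrite ?prime_gt0.
by rewrite !divn_small //; lia.
Qed.

Lemma logn_central_bin_big : 2 * m < p -> logn p 'C(2 * m, m) = 0.
Proof.
move=> mp; apply/eqP; rewrite -leqn0; apply: leq_trans logn_central_bin_le _.
rewrite -ltnS -(@ltn_exp2l p) ?prime_gt1 // expn1.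
have [->|m0] := posnP (2 * m); first by rewrite trunc_log0 expn0 prime_gt1.
exact: leq_ltn_trans (trunc_logP (prime_gt1 pp) m0) mp.
Qed.

End CentralBinomial.

Lemma prod_window_le N a b c : 0 < c -> \prod_(0 <= p < N) (if a <= p < b then c else 1) <= c ^ (b - a).
Proof.
move=> c0; suff h : \prod_(0 <= p < N) (if a <= p < b then c else 1) <= c ^ (minn N b - a).
  by apply: leq_trans h _; rewrite leq_pexp2l //; lia.
elim: N => [|N IH]; first by rewrite big_geq // expn_gt0 c0.
rewrite big_nat_recr //=; case: ifP => [/andP[aN Nb]|_].
  have -> : minn N.+1 b - a = (minn N b - a).+1 by lia.
  by rewrite expnSr leq_mul2r IH orbT.
by rewrite muln1; apply: leq_trans IH _; rewrite leq_pexp2l //; lia.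
Qed.

(** The final estimate of [prime_interval_large]; its start w = 10 explains the threshold 4^9
    there. *)
Lemma window_exponent_lt w : 10 <= w -> 6 * w * (2 ^ w + 2000) < 4 ^ w.-1.
Proof.
elim: w => // w IH; rewrite leq_eqVlt => /orP[/eqP <-|w10]; first by rewrite /=; lia.
have [v vE] : exists v, w = v.+1 by exists w.-1; lia.
have {IH} := IH w10; rewrite vE /= !expnS.
by move: (2 ^ v) (4 ^ v) => a b; have := leq0n (v * a); nia.
Qed.

(* Erdős' proof of Bertrand's postulate: the exceptional primes, near 0, m and
   2m, each contribute a factor at most [2 * m < 4 ^ w] to the central binomial
   coefficient, and there are at most [2 ^ w + 1999] of them. *)
Theorem prime_interval_large m : 4 ^ 9 <= 2 * m ->
  exists p, [/\ prime p, m + 1997 <= p & p + 3 <= 2 * m].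
Proof.
move=> m9; pose Q (p : 'I_(2 * m)) := [&& prime p, m + 1997 <= p & p + 3 <= 2 * m].
have [/existsP[p /and3P[pp p1 p2]]|/existsPn none] := boolP [exists p, Q p]; first by exists p.
have m0 : 0 < 2 * m by apply: leq_trans m9; rewrite expn_gt0.
pose w := (trunc_log 4 (2 * m)).+1.
have w10 : 10 <= w by rewrite ltnS trunc_log_max.
have mw : 2 * m < 4 ^ w by exact: trunc_log_ltn.
have wm : 4 ^ w.-1 <= 2 * m by exact: trunc_logP.
have c0 : 0 < 4 ^ w by rewrite expn_gt0.
pose C := 'C(2 * m, m); have C0 : 0 < C by rewrite bin_gt0; lia.
pose win a b p := if a <= p < b then 4 ^ w else 1.
have win0 a b p : 0 < win a b p by rewrite /win; case: ifP.
pose small p := if prime p && (p <= (2 * m) %/ 3) then p else 1.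
have small0 p : 0 < small p by rewrite /small; case: ifP => // /andP[/prime_gt0].
have CE : C = \prod_(0 <= p < (2 * m).+1) p ^ logn p C.
  rewrite {1}(@prod_pfactors (2 * m + C) C C0 (leq_addl _ _)).
  have le : (2 * m).+1 <= (2 * m + C).+1 by rewrite ltnS leq_addr.
  rewrite (big_cat_nat (leq0n _) le) /= [X in _ * X]big_nat_cond [X in _ * X]big1 ?muln1 //.
  move=> p /andP[/andP[mp _] _]; have [pp|npp] := boolP (prime p).
    by rewrite logn_central_bin_big.
  by rewrite lognE (negbTE npp).
(* Primes below 2^w, in (m, m + 1997) or from 2m - 2 on lie in a window. From 2^w on valuations are
   at most 1, primes in (2m/3, m] have valuation 0, and by assumption none lies in
   [m + 1997, 2m - 3]. *)
have factor p : p < (2 * m).+1 -> p ^ logn p C <=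
    win 0 (2 ^ w) p * (win m.+1 (m + 1997) p * (win (2 * m - 2) (2 * m).+1 p * small p)).
  move=> p2m; have pos3 : 0 < win (2 * m - 2) (2 * m).+1 p * small p by rewrite muln_gt0 win0 small0.
  have pos2 : 0 < win m.+1 (m + 1997) p * (win (2 * m - 2) (2 * m).+1 p * small p).
    by rewrite muln_gt0 win0.
  have [pp|npp] := boolP (prime p); last by rewrite lognE (negbTE npp) /= muln_gt0 win0.
  have le4 : p ^ logn p C <= 4 ^ w.
    by apply: leq_trans (ltnW mw); apply: pfactor_central_bin_le => //; lia.
  have [pw|pw] := ltnP p (2 ^ w).
    by rewrite {1}/win pw; apply: leq_trans le4 _; rewrite leq_pmulr.
  have p2 : 2 * m < p ^ 2.
    apply: leq_trans mw _; rewrite (_ : 4 ^ w = (2 ^ w) ^ 2); last by rewrite -expnM mulnC expnM.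
    by rewrite leq_exp2r.
  have [ps|ps] := leqP p ((2 * m) %/ 3).
    rewrite /small pp ps /= !mulnA; apply: (@leq_trans p); last by rewrite leq_pmull // !muln_gt0 !win0.
    by rewrite -[leqRHS]expn1 leq_pexp2l ?prime_gt0 // logn_central_bin_le1.
  have [pm|pm] := leqP p m.
    rewrite logn_central_bin_eq0 //; first by rewrite muln_gt0 win0.
    by lia.
  have [pm'|pm'] := ltnP p (m + 1997).
    rewrite {2}/win pm pm' /= mulnCA; apply: leq_trans le4 _.
    by rewrite leq_pmulr // !muln_gt0 !win0 small0.
  have pm2 : 2 * m - 2 <= p.
    have [->|pN] := eqVneq p (2 * m); first by lia.
    have pl : p < 2 * m by lia.
    by have := none (Ordinal pl); rewrite /Q /= pp pm' /= -ltnNge; lia.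
  rewrite {3}/win pm2 p2m /=; apply: leq_trans le4 _.
  by rewrite (mulnC (4 ^ w)) !mulnA leq_pmull // !muln_gt0 !win0 small0.
have Cle : C <= 4 ^ (w * (2 ^ w + 1999) + (2 * m) %/ 3).
  rewrite {1}CE; apply: (@leq_trans (\prod_(0 <= p < (2 * m).+1)
    (win 0 (2 ^ w) p * (win m.+1 (m + 1997) p * (win (2 * m - 2) (2 * m).+1 p * small p))))).
    by rewrite !big_nat; apply: leq_prod => p /andP[_ /factor].
  rewrite !big_split /= expnD expnM.
  have -> : 2 ^ w + 1999 = 2 ^ w - 0 + (m + 1997 - m.+1 + ((2 * m).+1 - (2 * m - 2))) by lia.
  rewrite !expnD -!mulnA !leq_mul ?prod_window_le //.
  by rewrite /small -big_mkcond primorial_le.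
have := central_bin_lower (m := m); rewrite -/C => /(_ ltac:(lia)) low.
have : 4 ^ m <= 4 ^ (w + (w * (2 ^ w + 1999) + (2 * m) %/ 3)).
  by apply: leq_trans low _; rewrite expnD leq_mul // ltnW.
rewrite leq_exp2l // => mle.
(* Comparing exponents bounds 2m by 6 w (2^w + 2000), against 4^(w-1) <= 2m. *)
have := window_exponent_lt w10; move: (2 ^ w) (4 ^ _) wm mle => a b wm mle.
by have := leq_divM (2 * m) 3; nia.
Qed.

End ErdosBertrand.

(** * Nonexistence *)

Section GegenbauerValuations.
Local Open Scope nat_scope.

(** For m >= 40 a prime p in [m + d - 2, 2m + d - 6] is itself of the form 2m + d - 2 - 2 rho with 2
    <= rho <= m/2, and has valuation 1. *)
Lemma slope_prime_exists d m : odd d -> 3 <= d <= 1999 -> 6 <= m ->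
  (d, m) \notin [:: (21, 6); (239, 6); (19, 7); (237, 7)] -> slope_prime m (2 * m + d - 2).
Proof.
move=> od /andP[d3 dmax] m6 exc.
have [m40|m40] := ltnP m 40.
  apply: slope_prime_small; [lia|lia|lia| |move=> m8].
    by rewrite oddB ?oddD ?oddM ?od //; lia.
  have m67 : m = 6 \/ m = 7 by lia.
  move: exc; rewrite !inE !xpair_eqE; case: m67 => ->; lia.
suff [p [pp ap pe]] : exists p, [/\ prime p, m + d - 2 <= p & p + 4 <= 2 * m + d - 2].
  have op : odd p by case: (even_prime pp) => // p2; lia.
  have oe : odd (2 * m + d - 2) by rewrite oddB ?oddD ?oddM ?od //; lia.
  pose rho := (2 * m + d - 2 - p)./2.
  have rhoE : 2 * rho = 2 * m + d - 2 - p.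
    rewrite mul2n -[RHS]odd_double_half oddB ?oe ?op //; lia.
  have pE : 2 * m + d - 2 - 2 * rho = p by lia.
  exists rho, p; rewrite pE logn_prime // eqxx dvdn1; split; [lia|lia|by []|lia|split; [exact: dvdnn|lia]].
(* If m + d - 2 >= 139981, then m >= 137984 exceeds 4^9 / 2, and p >= m + 1997 >= m + d - 2. *)
have [al|al] := boolP (N.of_nat (m + d - 2) <? 139981)%num.
  have [//||p [pp ap pe]] := @prime_interval_middle (m + d - 2) m m40 _ _ al; first by lia.
    by lia.
  by exists p; split => //; lia.
have [|p [pp mp pm]] := @prime_interval_large m; last by exists p; split => //; lia.
by rewrite -(leq_pmul2l (isT : 0 < 1)); lia.
Qed.

Lemma num_factor_gt0 m d i : 0 < m -> 0 < num_factor m d i.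
Proof. by move=> m0; rewrite /num_factor -!addnA ltn_addr. Qed.

Lemma den_factor_gt0 m i : 0 < den_factor m i.
Proof. by rewrite /den_factor addn1. Qed.

Lemma logn_prod_nat p a b (F : nat -> nat) : (forall i, 0 < F i) ->
  logn p (\prod_(a <= i < b) F i) = \sum_(a <= i < b) logn p (F i).
Proof.
move=> F0; rewrite -[logn p _]/(id (logn p _)).
apply: (@proj2 (0 < \prod_(a <= i < b) F i)); elim/big_rec2: _ => [|i s q _ [q0 <-]].
  by rewrite logn1.
by rewrite muln_gt0 F0 q0 lognM.
Qed.

Lemma logn_gegen_coef p m d j : 0 < m -> j <= m./2 ->
  logn p (gegen_coef m d j) = logn p 'C(m./2, j)
    + \sum_(0 <= i < j) logn p (num_factor m d i)
    + \sum_(j <= i < m./2) logn p (den_factor m i).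
Proof.
move=> m0 jk; rewrite /gegen_coef.
have num0 := num_factor_gt0 d _ m0; have den0 := den_factor_gt0 m.
have prod0 a b (F : nat -> nat) : (forall i, 0 < F i) -> 0 < \prod_(a <= i < b) F i.
  by move=> F0; rewrite prodn_gt0.
by rewrite !lognM ?muln_gt0 ?bin_gt0 ?jk ?prod0 // !logn_prod_nat.
Qed.

(** The binomial and the [den_factor] terms involve only numbers up to m < p, and two distinct
    [num_factor] terms differ by twice a positive number below p. *)
Lemma logn_gegen_coef_slope p m d i0 j : prime p -> 1 < m -> m < p -> i0 < m./2 ->
    p %| num_factor m d i0 -> j <= m./2 ->
  logn p (gegen_coef m d j) = (i0 < j) * logn p (num_factor m d i0).
Proof.
move=> pp m1 mp i0k pi0 jk; have kp : m./2 < p by lia.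
have ndvd n : 0 < n < p -> logn p n = 0.
  by case/andP=> n0 np; rewrite logn_coprime // prime_coprime // gtnNdvd.
rewrite logn_gegen_coef //; last exact: ltnW.
have -> : logn p 'C(m./2, j) = 0.
  have fact0 n : n < p -> logn p n`! = 0.
    elim: n => [|n IH] np; first by rewrite logn1.
    by rewrite factS lognM ?fact_gt0 // IH ?ndvd // ltnW.
  have := fact0 _ kp; rewrite -(bin_fact jk) lognM ?bin_gt0 ?muln_gt0 ?fact_gt0 //.
  by case: (logn p _).
rewrite [X in _ + X]big_nat_cond [X in _ + X]big1 ?addn0 ?add0n; last first.
  move=> i /andP[/andP[ji ik] _]; apply: ndvd; rewrite den_factor_gt0 /= /den_factor.
  by have := odd_double_half m; lia.
have numi0 i : i < m./2 -> i != i0 -> logn p (num_factor m d i) = 0.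
  move=> ik ii0; rewrite logn_coprime // prime_coprime //; apply/negP => pi.
  have [lt|lt|ii0'] := ltngtP i i0; last by rewrite ii0' eqxx in ii0.
    have : p %| 2 * (i0 - i).
      have -> : 2 * (i0 - i) = num_factor m d i0 - num_factor m d i by rewrite /num_factor; lia.
      exact: dvdn_sub.
    by rewrite Euclid_dvdM // !gtnNdvd //; lia.
  have : p %| 2 * (i - i0).
    have -> : 2 * (i - i0) = num_factor m d i - num_factor m d i0 by rewrite /num_factor; lia.
    exact: dvdn_sub.
  by rewrite Euclid_dvdM // !gtnNdvd //; lia.
have [i0j|ji0] := ltnP i0 j; last first.
  rewrite big_nat_cond big1 // => i /andP[/andP[_ ij] _]; apply: numi0; first exact: leq_trans jk.
  by rewrite neq_ltn (leq_trans ij ji0).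
rewrite mul1n (big_cat_nat (leq0n i0) (ltnW i0j)) /= (big_ltn i0j).
rewrite [X in X + _]big_nat_cond [X in X + _]big1; last first.
  move=> i /andP[/andP[_ ij] _]; apply: numi0; last by rewrite neq_ltn ij.
  exact: ltn_trans ij i0k.
rewrite add0n [X in _ + X]big_nat_cond [X in _ + X]big1 ?addn0 // => i /andP[/andP[ij il] _].
apply: numi0; first exact: leq_trans il jk.
by rewrite neq_ltn ij orbT.
Qed.

(* The Newton polygon is a single segment of width 3 whose height is not a
   multiple of 3, so that there is no rational root. *)
Lemma newton_cubic_absurd C u p : prime p -> alt_horner C 3 u = 0%R -> u != 0%R ->
    (forall j, j <= 3 -> 0 < C j) ->
    [&& logn p (C 0) < logn p (C 3), ~~ (3 %| logn p (C 3) - logn p (C 0)),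
      2 * logn p (C 0) + logn p (C 3) < 3 * logn p (C 1)
      & logn p (C 0) + 2 * logn p (C 3) < 3 * logn p (C 2)] ->
  False.
Proof.
move=> pp Cu0 u0 C0 /and4P[w03 n3 h1 h2].
have [a0|b0] := coprime_logn_num_den u pp; last first.
  apply: (@newton_polygon_absurd C 3 u p 0) => // -[|[|[|[|//]]]] // _ _; rewrite b0; lia.
have [lt|ge] := ltnP (logn p (C 0) + 3 * logn p `|denq u|) (logn p (C 3)).
  apply: (@newton_polygon_absurd C 3 u p 0) => // -[|[|[|[|//]]]] // _ _; rewrite a0; lia.
apply: (@newton_polygon_absurd C 3 u p 3) => // -[|[|[|[|//]]]] // _ _; rewrite a0; lia.
Qed.

(** All four polynomials are cubic in u = t^2; the prime is 5 for (19, 7) and 3 for the other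
    pairs. *)
Lemma gegen_cubic_rootless d m u : (d, m) \in [:: (21, 6); (239, 6); (19, 7); (237, 7)] ->
  u != 0%R -> alt_horner (gegen_coef m d) m./2 u = 0%R -> False.
Proof.
rewrite !inE !xpair_eqE => /or4P[] /andP[/eqP -> /eqP ->] u0 ru.
- apply: (@newton_cubic_absurd _ u 3 _ ru u0) => // [j j3|]; first exact: gegen_coef_gt0.
  by rewrite !logn_gegen_coef // unlock; vm_compute.
- apply: (@newton_cubic_absurd _ u 3 _ ru u0) => // [j j3|]; first exact: gegen_coef_gt0.
  by rewrite !logn_gegen_coef // unlock; vm_compute.
- apply: (@newton_cubic_absurd _ u 5 _ ru u0) => // [j j3|]; first exact: gegen_coef_gt0.
  by rewrite !logn_gegen_coef // unlock; vm_compute.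
apply: (@newton_cubic_absurd _ u 3 _ ru u0) => // [j j3|]; first exact: gegen_coef_gt0.
by rewrite !logn_gegen_coef // unlock; vm_compute.
Qed.

Definition is_square (n : N) : bool := (N.sqrt n * N.sqrt n =? n)%num.

Lemma is_squareP s n : N.to_nat n = s ^ 2 -> is_square n.
Proof.
move=> ns; have -> : n = (N.of_nat s * N.of_nat s)%num by rewrite -mulnn in ns; lia.
by rewrite /is_square N.sqrt_square N.eqb_refl.
Qed.

Fixpoint square_table (f : N -> N) (len : nat) (d : N) : seq N :=
  if len is l.+1 then
    let t := square_table f l (d + 2)%num in if is_square (f d) then d :: t else t
  else [::].

Lemma square_tableP f len d i : i < len -> is_square (f (d + 2 * N.of_nat i)%num) ->
  (d + 2 * N.of_nat i)%num \in square_table f len d.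
Proof.
elim: len d i => // l IH d [|i] il.
  have -> : (d + 2 * N.of_nat 0 = d)%num by lia.
  by move=> sq; rewrite [square_table _ _ _]/= sq mem_head.
have -> : (d + 2 * N.of_nat i.+1 = d + 2 + 2 * N.of_nat i)%num by lia.
move=> sq; have {IH} := IH (d + 2)%num i il sq; rewrite [square_table _ l.+1 _]/=.
by case: ifP => // _ h; rewrite inE h orbT.
Qed.

(** A computed table of the 999 odd values of d. *)
Lemma square_discriminant4 d s : odd d -> 3 <= d <= 1999 ->
  24 * (d + 1) * (d + 2) = s ^ 2 -> d \in [:: 23; 241].
Proof.
move=> od /andP[d3 dmax] e.
have [i dE] : exists i, d = 3 + 2 * i by exists (d./2 - 1); have := odd_double_half d; rewrite od; lia.
have := @square_tableP (fun d => 24 * (d + 1) * (d + 2))%num 999 3 i.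
have -> : square_table (fun d => 24 * (d + 1) * (d + 2))%num 999 3 = [:: 23; 241]%num by vm_compute.
rewrite !inE => /(_ ltac:(lia)) h.
have /h : is_square (24 * (3 + 2 * N.of_nat i + 1) * (3 + 2 * N.of_nat i + 2)).
  by apply: (@is_squareP s); rewrite -e dE; lia.
by lia.
Qed.

Lemma square_discriminant5 d s : odd d -> 3 <= d <= 1999 ->
  40 * (d + 1) * (d + 4) = s ^ 2 -> d \in [:: 241; 1079].
Proof.
move=> od /andP[d3 dmax] e.
have [i dE] : exists i, d = 3 + 2 * i by exists (d./2 - 1); have := odd_double_half d; rewrite od; lia.
have := @square_tableP (fun d => 40 * (d + 1) * (d + 4))%num 999 3 i.
have -> : square_table (fun d => 40 * (d + 1) * (d + 4))%num 999 3 = [:: 241; 1079]%num by vm_compute.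
rewrite !inE => /(_ ltac:(lia)) h.
have /h : is_square (40 * (3 + 2 * N.of_nat i + 1) * (3 + 2 * N.of_nat i + 4)).
  by apply: (@is_squareP s); rewrite -e dE; lia.
by lia.
Qed.

End GegenbauerValuations.

(** * The bound on m, and the theorem *)

Section GaussNodesBound.
Variables (R : realType) (r m : nat) (T : seq R) (N : R -> nat) (M : nat).
Let d := (2 * r + 3)%N.
Hypotheses (m_gt0 : (0 < m)%N) (M_gt0 : (0 < M)%N) (T_uniq : uniq T).
Hypotheses (N_gt0 : forall t, t \in T -> (0 < N t)%N) (T_size : (size T <= m)%N).
Hypothesis quad : forall k, (k < 2 * m)%N ->
  \sum_(t <- T) (N t)%:R * t ^+ k = M%:R * sphmom R d k.
Hypothesis d_le : (d <= 1999)%N.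
Local Open Scope nat_scope.

Let root := gegen_rational_root m_gt0 M_gt0 T_uniq N_gt0 T_size quad.

Let d_odd : odd d. Proof. by rewrite /d oddD oddM. Qed.
Let d_bounds : 3 <= d <= 1999. Proof. by rewrite d_le andbT leq_addl. Qed.

(** Four pairs are rootless cubics; otherwise a slope prime gives a segment whose width rho would
    have to divide its height. *)
Let gauss_nodes_le5 : m <= 5.
Proof.
rewrite leqNgt; apply/negP => m6.
have [exc|nexc] := boolP ((d, m) \in [:: (21, 6); (239, 6); (19, 7); (237, 7)]).
  by have [u u0] := root (ltac:(lia) : 1 < m); apply: gegen_cubic_rootless.
have [rho [p [rho1 rhom pp mp [pn nrho]]]] := slope_prime_exists d_odd d_bounds m6 nexc.
have numE : num_factor m d (m./2 - rho) = 2 * m + d - 2 - 2 * rho.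
  by rewrite /num_factor; have := odd_double_half m; have := d_bounds; lia.
rewrite -numE in pn nrho.
have i0k : m./2 - rho < m./2 by lia.
have v0 : 0 < logn p (num_factor m d (m./2 - rho)).
  by rewrite logn_gt0 mem_primes pp pn num_factor_gt0.
have m1 : 1 < m by lia.
have slope j : j <= m./2 -> _ := @logn_gegen_coef_slope p m d _ j pp m1 mp i0k pn.
have := gegen_slope m_gt0 M_gt0 T_uniq N_gt0 T_size quad pp i0k v0.
have -> : m./2 - (m./2 - rho) = rho by lia.
rewrite (negbTE nrho) -/d => h.
suff : false by []; apply: h => j.
  by move=> ji; rewrite slope ?ltnNge ?ji //; lia.
by move=> ij jk; rewrite slope // ij mul1n.
Qed.

(** The discriminants in u = t^2 are exactly 24 (d + 1) (d + 2) for m = 4 and 40 (d + 1) (d + 4) for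
    m = 5. *)
Theorem gauss_nodes_bound :
  m \in [:: 1; 2; 3] \/ (d, m) \in [:: (23, 4); (241, 4); (241, 5); (1079, 5)].
Proof.
have [m3|m3] := leqP m 3; first by left; rewrite !inE; lia.
right; have m45 : m = 4 \/ m = 5 by have := gauss_nodes_le5; lia.
have [u _] := root (ltac:(lia) : 1 < m); rewrite -/d !inE !xpair_eqE.
case: m45 => ->.
  have C0 : gegen_coef 4 d 0 = 3.
    by rewrite /gegen_coef unlock.
  have C1 : gegen_coef 4 d 1 = 6 * (d + 2) by rewrite /gegen_coef unlock /= /num_factor /den_factor /= ?bin1 ?binn; lia.
  have C2 : gegen_coef 4 d 2 = (d + 2) * (d + 4) by rewrite /gegen_coef unlock /= /num_factor /den_factor /= ?bin1 ?binn; lia.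
  move=> /quadratic_discriminant_square; rewrite C0 C1 C2 -mulnn.
  case=> [|s sE]; first by nia.
  have /(square_discriminant4 d_odd d_bounds) : 24 * (d + 1) * (d + 2) = s ^ 2 by rewrite -sE; nia.
  by rewrite !inE; lia.
have C0 : gegen_coef 5 d 0 = 15 by rewrite /gegen_coef unlock.
have C1 : gegen_coef 5 d 1 = 10 * (d + 4) by rewrite /gegen_coef unlock /= /num_factor /den_factor /= ?bin1 ?binn; lia.
have C2 : gegen_coef 5 d 2 = (d + 4) * (d + 6) by rewrite /gegen_coef unlock /= /num_factor /den_factor /= ?bin1 ?binn; lia.
move=> /quadratic_discriminant_square; rewrite C0 C1 C2 -mulnn.
case=> [|s sE]; first by nia.
have /(square_discriminant5 d_odd d_bounds) : 40 * (d + 1) * (d + 4) = s ^ 2 by rewrite -sE; nia.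
by rewrite !inE; lia.
Qed.

End GaussNodesBound.

(** Grouping the points by t = <z, x> turns the design identity at z into a quadrature whose weight
    at t is the number of points of that slice. *)
Lemma stiff_configuration_bound (R : realType) (r m : nat) (X : {fset 'rV[R]_(2 * r + 2).+1}) :
    (0 < m)%N -> (2 * r + 3 <= 1999)%N -> stiff_configuration m X ->
  m \in [:: 1; 2; 3]%N \/
  ((2 * r + 3, m) \in [:: (23, 4); (241, 4); (241, 5); (1079, 5)])%N.
Proof.
move=> m0 rmax [/spherical_designP[X0 Xs XP] [z z1 zm]].
pose N t := count (fun x => dotp z x == t) X.
apply: (@gauss_nodes_bound R r m (inner_products z X) N #|` X|) => //.
- by rewrite cardfs_gt0.
- exact: fset_uniq.
- by move=> t /imfsetP[x /= xX ->]; rewrite -has_count; apply/hasP; exists x.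
move=> k km; have := XP z k (ltac:(lia)); rewrite z1 expr1n mulr1.
have <- : (2 * r + 2).+1 = (2 * r + 3)%N by lia.
move=> <-; transitivity (\sum_(t <- inner_products z X) \sum_(x <- X | dotp z x == t) dotp z x ^+ k).
  apply: eq_bigr => t _; rewrite /N -sum1_count natr_sum mulr_suml.
  by apply: eq_bigr => x /eqP ->; rewrite mul1r.
rewrite (exchange_big_dep xpredT) //= big_seq [RHS]big_seq; apply: eq_bigr => x xX.
have xT : dotp z x \in inner_products z X by apply/imfsetP; exists x.
rewrite big_mkcond (bigD1_seq _ xT) ?fset_uniq //= eqxx big1 ?addr0 // => t.
by rewrite eq_sym => /negbTE ->.
Qed.

Theorem theorem4p3 (R : realType) (d m : nat)
    (d_odd : odd d) (d_ge3 : (3 <= d)%N) (d_le1999 : (d <= 1999)%N)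
    (m_ge1 : (1 <= m)%N) :
  (exists X : {fset 'rV[R]_d}, stiff_configuration m X) <->
  (m \in [:: 1; 2; 3]%N) \/
  ((d, m) \in [:: (23, 4); (241, 4); (241, 5); (1079, 5)]%N).
Proof.
split=> [[X Xm]|].
  have [r dE] : exists r, d = (2 * r + 2).+1.
    by exists (d./2 - 1)%N; have := odd_double_half d; rewrite d_odd; lia.
  subst d; have -> : ((2 * r + 2).+1 = 2 * r + 3)%N by lia.
  by apply: stiff_configuration_bound Xm => //; lia.
have [n dE] : exists n, d = n.+3 by exists (d - 3)%N; lia.
case; rewrite !inE ?xpair_eqE.
  rewrite dE => /or3P[] /eqP ->; [exact: stiff1|exact: stiff2|exact: stiff3].
case/or4P=> /andP[/eqP -> /eqP ->];
  [exact: stiff4_23|exact: stiff4_241|exact: stiff5_241|exact: stiff5_1079].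
Qed.
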